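(* Let $a>0$, $a\neq 1$, and assume $0<s<a/4$. Let $\{t_n\}_{n=1}^\infty$ be a decreasing sequence of real numbers with $\lim_{n\to\infty}t_n=0$ and assume that the sequence $\{t_n-t_{n+1}\}_{n=1}^\infty$ is also decreasing. Then the following statements (a), (b), (c) are equivalent. (a) The sequence $\{t_n\}$ belongs to $\ell^{\frac{2s}{a-4s},\infty}(\mathbb{N})$. (b) There is a constant $C_1$ such that for all $f\in H^s(\mathbb{R})$ we have $$\Big\|\sup_{n\in\mathbb{N}}|S^af(\cdot,t_n)|\Big\|_{L^2(\mathbb{R})}\le C_1\|f\|_{H^s}.$$ (c) There is a constant $C_2$ such that for all $f\in H^s(\mathbb{R})$ and all $\alpha>0$, $$\mathrm{meas}\big(\{x\in\mathbb{R}:\sup_{n\in\mathbb{N}}|S^af(x,t_n)|>\alpha\}\big)\le C_2\,\alpha^{-2}\|f\|_{H^s}^2.$$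
   Context: ''Decreasing'' means nonincreasing. $\mathrm{meas}$ is Lebesgue measure on $\mathbb{R}$. The Fourier transform is $\widehat f(\xi)=\int_{\mathbb{R}}f(x)e^{-ix\xi}\,dx$. The Sobolev space $H^s=H^s(\mathbb{R})$ consists of all distributions $f$ with $\|f\|_{H^s}:=\big(\int(1+|\xi|^2)^s|\widehat f(\xi)|^2\,d\xi\big)^{1/2}<\infty$. For $a>0$ the generalized Schrödinger means are $$S^af(x,t)=\int_{\mathbb{R}}e^{i(x\xi+t|\xi|^a)}\widehat f(\xi)\,\frac{d\xi}{2\pi}$$ for Schwartz functions $f$; for fixed $t$ the operator $f\mapsto S^af(\cdot,t)$ extends to all $f\in H^s$ (as the Fourier multiplier operator with multiplier $e^{it|\xi|^a}$). For $0<r<\infty$, $\{t_n\}\in\ell^{r,\infty}(\mathbb{N})$ means $\sup_{b>0}b^r\,\#\{n\in\mathbb{N}:|t_n|>b\}<\infty$. *)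

(* Defs.v *)
From HB Require Import structures.
From mathcomp Require Import all_boot all_order all_algebra.
From mathcomp Require Import complex.
From mathcomp Require Import all_classical all_reals all_analysis.

Set Implicit Arguments.
Unset Strict Implicit.
Unset Printing Implicit Defensive.

Import Order.TTheory GRing.Theory Num.Theory.
Import numFieldNormedType.Exports.

Local Open Scope classical_set_scope.
Local Open Scope ring_scope.
Local Open Scope complex_scope.

(* [`|z|] on [R[i]] is valued in [R[i]]; [cabs] is the same number in [R]. *)
Definition cabs (R : realType) (z : R[i]) : R := ComplexField.Normc.normc z.

Definition cis (R : realType) (theta : R) : R[i] := cos theta +i* sin theta.

(* The library has no measure or differential structure on [R[i]]:
   measurability, integration and differentiation of functions [R -> R[i]]
   are taken on real and imaginary parts. *)
Definition re_part (R : realType) (f : R -> R[i]) : R -> R :=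
  fun x => complex.Re (f x).

Definition im_part (R : realType) (f : R -> R[i]) : R -> R :=
  fun x => complex.Im (f x).

Definition cmeasurable (R : realType) (f : R -> R[i]) : Prop :=
  measurable_fun setT (re_part f) /\ measurable_fun setT (im_part f).

Definition cintegrable (R : realType) (f : R -> R[i]) : Prop :=
  (@lebesgue_measure R).-integrable setT (EFin \o re_part f) /\
  (@lebesgue_measure R).-integrable setT (EFin \o im_part f).

Definition cintegral (R : realType) (f : R -> R[i]) : R[i] :=
  (\int[@lebesgue_measure R]_x re_part f x) +i*
  (\int[@lebesgue_measure R]_x im_part f x).

Definition cderiven (R : realType) (m : nat) (f : R -> R[i]) : R -> R[i] :=
  fun x => derive1n m (re_part f) x +i* derive1n m (im_part f) x.

Definition csmooth (R : realType) (f : R -> R[i]) : Prop :=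
  forall (m : nat) (x : R),
    derivable (derive1n m (re_part f)) x 1 /\
    derivable (derive1n m (im_part f)) x 1.

Definition schwartz_seminorm (R : realType) (k m : nat) (f : R -> R[i])
    : \bar R :=
  ereal_sup (range (fun x : R => (`|x| ^+ k * cabs (cderiven m f x))%:E)).

Definition schwartz (R : realType) (f : R -> R[i]) : Prop :=
  csmooth f /\ forall k m : nat, (schwartz_seminorm k m f < +oo)%E.

Definition fourier (R : realType) (f : R -> R[i]) : R -> R[i] :=
  fun xi => cintegral (fun x => f x * cis (- (x * xi))).

Definition inv_fourier (R : realType) (f : R -> R[i]) : R -> R[i] :=
  fun x => ((2 * pi)^-1)%:C * cintegral (fun xi => f xi * cis (x * xi)).

(* Functionals are total on [R -> R[i]]; only their values on Schwartz
   functions are meaningful. *)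
Definition functional (R : realType) : Type := (R -> R[i]) -> R[i].

Definition tempered_distribution (R : realType) (u : functional R) : Prop :=
  (forall (c : R[i]) (phi psi : R -> R[i]), schwartz phi -> schwartz psi ->
     u (fun x => c * phi x + psi x) = c * u phi + u psi) /\
  (exists (N : nat) (M : R), forall phi : R -> R[i], schwartz phi ->
     ((cabs (u phi))%:E <=
      M%:E * \sum_(k < N.+1) \sum_(m < N.+1) schwartz_seminorm k m phi)%E).

Definition distr_of_fun (R : realType) (g : R -> R[i]) : functional R :=
  fun phi => cintegral (fun x => g x * phi x).

Definition distr_fourier (R : realType) (u : functional R) : functional R :=
  fun phi => u (fourier phi).

Definition distr_inv_fourier (R : realType) (u : functional R)
    : functional R :=
  fun phi => u (inv_fourier phi).

Definition is_density (R : realType) (u : functional R) (g : R -> R[i])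
    : Prop :=
  cmeasurable g /\
  forall phi : R -> R[i], schwartz phi ->
    cintegrable (fun x => g x * phi x) /\ u phi = distr_of_fun g phi.

(* A function representing [u], unique up to Lebesgue-null sets when there is
   one; the zero function (a junk value) otherwise. *)
Definition density (R : realType) (u : functional R) : R -> R[i] :=
  xget (fun _ : R => 0 : R[i]) [set g | is_density u g].

Definition fhat (R : realType) (f : functional R) : R -> R[i] :=
  density (distr_fourier f).

Definition sobolev_norm (R : realType) (s : R) (f : functional R) : \bar R :=
  ((\int[@lebesgue_measure R]_xi
      (((1 + `|xi| ^+ 2) `^ s) * cabs (fhat f xi) ^+ 2)%:E) `^ (2^-1))%E.

(* The existence clause excludes the junk value of [fhat]. *)
Definition sobolev (R : realType) (s : R) (f : functional R) : Prop :=
  tempered_distribution f /\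
  (exists g : R -> R[i], is_density (distr_fourier f) g) /\
  (sobolev_norm s f < +oo)%E.

(* The function [S^a f(., t)], i.e. the inverse Fourier transform, in the sense
   of distributions, of [exp(i t |xi|^a) * fhat f xi]. For [f] in [H^s] with
   [0 <= s] it lies in [L^2] and is thus determined almost everywhere. *)
Definition schrodinger_mean (R : realType) (a : R) (f : functional R) (t : R)
    : R -> R[i] :=
  density (distr_inv_fourier
    (distr_of_fun (fun xi => cis (t * `|xi| `^ a) * fhat f xi))).

Definition schrodinger_maximal (R : realType) (a : R) (t : nat -> R)
    (f : functional R) (x : R) : \bar R :=
  ereal_sup (range (fun n : nat => (cabs (schrodinger_mean a f (t n) x))%:E)).

Definition weak_ell (R : realType) (r : R) (t : nat -> R) : Prop :=
  (ereal_sup [set (b `^ r)%:E * counting [set n : nat | (b < `|t n|)%R]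
             | b in [set b : R | (0 < b)%R]] < +oo)%E.

(* Main.v *)
(** Sufficiency: [fhat f] is cut into dyadic frequency bands and the times into
    blocks [tau Gam^-(j+1) <= t_n < tau Gam^-j] with [Gam = 2^(a-4s)].  On a band of
    frequency [2^k], times below [2^(-ka)] cost nothing; on the block [j >= k] the
    linearised maximal operator is bounded by a [T T^*] argument, its kernel being
    estimated by integration by parts; on the blocks [j < k] the weak [l^r] condition
    bounds the number of times, and a union bound suffices.  Both bounds carry a
    factor decaying geometrically in [|j - k|], so the bands can be summed.  The
    frequencies [|xi| <= 1] are handled by telescoping in [n].

    Necessity: let [k + 1] of the times lie in [(b, 2b]].  Convexity of [t] bounds the
    later gaps by [b/k].  The mean of a wave packet of frequency [lam] and band
    width [rho] is of size at least [c rho] along the times, on points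
    [x = - a lam^(a-1) t_n] up to [1/(4 rho)], and for suitable [lam], [rho] these cover
    [[-a lam^(a-1) b, 0]].  The weak type inequality then gives
    [k <= C b^(-2s/(a-4s))], and summation over [b, 2b, 4b, ...] gives (a). *)

Require Import Defs.
From HB Require Import structures.
From mathcomp Require Import all_boot all_order all_algebra.
From mathcomp Require Import complex.
From mathcomp Require Import all_classical all_reals all_analysis.
From mathcomp Require Import measurable_realfun ring lra.

Set Implicit Arguments.
Unset Strict Implicit.
Unset Printing Implicit Defensive.

Import Order.TTheory GRing.Theory Num.Theory.
Import numFieldNormedType.Exports.

Local Open Scope classical_set_scope.
Local Open Scope ring_scope.

(** * Complex-valued integrals *)

(** The exponents come from one balance. With [B = 4^s] one has [2^a = Gam B^2], and the weak [l^r]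
    condition says that at most a constant times [B^j] of the times lie above [tau Gam^-(j+1)]. On
    band [k] the kernel bound loses [sqrt (Gam^-j 2^(ka)) = B^k Gam^(-(j-k)/2)] when [j >= k], the
    union bound loses [B^j = B^k B^-(k-j)] when [j < k], and the Sobolev weight pays for [B^k] in
    both cases. The condition [a <> 1] provides curvature: the second derivative of [u^a] must not
    vanish.

    A second obstacle is that a mean is an arbitrary representative of a distribution. It is
    identified almost everywhere with the limit of dyadic partial sums or, for a wave packet, with
    an explicit oscillatory integral, and the estimates are made on these. The [L^2] theory stays
    one-sided: a Bessel inequality is the case of time zero of the kernel argument, and Fourier
    inversion is proved for one profile up to a nonzero constant, which is enough since constants
    are immaterial here. *)

Section cplx.
Context {R : realType}.
Implicit Types z w : R[i].

Lemma ReM z w : complex.Re (z * w) =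
  complex.Re z * complex.Re w - complex.Im z * complex.Im w.
Proof. by case: z w => [a b] [c d]. Qed.

Lemma ImM z w : complex.Im (z * w) =
  complex.Re z * complex.Im w + complex.Im z * complex.Re w.
Proof. by case: z w => [a b] [c d]. Qed.

Lemma ReD z w : complex.Re (z + w) = complex.Re z + complex.Re w.
Proof. by case: z w => [a b] [c d]. Qed.

Lemma ImD z w : complex.Im (z + w) = complex.Im z + complex.Im w.
Proof. by case: z w => [a b] [c d]. Qed.

Lemma ReN z : complex.Re (- z) = - complex.Re z.
Proof. by case: z. Qed.

Lemma ImN z : complex.Im (- z) = - complex.Im z.
Proof. by case: z. Qed.

Lemma ReJ z : complex.Re (conjc z) = complex.Re z.
Proof. by case: z. Qed.

Lemma ImJ z : complex.Im (conjc z) = - complex.Im z.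
Proof. by case: z. Qed.

Definition cplxE := (ReM, ImM, ReD, ImD, ReN, ImN, ReJ, ImJ).

Lemma cplx_ext z w : complex.Re z = complex.Re w ->
  complex.Im z = complex.Im w -> z = w.
Proof. by case: z w => [a b] [c d] /= -> ->. Qed.

Lemma cabs2 z : cabs z ^+ 2 = complex.Re z ^+ 2 + complex.Im z ^+ 2.
Proof.
case: z => [a b]; rewrite /cabs /= sqr_sqrtr//.
by rewrite addr_ge0 ?sqr_ge0.
Qed.

Lemma cabs_ge0 z : 0 <= cabs z.
Proof. by case: z => [a b]; exact: sqrtr_ge0. Qed.

Lemma cabsM z w : cabs (z * w) = cabs z * cabs w.
Proof. exact: ComplexField.Normc.normcM. Qed.

Lemma cabsD z w : cabs (z + w) <= cabs z + cabs w.
Proof. exact: le_normcD. Qed.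

Lemma cabs0 : cabs (0 : R[i]) = 0.
Proof. by rewrite /cabs /= expr0n /= addr0 sqrtr0. Qed.

Lemma cabs_eq2 z w : cabs z ^+ 2 = cabs w ^+ 2 -> cabs z = cabs w.
Proof. by move=> /eqP; rewrite eqrXn2 ?cabs_ge0// => /eqP. Qed.

Lemma cabsN z : cabs (- z) = cabs z.
Proof. by apply: cabs_eq2; rewrite !cabs2 ReN ImN !sqrrN. Qed.

Lemma cabsJ z : cabs (conjc z) = cabs z.
Proof. by apply: cabs_eq2; rewrite !cabs2 ReJ ImJ sqrrN. Qed.

Lemma cabsR (r : R) : cabs (r%:C)%C = `|r|.
Proof. by rewrite /cabs /= expr0n addr0 sqrtr_sqr. Qed.

Lemma Re_cabs z : `|complex.Re z| <= cabs z.
Proof.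
rewrite -(@ler_pXn2r _ 2) ?nnegrE ?cabs_ge0 ?normr_ge0//.
by rewrite cabs2 real_normK ?num_real// lerDl sqr_ge0.
Qed.

Lemma Im_cabs z : `|complex.Im z| <= cabs z.
Proof.
rewrite -(@ler_pXn2r _ 2) ?nnegrE ?cabs_ge0 ?normr_ge0//.
by rewrite cabs2 real_normK ?num_real// lerDr sqr_ge0.
Qed.

Lemma cabs_ReIm z : cabs z <= `|complex.Re z| + `|complex.Im z|.
Proof.
rewrite -(@ler_pXn2r _ 2) ?nnegrE ?cabs_ge0 ?addr_ge0 ?normr_ge0//.
by rewrite cabs2 sqrrD !real_normK ?num_real// lerD2r lerDl mulrn_wge0// mulr_ge0.
Qed.

Lemma cis_abs (x : R) : cabs (cis x) = 1.
Proof. by rewrite /cabs /= cos2Dsin2 sqrtr1. Qed.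

Lemma cisD (x y : R) : cis (x + y) = cis x * cis y.
Proof. by apply: cplx_ext; rewrite cplxE /= ?cosD ?sinD; ring. Qed.

Lemma cisJ (x : R) : conjc (cis x) = cis (- x).
Proof. by apply: cplx_ext; rewrite cplxE /= ?cosN ?sinN. Qed.

Lemma mulJ z : conjc z * z = ((cabs z ^+ 2)%:C)%C.
Proof. by apply: cplx_ext; rewrite !cplxE /= ?cabs2; ring. Qed.

End cplx.

Section cmeas.
Context {R : realType} d (T : measurableType d).
Implicit Types f g : T -> R[i].

(** On the line this unfolds to [cmeasurable]. The domain is left general because the Fubini
    arguments need it on [R * R]. *)
Definition cmeas f := measurable_fun setT (fun x => complex.Re (f x)) /\
  measurable_fun setT (fun x => complex.Im (f x)).

Lemma cmeasD f g : cmeas f -> cmeas g -> cmeas (fun x => f x + g x).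
Proof.
move=> [f1 f2] [g1 g2]; split.
  by under eq_fun do rewrite ReD; exact: measurable_funD.
by under eq_fun do rewrite ImD; exact: measurable_funD.
Qed.

Lemma cmeasM f g : cmeas f -> cmeas g -> cmeas (fun x => f x * g x).
Proof.
move=> [f1 f2] [g1 g2]; split.
  by under eq_fun do rewrite ReM; apply: measurable_funB; exact: measurable_funM.
by under eq_fun do rewrite ImM; apply: measurable_funD; exact: measurable_funM.
Qed.

Lemma cmeasN f : cmeas f -> cmeas (fun x => - f x).
Proof.
move=> [f1 f2]; split.
  by under eq_fun do rewrite ReN; exact: measurableT_comp.
by under eq_fun do rewrite ImN; exact: measurableT_comp.
Qed.

Lemma cmeasJ f : cmeas f -> cmeas (fun x => conjc (f x)).
Proof.
move=> [f1 f2]; split.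
  by under eq_fun do rewrite ReJ.
by under eq_fun do rewrite ImJ; exact: measurableT_comp.
Qed.

Lemma cmeas_cst (c : R[i]) : cmeas (fun=> c).
Proof. by split; exact: measurable_cst. Qed.

Lemma cmeasR (f : T -> R) : measurable_fun setT f -> cmeas (fun x => (f x)%:C)%C.
Proof. by move=> mf; split => //; exact: measurable_cst. Qed.

Lemma cmeas_cis (f : T -> R) : measurable_fun setT f -> cmeas (fun x => cis (f x)).
Proof.
move=> mf; split => /=; apply: measurableT_comp mf; apply: continuous_measurable_fun.
  exact: continuous_cos.
exact: continuous_sin.
Qed.

Lemma measurable_cabs f : cmeas f -> measurable_fun setT (fun x => cabs (f x)).
Proof.
move=> [f1 f2]; rewrite [X in measurable_fun _ X](_ : _ = fun x =>
    Num.sqrt (complex.Re (f x) ^+ 2 + complex.Im (f x) ^+ 2)); last first.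
  by apply/funext => x; rewrite -cabs2 sqrtr_sqr ger0_norm ?cabs_ge0.
apply: measurableT_comp.
  by apply: continuous_measurable_fun => x; exact: sqrt_continuous.
by apply: measurable_funD; exact: measurable_funX.
Qed.

Lemma cmeas_if (b : T -> bool) f g : measurable_fun setT b -> cmeas f -> cmeas g ->
  cmeas (fun x => if b x then f x else g x).
Proof.
move=> mb [f1 f2] [g1 g2]; split.
  under eq_fun do rewrite fun_if.
  by apply: measurable_fun_if => //; exact: measurable_funTS.
under eq_fun do rewrite fun_if.
by apply: measurable_fun_if => //; exact: measurable_funTS.
Qed.

End cmeas.

Lemma cmeas_comp {R : realType} d d' (T : measurableType d) (U : measurableType d')
  (f : T -> R[i]) (h : U -> T) : cmeas f -> measurable_fun setT h ->
  cmeas (fun x => f (h x)).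
Proof.
by move=> [f1 f2] mh; split; [exact: (measurableT_comp f1)|exact: (measurableT_comp f2)].
Qed.

Notation mu := (@lebesgue_measure _).
Notation "f '\is_int'" := ((@lebesgue_measure _).-integrable setT (EFin \o f)) (at level 50).

Section integ.
Context {R : realType}.
Implicit Types f g : R -> R.

Lemma int_le f g : measurable_fun setT f -> (forall x, `|f x| <= g x) ->
  g \is_int -> f \is_int.
Proof.
move=> mf fg; apply: le_integrable => //; first exact/measurable_EFinP.
move=> x _ /=; rewrite lee_fin; apply: le_trans (fg x) _; exact: ler_norm.
Qed.

Lemma intP f : measurable_fun setT f ->
  (\int[mu]_x (`|f x|%:E) < +oo)%E -> f \is_int.
Proof. by move=> mf h; apply/integrableP; split => //; exact/measurable_EFinP. Qed.

Lemma int_meas f : f \is_int -> measurable_fun setT f.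
Proof. by move=> /measurable_int/measurable_EFinP. Qed.

Lemma intD f g : f \is_int -> g \is_int -> (fun x => f x + g x) \is_int.
Proof. by move=> f1 g1; exact: (integrableD _ f1 g1). Qed.

Lemma intB f g : f \is_int -> g \is_int -> (fun x => f x - g x) \is_int.
Proof. by move=> f1 g1; exact: (integrableB _ f1 g1). Qed.

Lemma intZ (c : R) f : f \is_int -> (fun x => c * f x) \is_int.
Proof. by move=> f1; exact: (integrableZl measurableT _ f1). Qed.

Lemma intZr (c : R) f : f \is_int -> (fun x => f x * c) \is_int.
Proof. by move=> /(intZ c); under eq_fun do rewrite mulrC. Qed.

Lemma Rint_EFin f : f \is_int -> ((\int[mu]_x f x)%:E = \int[mu]_x (f x)%:E)%E.
Proof. by move=> h; rewrite fineK//; exact: integrable_fin_num h. Qed.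

Lemma cintegrable_le (f : R -> R[i]) g : cmeas f -> (forall x, cabs (f x) <= g x) ->
  g \is_int -> cintegrable f.
Proof.
move=> [f1 f2] fg ig; split; apply: int_le ig => // x.
  exact: le_trans (Re_cabs _) (fg x).
exact: le_trans (Im_cabs _) (fg x).
Qed.

Lemma cintegrable_cmeas (f : R -> R[i]) : cintegrable f -> cmeas f.
Proof. by move=> [/int_meas f1 /int_meas f2]. Qed.

Lemma cintegrable_cabs (f : R -> R[i]) : cintegrable f -> (fun x => cabs (f x)) \is_int.
Proof.
move=> fi; have [f1 f2] := fi.
apply: (@int_le _ (fun x => `|re_part f x| + `|im_part f x|)).
- by apply: measurable_cabs; exact: cintegrable_cmeas.
- by move=> x; rewrite ger0_norm ?cabs_ge0//; exact: cabs_ReIm.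
- by apply: intD; exact: integrable_norm.
Qed.

Lemma cintegralD (f g : R -> R[i]) : cintegrable f -> cintegrable g ->
  cintegral (fun x => f x + g x) = cintegral f + cintegral g.
Proof.
move=> [f1 f2] [g1 g2]; apply: cplx_ext; rewrite ?cplxE /=.
  by rewrite -RintegralD//; apply: eq_Rintegral => x _; rewrite /re_part ReD.
by rewrite -RintegralD//; apply: eq_Rintegral => x _; rewrite /im_part ImD.
Qed.

Lemma cintegralZ (c : R[i]) (f : R -> R[i]) : cintegrable f ->
  cintegral (fun x => c * f x) = c * cintegral f.
Proof.
move=> [f1 f2]; apply: cplx_ext; rewrite ?cplxE /=.
  rewrite -!RintegralZl// -RintegralB//; try exact: intZ.
  by apply: eq_Rintegral => x _; rewrite /re_part ReM.
rewrite -!RintegralZl// -RintegralD//; try exact: intZ.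
by apply: eq_Rintegral => x _; rewrite /im_part ImM.
Qed.

Lemma cintegralJ (f : R -> R[i]) :  cintegrable f ->
  cintegral (fun x => conjc (f x)) = conjc (cintegral f).
Proof.
move=> [f1 f2]; apply: cplx_ext; rewrite ?cplxE /=.
  by apply: eq_Rintegral => x _; rewrite /re_part ReJ.
rewrite -mulN1r -RintegralZl//.
by apply: eq_Rintegral => x _; rewrite /im_part ImJ mulN1r.
Qed.

Lemma eq_cintegral (f g : R -> R[i]) : f =1 g -> cintegral f = cintegral g.
Proof. by move=> /funext ->. Qed.

(** With [I] the integral, multiplication by [conjc I] rotates it onto the positive axis: [|I|^2] is
    the integral of [Re (conjc I * f)], hence at most [|I|] times the integral of [|f|]. Since [|I|]
    is cancelled, [I = 0] is a separate case. *)
Lemma le_cabs_cintegral (f : R -> R[i]) : cintegrable f ->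
  cabs (cintegral f) <= \int[mu]_x cabs (f x).
Proof.
move=> fi; set I := cintegral f.
have [->|I0] := eqVneq (cabs I) 0.
  by apply: Rintegral_ge0 => x _; exact: cabs_ge0.
have Ip : 0 < cabs I by rewrite lt_neqAle eq_sym I0 cabs_ge0.
rewrite -(ler_pM2l Ip) -expr2.
have -> : cabs I ^+ 2 = complex.Re (cintegral (fun x => conjc I * f x)).
  by rewrite cintegralZ// mulJ.
have fa := cintegrable_cabs fi.
have cIf : cintegrable (fun x => conjc I * f x).
  apply: (@cintegrable_le _ (fun x => cabs I * cabs (f x))).
  - by apply: cmeasM; [exact: cmeas_cst|exact: cintegrable_cmeas].
  - by move=> x; rewrite cabsM cabsJ.
  - exact: intZ.
rewrite (_ : complex.Re _ = \int[mu]_x complex.Re (conjc I * f x))//.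
rewrite -RintegralZl//; apply: le_Rintegral => //.
- by case: cIf.
- exact: intZ.
- by move=> x _; rewrite (le_trans (ler_norm _))// (le_trans (Re_cabs _))// cabsM cabsJ.
Qed.

End integ.

(** * Fubini's theorem for kernels dominated by a tensor product *)

Section fubini.
Context {R : realType}.
Variables (f : R * R -> R) (u v : R -> R).
Hypothesis mf : measurable_fun setT f.
Hypotheses (iu : u \is_int) (iv : v \is_int).
Hypothesis fuv : forall x y, `|f (x, y)| <= u x * v y.
Let v0 x y : 0 <= u x * v y. Proof. exact: le_trans (fuv x y). Qed.

Let ix x : (fun y => f (x, y)) \is_int.
Proof.
apply: (@int_le _ _ (fun y => u x * v y)) => //; last exact: intZ.
apply: (measurableT_comp mf); exact: measurable_pair1.
Qed.

Let iy y : (fun x => f (x, y)) \is_int.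
Proof.
apply: (@int_le _ _ (fun x => u x * v y)) => //; last exact: intZr.
apply: (measurableT_comp mf); exact: measurable_pair2.
Qed.

Let int2 : ((@lebesgue_measure R) \x (@lebesgue_measure R))%E.-integrable setT (EFin \o f).
Proof.
apply/integrable12ltyP; first exact/measurable_EFinP.
have h x : (\int[mu]_y `|(EFin \o f) (x, y)| <= (u x * \int[mu]_y v y)%:E)%E.
  rewrite -RintegralZl// Rint_EFin; last exact: intZ.
  apply: ge0_le_integral => //=.
  - by apply/measurable_EFinP; apply: measurableT_comp => //; exact: int_meas (ix x).
  - by apply/measurable_EFinP; apply: measurable_funM => //; exact: int_meas.
  - by move=> y _; rewrite lee_fin.
apply: (@le_lt_trans _ _ (\int[mu]_x (u x * \int[mu]_y v y)%:E)%E).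
  apply: ge0_le_integral => //=.
  - move=> x _; exact: integral_ge0.
  - have mnf : measurable_fun setT (fun z => (`|f z|)%:E).
      by apply/measurable_EFinP; exact: measurableT_comp.
    exact: (measurable_fun_fubini_tonelli_F (m2 := mu) _ mnf).
  - by apply/measurable_EFinP; apply: measurable_funM => //; exact: int_meas.
  - by move=> x _; exact: h.
have iuv : (fun x => u x * \int[mu]_y v y) \is_int by exact: intZr.
exact: integrable_lty iuv.
Qed.

Lemma measurable_Rint1 : measurable_fun setT (fun x => \int[mu]_y f (x, y)).
Proof. by apply: measurableT_comp => //; exact: (measurable_fubini_F int2). Qed.

Lemma measurable_Rint2 : measurable_fun setT (fun y => \int[mu]_x f (x, y)).
Proof. by apply: measurableT_comp => //; exact: (measurable_fubini_G int2). Qed.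

Lemma Rfubini : \int[mu]_x (\int[mu]_y f (x, y)) = \int[mu]_y (\int[mu]_x f (x, y)).
Proof.
rewrite /Rintegral.
under eq_integral do rewrite fineK ?(integrable_fin_num _ (ix _))//.
rewrite (Fubini int2).
by under [in RHS]eq_integral do rewrite fineK ?(integrable_fin_num _ (iy _))//.
Qed.

End fubini.

Section cfubini.
Context {R : realType}.
Variables (f : R * R -> R[i]) (u v : R -> R).
Hypothesis mf : cmeas f.
Hypotheses (iu : u \is_int) (iv : v \is_int).
Hypothesis fuv : forall x y, cabs (f (x, y)) <= u x * v y.

Let re_le x y : `|complex.Re (f (x, y))| <= u x * v y.
Proof. exact: le_trans (Re_cabs _) _. Qed.

Let im_le x y : `|complex.Im (f (x, y))| <= u x * v y.
Proof. exact: le_trans (Im_cabs _) _. Qed.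

Lemma cmeas_cint1 : cmeas (fun x => cintegral (fun y => f (x, y))).
Proof.
by case: mf => f1 f2; split; [exact: (measurable_Rint1 f1 iu iv)|exact: (measurable_Rint1 f2 iu iv)].
Qed.

Lemma cmeas_cint2 : cmeas (fun y => cintegral (fun x => f (x, y))).
Proof.
by case: mf => f1 f2; split; [exact: (measurable_Rint2 f1 iu iv)|exact: (measurable_Rint2 f2 iu iv)].
Qed.

Lemma cfubini : cintegral (fun x => cintegral (fun y => f (x, y))) =
  cintegral (fun y => cintegral (fun x => f (x, y))).
Proof.
case: mf => f1 f2; apply: cplx_ext => /=.
  exact: (Rfubini f1 iu iv re_le).
exact: (Rfubini f2 iu iv im_le).
Qed.

End cfubini.

Section oneDsqr_int.
Context {R : realType}.

Lemma integralT_oneDsqr : (\int[mu]_x ((oneDsqr (x : R))^-1)%:E = pi%:E)%E.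
Proof.
rewrite ge0_symfun_integralT.
- by rewrite -set_itvcy integral0y_oneDsqr -EFinM mulrCA divff ?mulr1.
- by move=> x; rewrite invr_ge0 (le_trans ler01)// oneDsqr_ge1.
- exact: continuous_oneDsqrV.
- by move=> x; rewrite /= /oneDsqr sqrrN.
Qed.

Lemma int_oneDsqr : (fun x : R => (oneDsqr x)^-1) \is_int.
Proof.
apply: intP; first by apply: continuous_measurable_fun; exact: continuous_oneDsqrV.
under eq_integral do rewrite ger0_norm ?invr_ge0 ?(le_trans ler01) ?oneDsqr_ge1//.
by rewrite integralT_oneDsqr ltry.
Qed.

(** The majorant does not decay in [y], so [f] need not be integrable on the plane. Multiplying by
    [1 / (1 + y^2)] restores a tensor majorant, and the factor is divided out after the integration
    in [x]. *)
Lemma cmeas_cint_unif (f : R * R -> R[i]) (u : R -> R) : cmeas f -> u \is_int ->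
  (forall x y, cabs (f (x, y)) <= u x) ->
  cmeas (fun y => cintegral (fun x => f (x, y))).
Proof.
move=> mf iu fu.
pose g (z : R * R) := (((oneDsqr z.2)^-1)%:C)%C * f z.
have o0 (y : R) : 0 < oneDsqr y by rewrite (lt_le_trans ltr01)// oneDsqr_ge1.
have mo : measurable_fun setT (fun x : R => (oneDsqr x)^-1) by exact: int_meas int_oneDsqr.
have mg : cmeas g.
  apply: cmeasM => //; apply: cmeasR.
  exact: (measurableT_comp mo measurable_snd).
have gl x y : cabs (g (x, y)) <= u x * (oneDsqr y)^-1.
  by rewrite cabsM cabsR ger0_norm ?invr_ge0 ?(ltW (o0 _))// mulrC ler_pM2r ?invr_gt0.
have fi y : cintegrable (fun x => f (x, y)).
  apply: (@cintegrable_le _ _ u) => //.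
  by apply: (cmeas_comp mf); exact: measurable_pair2.
rewrite [X in cmeas X](_ : _ = fun y =>
   (((oneDsqr y))%:C)%C * cintegral (fun x => g (x, y))); last first.
  apply/funext => y; rewrite /g /= cintegralZ// mulrA -[X in _ = X * _]rmorphM /=.
  by rewrite divff ?gt_eqF// mul1r.
apply: cmeasM.
  by apply: cmeasR; apply: continuous_measurable_fun; exact: continuous_oneDsqr.
exact: cmeas_cint2 mg iu int_oneDsqr gl.
Qed.

Lemma le_cabs_cintegral_ereal (f : R -> R[i]) : cintegrable f ->
  ((cabs (cintegral f))%:E <= \int[mu]_x (cabs (f x))%:E)%E.
Proof.
move=> fi; rewrite -Rint_EFin; last exact: cintegrable_cabs.
by rewrite lee_fin le_cabs_cintegral.
Qed.

End oneDsqr_int.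

Arguments cabs : simpl never.
Arguments cis : simpl never.
Arguments cintegral : simpl never.
Arguments conjc : simpl never.

Section ge0_integral_line.
Context {R : realType}.
Implicit Types f g : R -> \bar R.
Local Open Scope ereal_scope.

Lemma ge0_le_int f g : (forall x, 0 <= f x) -> measurable_fun setT f ->
  measurable_fun setT g -> (forall x, f x <= g x) ->
  \int[mu]_x f x <= \int[mu]_x g x.
Proof. by move=> f0 mf mg fg; apply: ge0_le_integral => //; move=> x _; exact: fg. Qed.

Lemma ge0_intD f g : (forall x, 0 <= f x) -> measurable_fun setT f ->
  (forall x, 0 <= g x) -> measurable_fun setT g ->
  \int[mu]_x (f x + g x) = \int[mu]_x f x + \int[mu]_x g x.
Proof. by move=> f0 mf g0 mg; rewrite ge0_integralD. Qed.

Lemma ge0_intZ (c : R) f : (0 <= c)%R -> (forall x, 0 <= f x) ->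
  measurable_fun setT f -> \int[mu]_x (c%:E * f x) = c%:E * \int[mu]_x f x.
Proof. by move=> c0 f0 mf; rewrite ge0_integralZl_EFin. Qed.

End ge0_integral_line.

Definition itvN {R : realType} (N : nat) : set R := `[- N%:R, N%:R].

(** * The method of the adjoint for the linearised maximal operator *)

Section TTstar.
Context {R : realType}.
Variables (G : R -> R[i]) (T p chi k : R -> R) (B : R).
Hypotheses (mG : cmeas G) (iG : (fun x => cabs (G x)) \is_int).
Hypothesis iG2 : (fun x => cabs (G x) ^+ 2) \is_int.
Hypotheses (mT : measurable_fun setT T) (mp : measurable_fun setT p).
Hypotheses (ichi : chi \is_int) (chi0 : forall x, 0 <= chi x).
Hypothesis Gchi : forall x, cabs (G x) ^+ 2 <= chi x * cabs (G x) ^+ 2.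
Hypotheses (mk : measurable_fun setT k) (kN : forall x, k (- x) = k x).
Hypothesis B0 : 0 < B.
Hypothesis kB : forall y, (\int[mu]_x (k (x - y))%:E <= B%:E)%E.
Hypothesis Kk : forall x y,
  cabs (cintegral (fun xi => (chi xi)%:C%C * cis ((x - y) * xi + (T x - T y) * p xi)))
    <= k (x - y).

(** Linearised maximal operator: [T x] is the time selected at [x] and [p] is the dispersion. The
    cutoff [chi] is at least 1 where [G] is nonzero, [k] majorises the kernel of the operator
    composed with its adjoint, and [B] is the Schur bound of [k]. The number [H] bounds [h]
    uniformly, which makes the truncated integrals finite. *)
Let h x := cintegral (fun xi => G xi * cis (x * xi + T x * p xi)).
Let H := \int[mu]_xi cabs (G xi).

Let k0 x y : 0 <= k (x - y).
Proof. exact: le_trans (cabs_ge0 _) (Kk x y). Qed.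

Let mph : measurable_fun setT (fun z : R * R => z.1 * z.2 + T z.1 * p z.2).
Proof.
apply: measurable_funD; apply: measurable_funM => //.
- exact: (measurableT_comp mT measurable_fst).
- exact: (measurableT_comp mp measurable_snd).
Qed.

Let mcis : cmeas (fun z : R * R => cis (z.1 * z.2 + T z.1 * p z.2)).
Proof. exact: cmeas_cis. Qed.

Let cmeas_fst (f : R -> R[i]) : cmeas f -> cmeas (fun z : R * R => f z.1).
Proof. by move=> mf; apply: (cmeas_comp mf); exact: measurable_fst. Qed.

Let cmeas_snd (f : R -> R[i]) : cmeas f -> cmeas (fun z : R * R => f z.2).
Proof. by move=> mf; apply: (cmeas_comp mf); exact: measurable_snd. Qed.

Let cintG x : cintegrable (fun xi => G xi * cis (x * xi + T x * p xi)).
Proof.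
apply: (cintegrable_le _ _ iG).
  apply: cmeasM => //; apply: cmeas_cis; apply: measurable_funD.
    exact: measurable_funM.
  exact: measurable_funM.
by move=> xi; rewrite cabsM cis_abs mulr1.
Qed.

Lemma cmeas_osc : cmeas h.
Proof.
rewrite /h.
apply: (@cmeas_cint_unif _ (fun z => G z.1 * cis (z.2 * z.1 + T z.2 * p z.1)) _ _ iG).
  apply: cmeasM; first exact: cmeas_fst.
  have m : measurable_fun setT (fun z : R * R => (z.2, z.1)).
    by apply/measurable_fun_pairP; split; [exact: measurable_snd|exact: measurable_fst].
  exact: (cmeas_comp mcis m).
by move=> x y /=; rewrite cabsM cis_abs mulr1.
Qed.

Let h_le x : cabs (h x) <= H.
Proof.
apply: le_trans (le_cabs_cintegral (cintG x)) _; apply: le_Rintegral => //.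
- exact: cintegrable_cabs.
- by move=> xi _; rewrite cabsM cis_abs mulr1.
Qed.

Let H0 : 0 <= H. Proof. exact: le_trans (cabs_ge0 _) (h_le 0). Qed.

(* Here [w] is [conj h] cut off to [[-N, N]] and [A = int w h = int G V].  Young's inequality
   [2 Re (G V) / B <= |G|^2 + chi |V|^2 / B^2] and the Schur bound [int chi |V|^2 <= B A]
   give [A <= B int |G|^2] without any operator norm. *)
Section trunc.
Variable N : nat.
Let e : R -> R := \1_(itvN N).

Let ie : e \is_int. Proof. exact: integrable_indic_itv. Qed.

Let e0 x : 0 <= e x. Proof. by rewrite /e indicE. Qed.

Let e1 x : e x <= 1. Proof. by rewrite /e indicE lern1 leq_b1. Qed.

Let ee x : e x ^+ 2 = e x.
Proof. by rewrite /e indicE; case: (_ \in _); rewrite ?expr1n ?expr0n. Qed.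

Let me : measurable_fun setT e. Proof. exact: int_meas ie. Qed.

Let w x := (e x)%:C%C * conjc (h x).

Let mw : cmeas w.
Proof. by apply: cmeasM; [exact: cmeasR|apply: cmeasJ; exact: cmeas_osc]. Qed.

Let w_abs x : cabs (w x) = e x * cabs (h x).
Proof. by rewrite cabsM cabsR ger0_norm// cabsJ. Qed.

Let w_le x : cabs (w x) <= e x * H.
Proof. by rewrite w_abs ler_wpM2l. Qed.

Let ieH : (fun x => e x * H) \is_int. Proof. exact: intZr. Qed.

Let A := \int[mu]_x (e x * cabs (h x) ^+ 2).

Let iA : (fun x => e x * cabs (h x) ^+ 2) \is_int.
Proof.
apply: (@int_le _ _ (fun x => e x * H ^+ 2)); last exact: intZr.
  apply: measurable_funM => //; apply: measurable_funX.
  by apply: measurable_cabs; exact: cmeas_osc.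
move=> x; rewrite ger0_norm ?mulr_ge0 ?exprn_ge0 ?cabs_ge0//.
by rewrite ler_wpM2l// lerXn2r ?nnegrE ?cabs_ge0.
Qed.

Let V xi := cintegral (fun x => w x * cis (x * xi + T x * p xi)).

Let cintV xi : cintegrable (fun x => w x * cis (x * xi + T x * p xi)).
Proof.
apply: (cintegrable_le _ _ ieH).
  apply: cmeasM => //; apply: cmeas_cis; apply: measurable_funD.
    exact: measurable_funM.
  exact: measurable_funM.
by move=> x; rewrite cabsM cis_abs mulr1.
Qed.

Let mV : cmeas V.
Proof.
apply: (@cmeas_cint_unif _ (fun z => w z.1 * cis (z.1 * z.2 + T z.1 * p z.2)) _ _ ieH).
  by apply: cmeasM => //; exact: cmeas_fst.
by move=> x y /=; rewrite cabsM cis_abs mulr1.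
Qed.

Let c0 := \int[mu]_x (e x * H).

Let V_le xi : cabs (V xi) <= c0.
Proof.
apply: le_trans (le_cabs_cintegral (cintV xi)) _; apply: le_Rintegral => //.
- exact: cintegrable_cabs.
- by move=> x _; rewrite cabsM cis_abs mulr1.
Qed.

Let c00 : 0 <= c0. Proof. exact: le_trans (cabs_ge0 _) (V_le 0). Qed.

Let duality : A%:C%C = cintegral (fun xi => G xi * V xi).
Proof.
pose F (z : R * R) := w z.1 * (G z.2 * cis (z.1 * z.2 + T z.1 * p z.2)).
have mF : cmeas F.
  by apply: cmeasM; [exact: cmeas_fst|apply: cmeasM => //; exact: cmeas_snd].
have FE : A%:C%C = cintegral (fun x => cintegral (fun xi => F (x, xi))).
  transitivity (cintegral (fun x => ((e x * cabs (h x) ^+ 2)%:C)%C)).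
    by apply: cplx_ext => //=; rewrite /Rintegral integral0.
  apply: eq_cintegral => x; rewrite /F /= cintegralZ//.
  rewrite -/(h x) /w -mulrA mulJ -[RHS]rmorphM //=.
rewrite FE (cfubini mF ieH iG); last first.
  move=> x y; rewrite /F cabsM (cabsM (G _)) cis_abs mulr1.
  exact: ler_wpM2r (cabs_ge0 _) _ _ (w_le x).
apply: eq_cintegral => xi; rewrite /F /V /= -cintegralZ//.
by apply: eq_cintegral => x; rewrite mulrCA.
Qed.

Let D := \int[mu]_xi (chi xi * cabs (V xi) ^+ 2).

Let iD : (fun xi => chi xi * cabs (V xi) ^+ 2) \is_int.
Proof.
apply: (@int_le _ _ (fun x => chi x * c0 ^+ 2)); last exact: intZr.
  apply: measurable_funM; first exact: int_meas.
  by apply: measurable_funX; exact: measurable_cabs.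
move=> x; rewrite ger0_norm ?mulr_ge0 ?exprn_ge0 ?cabs_ge0//.
by rewrite ler_wpM2l// lerXn2r ?nnegrE ?cabs_ge0.
Qed.

Let Q := \int[mu]_xi (cabs (G xi) ^+ 2).

Let young : 2 * B^-1 * A <= Q + B^-1 ^+ 2 * D.
Proof.
have Bi : 0 < B^-1 by rewrite invr_gt0.
have iGV : cintegrable (fun xi => G xi * V xi).
  apply: (@cintegrable_le _ _ (fun xi => cabs (G xi) * c0)); last exact: intZr.
    exact: cmeasM.
  by move=> xi; rewrite cabsM ler_wpM2l ?cabs_ge0.
have -> : A = \int[mu]_xi complex.Re (G xi * V xi).
  by rewrite -[LHS]/(complex.Re A%:C%C) duality.
rewrite /Q /D -!RintegralZl//; last by case: iGV.
rewrite -RintegralD//; last exact: intZ.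
apply: le_Rintegral => //.
- by apply: intZ; case: iGV.
- by apply: intD => //; exact: intZ.
move=> xi _; apply: (@le_trans _ _ (2 * B^-1 * (cabs (G xi) * cabs (V xi)))).
  rewrite ler_wpM2l ?mulr_ge0 ?(ltW Bi)// -cabsM.
  exact: le_trans (ler_norm _) (Re_cabs _).
have := Gchi xi; have := cabs_ge0 (G xi); have := cabs_ge0 (V xi).
rewrite le_eqVlt => /predU1P[<- _ _|V0].
  by rewrite mulr0 mulr0 expr0n/= !mulr0 addr0 sqr_ge0.
rewrite le_eqVlt => /predU1P[<- _|G0].
  by rewrite mul0r mulr0 expr0n/= add0r !mulr_ge0// ltW.
rewrite ler_pMl ?exprn_gt0// => chi1.
apply: (@le_trans _ _ (cabs (G xi) ^+ 2 + B^-1 ^+ 2 * cabs (V xi) ^+ 2)).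
  rewrite -subr_ge0; set x := cabs _; set y := cabs _.
  have -> : x ^+ 2 + B^-1 ^+ 2 * y ^+ 2 - 2 / B * (x * y) = (x - B^-1 * y) ^+ 2 by ring.
  exact: sqr_ge0.
by rewrite lerD2l ler_wpM2l ?sqr_ge0// ler_peMl ?sqr_ge0.
Qed.

Let K x y := cintegral (fun xi => (chi xi)%:C%C * cis ((x - y) * xi + (T x - T y) * p xi)).

Let Z y := cintegral (fun x => w x * K x y).

Let mchi : cmeas (fun xi => (chi xi)%:C%C).
Proof. by apply: cmeasR; exact: int_meas. Qed.

Let cchi x : cabs (chi x)%:C%C = chi x.
Proof. by rewrite cabsR ger0_norm. Qed.

(** Writing one factor of [|V|^2] as the conjugate of its defining integral and integrating in [xi]
    first leaves the kernel [K]: [Z] is [w] integrated against [K]. All exchanges are justified by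
    [H], [c0] and the integrability of [chi]. *)
Let DE : cmeas (fun y => conjc (w y) * Z y) /\
  D%:C%C = cintegral (fun y => conjc (w y) * Z y).
Proof.
pose F (z : R * R) := (chi z.2)%:C%C * V z.2 *
  (conjc (w z.1) * cis (- (z.1 * z.2 + T z.1 * p z.2))).
have mcisN : cmeas (fun z : R * R => cis (- (z.1 * z.2 + T z.1 * p z.2))).
  by apply: cmeas_cis; exact: measurableT_comp.
have mF : cmeas F.
  apply: cmeasM; first by apply: cmeasM; [exact: (cmeas_snd mchi)|exact: cmeas_snd].
  by apply: cmeasM => //; exact: (cmeas_fst (cmeasJ mw)).
have FE : D%:C%C = cintegral (fun xi => cintegral (fun y => F (y, xi))).
  transitivity (cintegral (fun xi => ((chi xi * cabs (V xi) ^+ 2)%:C)%C)).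
    by apply: cplx_ext => //=; rewrite /Rintegral integral0.
  apply: eq_cintegral => xi; rewrite /F /= cintegralZ; last first.
    apply: (cintegrable_le _ _ ieH).
      apply: cmeasM; first exact: cmeasJ.
      apply: cmeas_cis; apply: measurableT_comp => //; apply: measurable_funD.
        exact: measurable_funM.
      exact: measurable_funM.
    by move=> x; rewrite cabsM cis_abs mulr1 (cabsJ (w x)).
  rewrite rmorphM /= -mulJ -mulrA; congr (_ * _).
  rewrite mulrC; congr (_ * _); rewrite /V -cintegralJ//.
  by apply: eq_cintegral => y; rewrite [LHS]rmorphM /= [in LHS]cisJ.
have Fle y xi : cabs (F (y, xi)) <= e y * H * (chi xi * c0).
  rewrite /F cabsM cabsM (cabsM (conjc _)) cis_abs mulr1 cabsJ cchi mulrC.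
  by rewrite ler_pM ?mulr_ge0 ?cabs_ge0// ler_wpM2l.
suff inner : (fun y => cintegral (fun xi => F (y, xi))) = (fun y => conjc (w y) * Z y).
  split; first by rewrite -inner; exact: cmeas_cint1 mF ieH (intZr c0 ichi) Fle.
  by rewrite FE -inner; exact: esym (cfubini mF ieH (intZr c0 ichi) Fle).
apply/funext => y; rewrite /F /=.
rewrite (@eq_cintegral _ _ (fun xi => conjc (w y) *
  ((chi xi)%:C%C * V xi * cis (- (y * xi + T y * p xi))))); last first.
  by move=> xi; rewrite mulrCA.
have mcy : cmeas (fun xi => cis (- (y * xi + T y * p xi))).
  apply: cmeas_cis; apply: measurableT_comp => //; apply: measurable_funD.
    exact: measurable_funM.
  exact: measurable_funM.
rewrite cintegralZ; last first.
  apply: (cintegrable_le _ _ (intZr c0 ichi)).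
    by apply: cmeasM => //; exact: cmeasM.
  by move=> xi; rewrite !cabsM cis_abs mulr1 cchi ler_wpM2l.
congr (_ * _); rewrite /Z.
pose F2 (z : R * R) := w z.1 * ((chi z.2)%:C%C *
  (cis (z.1 * z.2 + T z.1 * p z.2) * cis (- (y * z.2 + T y * p z.2)))).
have mF2 : cmeas F2.
  apply: cmeasM; first exact: cmeas_fst.
  apply: cmeasM; first exact: (cmeas_snd mchi).
  by apply: cmeasM => //; exact: (cmeas_snd mcy).
transitivity (cintegral (fun xi => cintegral (fun x => F2 (x, xi)))).
  apply: eq_cintegral => xi; rewrite /F2 /= mulrAC -cintegralZ//.
  by apply: eq_cintegral => x; rewrite mulrCA -mulrA; congr (_ * (_ * _)); exact: mulrC.
rewrite -(cfubini mF2 ieH ichi); last first.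
  by move=> x z; rewrite /F2 cabsM (cabsM (chi _)%:C%C) cabsM !cis_abs !mulr1 cchi ler_wpM2r.
apply: eq_cintegral => x; rewrite /F2 /K /= -cintegralZ; last first.
  apply: (cintegrable_le _ _ ichi).
    apply: cmeasM => //; apply: cmeas_cis; apply: measurable_funD.
      exact: measurable_funM.
    exact: measurable_funM.
  by move=> xi; rewrite cabsM cis_abs mulr1 cchi.
apply: eq_cintegral => xi; rewrite -cisD; congr (_ * (_ * cis _)); ring.
Qed.

Let Kle x y : cabs (K x y) <= \int[mu]_xi chi xi.
Proof.
have ci : cintegrable (fun xi => (chi xi)%:C%C * cis ((x - y) * xi + (T x - T y) * p xi)).
  apply: (cintegrable_le _ _ ichi).
    apply: cmeasM => //; apply: cmeas_cis; apply: measurable_funD.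
      exact: measurable_funM.
    exact: measurable_funM.
  by move=> xi; rewrite cabsM cis_abs mulr1 cchi.
apply: le_trans (le_cabs_cintegral ci) _; apply: le_Rintegral => //.
- exact: cintegrable_cabs.
- by move=> xi _; rewrite cabsM cis_abs mulr1 cchi.
Qed.

Let Zint y : cintegrable (fun x => w x * K x y).
Proof.
apply: (@cintegrable_le _ _ (fun x => (e x * H) * \int[mu]_xi chi xi)); last exact: intZr.
  apply: cmeasM => //; apply: (@cmeas_cint_unif _ (fun z => (chi z.1)%:C%C *
    cis ((z.2 - y) * z.1 + (T z.2 - T y) * p z.1)) _ _ ichi).
    apply: cmeasM; first exact: (cmeas_fst mchi).
    apply: cmeas_cis; apply: measurable_funD; apply: measurable_funM.
    - by apply: measurable_funB => //; exact: measurable_snd.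
    - exact: measurable_fst.
    - by apply: measurable_funB => //; exact: (measurableT_comp mT measurable_snd).
    - exact: (measurableT_comp mp measurable_fst).
  by move=> x z; rewrite cabsM cis_abs mulr1 cchi.
move=> x; rewrite (cabsM (w x)) ler_pM ?cabs_ge0//.
Qed.

Let W x := cabs (w x).

Let mW : measurable_fun setT W. Proof. exact: measurable_cabs. Qed.

Let W2 x : W x ^+ 2 = e x * cabs (h x) ^+ 2.
Proof. by rewrite /W w_abs exprMn ee. Qed.

Let mkd : measurable_fun setT (fun z : R * R => k (z.1 - z.2)).
Proof.
apply: (measurableT_comp mk); apply: measurable_funB.
  exact: measurable_fst.
exact: measurable_snd.
Qed.

Let mW1 : measurable_fun setT (fun z : R * R => W z.1).
Proof. exact: (measurableT_comp mW measurable_fst). Qed.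

Let mW2 : measurable_fun setT (fun z : R * R => W z.2).
Proof. exact: (measurableT_comp mW measurable_snd). Qed.

Let mWk1 : measurable_fun setT (fun z : R * R => W z.1 ^+ 2 * k (z.1 - z.2)).
Proof. exact: (measurable_funM (measurable_funX 2 mW1) mkd). Qed.

Let mWk2 : measurable_fun setT (fun z : R * R => W z.2 ^+ 2 * k (z.1 - z.2)).
Proof. exact: (measurable_funM (measurable_funX 2 mW2) mkd). Qed.

Let ZW y : ((W y * cabs (Z y))%:E <= \int[mu]_x (W y * (W x * k (x - y)))%:E)%E.
Proof.
have mkx : measurable_fun setT (fun x : R => k (x - y)).
  by apply: (measurableT_comp mk); exact: measurable_funB.
under eq_integral do rewrite EFinM.
rewrite ge0_integralZl//; last 3 first.
- by apply/measurable_EFinP; exact: measurable_funM.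
- by move=> x _; rewrite lee_fin mulr_ge0 ?cabs_ge0.
- by rewrite lee_fin cabs_ge0.
rewrite EFinM lee_wpmul2l ?lee_fin ?cabs_ge0//.
apply: le_trans (le_cabs_cintegral_ereal (Zint y)) _.
apply: ge0_le_integral => //.
- by move=> x _; rewrite lee_fin cabs_ge0.
- apply/measurable_EFinP; apply: measurable_cabs; exact: cintegrable_cmeas (Zint y).
- by apply/measurable_EFinP; exact: measurable_funM.
- by move=> x _; rewrite lee_fin (cabsM (w x)); exact: ler_wpM2l (cabs_ge0 _) _ _ (Kk x y).
Qed.

Let sqW1 : (\int[mu]_y \int[mu]_x (W y ^+ 2 * k (x - y))%:E <= (B * A)%:E)%E.
Proof.
apply: (@le_trans _ _ (\int[mu]_y (W y ^+ 2 * B)%:E)%E).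
  apply: ge0_le_integral => //.
  - by move=> y _; apply: integral_ge0 => x _; rewrite lee_fin mulr_ge0 ?sqr_ge0.
  - have mz : measurable_fun setT (fun z : R * R => (W z.2 ^+ 2 * k (z.1 - z.2))%:E).
      by apply/measurable_EFinP; exact: mWk2.
    apply: (measurable_fun_fubini_tonelli_G (m1 := mu) _ mz) => z.
    by rewrite lee_fin mulr_ge0 ?sqr_ge0.
  - by apply/measurable_EFinP; apply: measurable_funM => //; exact: measurable_funX.
  - move=> y _; under eq_integral do rewrite EFinM.
    rewrite ge0_integralZl//; last 3 first.
    + apply/measurable_EFinP; apply: (measurableT_comp mk); exact: measurable_funB.
    + by move=> x _; rewrite lee_fin.
    + by rewrite lee_fin sqr_ge0.
    by rewrite [X in (_ <= X)%E]EFinM lee_wpmul2l// lee_fin sqr_ge0.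
under eq_integral do rewrite W2.
by rewrite -Rint_EFin ?RintegralZr//; [rewrite mulrC|exact: intZr].
Qed.

(** Tonelli exchanges the variables and the evenness of [k] turns the result into the previous
    bound. *)
Let sqW2 : (\int[mu]_y \int[mu]_x (W x ^+ 2 * k (x - y))%:E <= (B * A)%:E)%E.
Proof.
have mz : measurable_fun setT (fun z : R * R => (W z.1 ^+ 2 * k (z.1 - z.2))%:E).
  by apply/measurable_EFinP; exact: mWk1.
have z0 z : (0 <= (W z.1 ^+ 2 * k (z.1 - z.2))%:E)%E by rewrite lee_fin mulr_ge0 ?sqr_ge0.
have /= <- := fubini_tonelli (m1 := mu) (m2 := mu) _ mz z0.
apply: le_trans sqW1; rewrite le_eqVlt; apply/orP; left; apply/eqP.
by apply: eq_integral => x _; apply: eq_integral => y _ /=; rewrite -kN opprB.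
Qed.

(** Schur's test: [W x * W y] is at most half of [W x^2 + W y^2], and against [k (x - y)] each of
    the two squares integrates to at most [B * A]. *)
Let D_le : D <= B * A.
Proof.
have Zle y : cabs (Z y) <= c0 * \int[mu]_xi chi xi.
  apply: le_trans (le_cabs_cintegral (Zint y)) _.
  rewrite /c0 -RintegralZr//; apply: le_Rintegral => //.
  - exact: cintegrable_cabs (Zint y).
  - exact: intZr.
  - by move=> x _; rewrite (cabsM (w x)) ler_pM ?cabs_ge0.
have wZ : cintegrable (fun y => conjc (w y) * Z y).
  apply: (@cintegrable_le _ _ (fun y => e y * H * (c0 * \int[mu]_xi chi xi))).
  - by case: DE.
  - by move=> y; rewrite (cabsM (conjc (w y))) (cabsJ (w y)); apply: ler_pM; rewrite ?cabs_ge0.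
  - exact: intZr.
rewrite -lee_fin (@le_trans _ _ (cabs D%:C%C)%:E)//.
  by rewrite cabsR lee_fin ler_norm.
case: DE => _ ->; apply: le_trans (le_cabs_cintegral_ereal wZ) _.
have mz1 : measurable_fun setT (fun z : R * R => (2^-1 * (W z.2 ^+ 2 * k (z.1 - z.2)))%:E).
  by apply/measurable_EFinP; apply: measurable_funM; [exact: measurable_cst|exact: mWk2].
have mz2 : measurable_fun setT (fun z : R * R => (2^-1 * (W z.1 ^+ 2 * k (z.1 - z.2)))%:E).
  by apply/measurable_EFinP; apply: measurable_funM; [exact: measurable_cst|exact: mWk1].
have p1 z : (0 <= (2^-1 * (W z.2 ^+ 2 * k (z.1 - z.2)))%:E)%E.
  by rewrite lee_fin; apply: mulr_ge0 => //; apply: mulr_ge0 => //; exact: sqr_ge0.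
have p2 z : (0 <= (2^-1 * (W z.1 ^+ 2 * k (z.1 - z.2)))%:E)%E.
  by rewrite lee_fin; apply: mulr_ge0 => //; apply: mulr_ge0 => //; exact: sqr_ge0.
have mG1 := measurable_fun_fubini_tonelli_G (m1 := mu) _ mz1 p1.
have mG2 := measurable_fun_fubini_tonelli_G (m1 := mu) _ mz2 p2.
have mx1 y : measurable_fun setT (fun x : R => (2^-1 * (W y ^+ 2 * k (x - y)))%:E).
  exact: (measurableT_comp mz1 (measurable_pair2 y)).
have mx2 y : measurable_fun setT (fun x : R => (2^-1 * (W x ^+ 2 * k (x - y)))%:E).
  exact: (measurableT_comp mz2 (measurable_pair2 y)).
have half (f : R -> R -> R) : (forall x y, 0 <= f x y) ->
    measurable_fun setT (fun z : R * R => f z.1 z.2) ->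
    (\int[mu]_y \int[mu]_x (f x y)%:E <= (B * A)%:E)%E ->
    (\int[mu]_y \int[mu]_x (2^-1 * f x y)%:E <= (2^-1 * (B * A))%:E)%E.
  move=> f0 mf fle.
  have mfe : measurable_fun setT (fun z : R * R => (f z.1 z.2)%:E) by exact/measurable_EFinP.
  have h20 : 0 <= 2^-1 :> R by rewrite invr_ge0.
  apply: (@le_trans _ _ (\int[mu]_y ((2^-1)%:E * \int[mu]_x (f x y)%:E))%E).
    rewrite le_eqVlt; apply/orP; left; apply/eqP; apply: eq_integral => y _.
    rewrite -ge0_intZ.
    - by apply: eq_integral => x _; rewrite EFinM.
    - exact: h20.
    - by move=> x; rewrite lee_fin.
    - exact: (measurableT_comp mfe (measurable_pair2 y)).
  rewrite ge0_intZ.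
  - by rewrite [X in (_ <= X)%E]EFinM lee_wpmul2l.
  - exact: h20.
  - by move=> y; apply: integral_ge0 => x _; rewrite lee_fin.
  - apply: (measurable_fun_fubini_tonelli_G (m1 := mu) _ mfe) => z; rewrite lee_fin//.
pose I1 y := (\int[mu]_x (2^-1 * (W y ^+ 2 * k (x - y)))%:E)%E.
pose I2 y := (\int[mu]_x (2^-1 * (W x ^+ 2 * k (x - y)))%:E)%E.
have I10 y : (0 <= I1 y)%E by apply: integral_ge0 => x _; exact: (p1 (x, y)).
have I20 y : (0 <= I2 y)%E by apply: integral_ge0 => x _; exact: (p2 (x, y)).
have le1 y : ((cabs (conjc (w y) * Z y))%:E <= I1 y + I2 y)%E.
  rewrite (cabsM (conjc (w y))) (cabsJ (w y)); apply: le_trans (ZW y) _.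
  rewrite /I1 /I2 -ge0_intD.
  - apply: ge0_le_int.
    + move=> x; rewrite lee_fin; apply: mulr_ge0; first exact: cabs_ge0.
      by apply: mulr_ge0 => //; exact: cabs_ge0.
    + apply/measurable_EFinP; apply: measurable_funM; first exact: measurable_cst.
      by apply: (measurable_funM mW); apply: (measurableT_comp mk); exact: measurable_funB.
    + exact: (emeasurable_funD (mx1 y) (mx2 y)).
    + move=> x; rewrite -EFinD lee_fin !mulrA -!mulrDl; apply: ler_wpM2r => //.
      rewrite -subr_ge0 (_ : _ - _ = 2^-1 * (W x - W y) ^+ 2); last by field.
      by apply: mulr_ge0 => //; exact: sqr_ge0.
  - by move=> x; exact: (p1 (x, y)).
  - exact: mx1.
  - by move=> x; exact: (p2 (x, y)).
  - exact: mx2.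
apply: (@le_trans _ _ (\int[mu]_y (I1 y + I2 y))%E).
  apply: ge0_le_int.
  - by move=> y; rewrite lee_fin cabs_ge0.
  - apply/measurable_EFinP; apply: measurable_cabs; exact: cintegrable_cmeas wZ.
  - exact: emeasurable_funD mG1 mG2.
  - exact: le1.
rewrite (ge0_intD I10 mG1 I20 mG2).
rewrite (_ : B * A = 2^-1 * (B * A) + 2^-1 * (B * A)); last by field.
rewrite EFinD; apply: leeD; apply: half.
- by move=> x y; apply: mulr_ge0 => //; exact: sqr_ge0.
- exact: mWk2.
- exact: sqW1.
- by move=> x y; apply: mulr_ge0 => //; exact: sqr_ge0.
- exact: mWk1.
- exact: sqW2.
Qed.

(** Together [young] and [D_le] give [2 A / B <= Q + A / B]. The term [A / B] can be absorbed on the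
    left because the truncation makes [A] finite. *)
Lemma trunc_bound : (\int[mu]_x (e x * cabs (h x) ^+ 2)%:E <= (B * Q)%:E)%E.
Proof.
rewrite -Rint_EFin// lee_fin -/A.
have := young; rewrite -(ler_pM2l (exprn_gt0 2 B0)).
have -> : B ^+ 2 * (2 / B * A) = 2 * B * A by field; rewrite gt_eqF.
have -> : B ^+ 2 * (Q + B^-1 ^+ 2 * D) = B ^+ 2 * Q + D by field; rewrite gt_eqF.
move=> yg; rewrite -(ler_pM2l B0); have := D_le; lra.
Qed.

End trunc.

(** The bound [B * Q] of the truncated integrals does not depend on [N], so monotone convergence
    removes the truncation. *)
Lemma TTstar : (\int[mu]_x (cabs (h x) ^+ 2)%:E <= (B * \int[mu]_xi cabs (G xi) ^+ 2)%:E)%E.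
Proof.
pose g N x := ((\1_(itvN N) x * cabs (h x) ^+ 2)%:E : \bar R).
have mg N : measurable_fun setT (g N).
  apply/measurable_EFinP; apply: measurable_funM; first by apply: measurable_indic; exact: measurable_itv.
  by apply: measurable_funX; apply: measurable_cabs; exact: cmeas_osc.
have nd x : {homo g ^~ x : n m / (n <= m)%N >-> (n <= m)%E}.
  move=> n m nm; rewrite lee_fin ler_wpM2r ?sqr_ge0// !indicE ler_nat.
  case: (boolP (x \in itvN n)) => // /set_mem; rewrite /itvN /= in_itv/= => /andP[a b].
  rewrite mem_set//= in_itv/=; apply/andP; split.
    by rewrite (le_trans _ a)// lerN2 ler_nat.
  by rewrite (le_trans b)// ler_nat.
have g0 N x : (0 <= g N x)%E by rewrite lee_fin mulr_ge0 ?sqr_ge0// indicE.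
have := @monotone_convergence _ _ _ mu _ measurableT g mg (fun n x _ => g0 n x)
  (fun x _ => nd x).
under eq_integral.
  move=> x _; rewrite (_ : limn (g^~ x) = (cabs (h x) ^+ 2)%:E); last first.
    apply/cvg_lim => //; apply: cvg_near_cst.
    exists (Num.truncn `|x|).+1 => // n /= nx.
    rewrite /g indicE mem_set ?mul1r// /itvN /= in_itv /= -ler_norml.
    by rewrite ltW// (lt_le_trans (truncnS_gt _))// ler_nat.
  over.
move=> ->; apply: lime_le.
  apply: ereal_nondecreasing_is_cvgn => n m nm; apply: ge0_le_integral => //.
  - exact: mg.
  - exact: mg.
  - by move=> x _; exact: nd.
by apply: nearW => N; exact: trunc_bound.
Qed.
End TTstar.

(** * Oscillatory integrals *)

Section segment_calculus.
Context {R : realType}.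
Implicit Types (f g F : R -> R) (a b : R).

(** Two-sided continuity at every point of the closed segment, end points included. This is stronger
    than continuity on the segment, but it is stable under the algebra and holds here because the
    functions involved extend beyond the segment. *)
Definition cont_on f a b := forall x, a <= x <= b -> {for x, continuous f}.
Definition deriv_on F f a b := forall x, a <= x <= b -> is_derive x 1 F (f x).

Lemma is_derive_cont F (x d : R) : is_derive x 1 F d -> {for x, continuous F}.
Proof. by move=> [dF _]; apply: differentiable_continuous; apply/derivable1_diffP. Qed.

Lemma deriv_on_cont F f a b : deriv_on F f a b -> cont_on F a b.
Proof. by move=> h x /h /is_derive_cont. Qed.

Lemma cont_onW f a b : cont_on f a b -> {within `[a, b], continuous f}.
Proof.
move=> cf; apply: continuous_in_subspaceT => x; rewrite inE /= in_itv /=; exact: cf.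
Qed.

Lemma deriv_on_LR F f a b : a < b -> deriv_on F f a b -> derivable_oo_LRcontinuous F a b.
Proof.
move=> ab dF; have cF := deriv_on_cont dF; split.
- by move=> x; rewrite in_itv /= => /andP[ax xb]; have [] := dF x _; rewrite ?ltW ?ax.
- by apply: cvg_at_right_filter; apply: cF; rewrite lexx ltW.
- by apply: cvg_at_left_filter; apply: cF; rewrite lexx ltW.
Qed.

Lemma deriv_onE F f a b : deriv_on F f a b -> {in `]a, b[, F^`()%classic =1 f}.
Proof.
move=> dF x; rewrite in_itv /= => /andP[ax xb].
have h : a <= x <= b by rewrite !ltW.
by rewrite derive1E; have [] := dF x h.
Qed.

Lemma cont_on_int f a b : cont_on f a b -> mu.-integrable `[a, b] (EFin \o f).
Proof.
move=> cf; apply: continuous_compact_integrable; first exact: segment_compact.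
exact: cont_onW.
Qed.

Lemma Rint_FTC2 F f a b : a < b -> deriv_on F f a b -> cont_on f a b ->
  \int[mu]_(x in `[a, b]) f x = F b - F a.
Proof.
move=> ab dF cf; rewrite /Rintegral (@continuous_FTC2 _ _ F)//.
- exact: cont_onW.
- exact: deriv_on_LR dF.
- exact: deriv_onE.
Qed.

Lemma cont_on_cst (c : R) a b : cont_on (fun=> c) a b.
Proof. by move=> x _; exact: cst_continuous. Qed.

Lemma Rint_cst (c a b : R) : a < b -> \int[mu]_(x in `[a, b]) c = c * (b - a).
Proof.
move=> ab; rewrite (@Rint_FTC2 (fun x => c * x))//; first by rewrite mulrBr.
- by move=> x _; apply: is_derive_eq; rewrite /GRing.scale /=; ring.
- exact: cont_on_cst.
Qed.

Lemma Rint_le_bound f a b C : a < b -> cont_on f a b ->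
  (forall x, a <= x <= b -> `|f x| <= C) ->
  `|\int[mu]_(x in `[a, b]) f x| <= C * (b - a).
Proof.
move=> ab cf fC; have fi := cont_on_int cf.
apply: le_trans (le_normr_Rintegral _ fi) _ => //.
rewrite -Rint_cst//; apply: le_Rintegral => //.
- exact: integrable_norm.
- exact/cont_on_int/cont_on_cst.
Qed.

Lemma Rint_norm_le f g a b : cont_on f a b -> cont_on g a b ->
  (forall x, a <= x <= b -> `|f x| <= g x) ->
  `|\int[mu]_(x in `[a, b]) f x| <= \int[mu]_(x in `[a, b]) g x.
Proof.
move=> cf cg fg; have fi := cont_on_int cf; have gi := cont_on_int cg.
apply: le_trans (le_normr_Rintegral _ fi) _ => //.
apply: le_Rintegral => //; exact: integrable_norm.
Qed.

Lemma cont_onM f g a b : cont_on f a b -> cont_on g a b -> cont_on (fun x => f x * g x) a b.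
Proof. by move=> cf cg x xab; apply: continuousM; [exact: cf|exact: cg]. Qed.

Lemma cont_onD f g a b : cont_on f a b -> cont_on g a b -> cont_on (fun x => f x + g x) a b.
Proof. by move=> cf cg x xab; apply: continuousD; [exact: cf|exact: cg]. Qed.

Lemma cont_onN f a b : cont_on f a b -> cont_on (fun x => - f x) a b.
Proof. by move=> cf x xab; apply: continuousN; exact: cf. Qed.

Lemma cont_onV f a b : (forall x, a <= x <= b -> f x != 0) -> cont_on f a b ->
  cont_on (fun x => (f x)^-1) a b.
Proof. by move=> f0 cf x xab; apply: continuousV; [exact: f0|exact: cf]. Qed.

Lemma cont_onX f n a b : cont_on f a b -> cont_on (fun x => f x ^+ n) a b.
Proof.
move=> cf; elim: n => [|n ih]; first exact: cont_on_cst.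
by under [X in cont_on X]eq_fun do rewrite exprS; exact: cont_onM.
Qed.

Lemma cont_on_cos f a b : cont_on f a b -> cont_on (fun x => cos (f x)) a b.
Proof. by move=> cf x /cf ?; apply: continuous_comp => //; exact: continuous_cos. Qed.

Lemma cont_on_sin f a b : cont_on f a b -> cont_on (fun x => sin (f x)) a b.
Proof. by move=> cf x /cf ?; apply: continuous_comp => //; exact: continuous_sin. Qed.

(** The boundary terms vanish with [A]. The free shift [th] makes the identity cover sine as well,
    since [sin u = cos (u - pi / 2)], so that it can be applied twice in a row. *)
Lemma osc_ibp (A A1 phi phi1 : R -> R) a b th : a < b ->
  deriv_on A A1 a b -> cont_on A1 a b -> deriv_on phi phi1 a b -> cont_on phi1 a b ->
  A a = 0 -> A b = 0 ->
  \int[mu]_(x in `[a, b]) (A x * (phi1 x * cos (phi x + th))) =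
  - \int[mu]_(x in `[a, b]) (A1 x * sin (phi x + th)).
Proof.
move=> ab dA cA1 dphi cphi1 Aa Ab.
have cphi := deriv_on_cont dphi.
have dS : deriv_on (fun x => sin (phi x + th)) (fun x => phi1 x * cos (phi x + th)) a b.
  move=> x xab; have dx := dphi x xab.
  by apply: is_derive_eq; rewrite /GRing.scale /= addr0 mulrC.
rewrite (@Rintegration_by_parts _ A (fun x => sin (phi x + th)) A1
  (fun x => phi1 x * cos (phi x + th)) a b ab).
- by rewrite Aa Ab !mul0r subr0 sub0r.
- exact: cont_onW.
- exact: deriv_on_LR dA.
- exact: deriv_onE.
- apply: cont_onW; apply: cont_onM => //; apply: cont_on_cos; apply: cont_onD => //.
  exact: cont_on_cst.
- exact: deriv_on_LR dS.
- exact: deriv_onE.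
Qed.

End segment_calculus.

(** * Oscillatory integrals without stationary points *)

Section nonstationary.
Context {R : realType}.
Variables (chi chi1 chi2 phi phi1 phi2 phi3 : R -> R) (a b M K nu : R).
Hypotheses (ab : a < b).
Hypotheses (dchi : deriv_on chi chi1 a b) (dchi1 : deriv_on chi1 chi2 a b).
Hypotheses (cchi2 : cont_on chi2 a b).
Hypotheses (chia : chi a = 0) (chib : chi b = 0) (chi1a : chi1 a = 0) (chi1b : chi1 b = 0).
Hypotheses (dphi : deriv_on phi phi1 a b) (dphi1 : deriv_on phi1 phi2 a b).
Hypotheses (dphi2 : deriv_on phi2 phi3 a b) (cphi3 : cont_on phi3 a b).
Hypotheses (M0 : 0 <= M) (K0 : 0 <= K).
Hypothesis bchi : forall x, a <= x <= b ->
  [/\ `|chi x| <= M, `|chi1 x| <= M & `|chi2 x| <= M].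
Hypothesis nu0 : 0 < nu.
Hypothesis bphi1 : forall x, a <= x <= b -> nu <= `|phi1 x|.
Hypothesis bphi2 : forall x, a <= x <= b -> `|phi2 x| <= K * nu.
Hypothesis bphi3 : forall x, a <= x <= b -> `|phi3 x| <= K * nu.

Let p0 x : a <= x <= b -> phi1 x != 0.
Proof. by move=> /bphi1 h; rewrite -normr_gt0 (lt_le_trans nu0). Qed.

(** The amplitudes after one and two integrations by parts: [A1] is the derivative of [chi / phi1],
    and [A2] that of [A1 / phi1]. *)
Let A1 x := chi1 x / phi1 x - chi x * phi2 x / phi1 x ^+ 2.
Let A2 x := chi2 x / phi1 x ^+ 2 - 3 * (chi1 x * phi2 x / phi1 x ^+ 3)
   - chi x * phi3 x / phi1 x ^+ 3 + 3 * (chi x * phi2 x ^+ 2 / phi1 x ^+ 4).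

Let dV x : a <= x <= b -> is_derive x 1 (fun y => (phi1 y)^-1) (- phi2 x / phi1 x ^+ 2).
Proof.
move=> xab; have dx := dphi1 xab; have := is_deriveV (p0 xab) dx.
by rewrite (_ : _ *: _ = - phi2 x / phi1 x ^+ 2)// /GRing.scale /= mulrC mulrN mulNr.
Qed.

Let dA : deriv_on (fun x => chi x * (phi1 x)^-1) A1 a b.
Proof.
move=> x xab; have d1 := dchi xab; have d2 := dV xab; have nz := p0 xab.
apply: is_derive_eq; rewrite /GRing.scale /= /A1; field; exact: nz.
Qed.

Let dA1 : deriv_on (fun x => A1 x * (phi1 x)^-1) A2 a b.
Proof.
move=> x xab; have d1 := dchi xab; have d2 := dV xab; have nz := p0 xab.
have d3 := dchi1 xab; have d4 := dphi2 xab.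
have -> : (fun x => A1 x * (phi1 x)^-1) = (fun x => chi1 x * (phi1 x)^-1 * (phi1 x)^-1
  - chi x * phi2 x * (phi1 x)^-1 * (phi1 x)^-1 * (phi1 x)^-1).
  apply/funext => z; rewrite /A1 -exprVn; ring.
apply: is_derive_eq; rewrite /GRing.scale /= /A2; field; exact: nz.
Qed.

Let cphi := deriv_on_cont dphi.
Let cphi1 := deriv_on_cont dphi1.
Let cphi2 := deriv_on_cont dphi2.
Let cchi := deriv_on_cont dchi.
Let cchi1 := deriv_on_cont dchi1.
Let cV : cont_on (fun x => (phi1 x)^-1) a b. Proof. exact: cont_onV. Qed.
Let cVX n : cont_on (fun x => (phi1 x ^+ n)^-1) a b.
Proof.
apply: cont_onV; last exact: cont_onX.
by move=> x /p0 h; rewrite expf_neq0.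
Qed.

Let cA1 : cont_on A1 a b.
Proof.
apply: cont_onD; first exact: cont_onM.
by apply: cont_onN; apply: cont_onM => //; exact: cont_onM.
Qed.

Let cA2 : cont_on A2 a b.
Proof.
apply: cont_onD; last first.
  apply: cont_onM; first exact: cont_on_cst.
  by apply: cont_onM => //; apply: cont_onM => //; exact: cont_onX.
apply: cont_onD; last by apply: cont_onN; apply: cont_onM => //; exact: cont_onM.
apply: cont_onD; first exact: cont_onM.
apply: cont_onN; apply: cont_onM; first exact: cont_on_cst.
by apply: cont_onM => //; exact: cont_onM.
Qed.

Let A2_le x : a <= x <= b -> `|A2 x| <= M * (1 + 4 * K + 3 * K ^+ 2) / nu ^+ 2.
Proof.
move=> xab; have [c0 c1 c2] := bchi xab; have q1 := bphi1 xab.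
have q2 := bphi2 xab; have q3 := bphi3 xab.
pose q := `|phi1 x|; have q0 : 0 < q by rewrite normr_gt0 p0.
have r1 : nu / q <= 1 by rewrite ler_pdivrMr ?mul1r.
have r0 : 0 <= nu / q by rewrite divr_ge0 ?ltW.
have iq : q^-1 <= nu^-1 by rewrite lef_pV2.
have iq0 : 0 <= q^-1 by rewrite invr_ge0 ltW.
have iq2 : q^-1 ^+ 2 <= nu^-1 ^+ 2 by rewrite lerXn2r ?nnegrE// invr_ge0 ltW.
have s2 : `|phi2 x| / q <= K.
  rewrite ler_pdivrMr//; apply: le_trans q2 _; exact: ler_wpM2l.
have s3 : `|phi3 x| / q <= K.
  rewrite ler_pdivrMr//; apply: le_trans q3 _; exact: ler_wpM2l.
have s20 : 0 <= `|phi2 x| / q by rewrite divr_ge0 ?normr_ge0 ?(ltW q0).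
have s30 : 0 <= `|phi3 x| / q by rewrite divr_ge0 ?normr_ge0 ?(ltW q0).
apply: (@le_trans _ _ ((`|chi2 x| + 3 * (`|chi1 x| * (`|phi2 x| / q)) +
   `|chi x| * (`|phi3 x| / q) + 3 * (`|chi x| * (`|phi2 x| / q) ^+ 2)) * q^-1 ^+ 2)).
  rewrite [X in _ <= X](_ : _ = `|chi2 x| * q^-1 ^+ 2 +
    3 * (`|chi1 x| * (`|phi2 x| / q)) * q^-1 ^+ 2 +
    `|chi x| * (`|phi3 x| / q) * q^-1 ^+ 2 +
    3 * (`|chi x| * (`|phi2 x| / q) ^+ 2) * q^-1 ^+ 2); last by ring.
  rewrite /A2; apply: le_trans (ler_normD _ _) _; apply: lerD; last first.
    rewrite !normrM !normfV !normrX normr_nat -/q le_eqVlt; apply/orP; left; apply/eqP.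
    by field; rewrite gt_eqF.
  apply: le_trans (ler_normB _ _) _; apply: lerD; last first.
    rewrite !normrM !normfV !normrX -/q le_eqVlt; apply/orP; left; apply/eqP.
    by field; rewrite gt_eqF.
  apply: le_trans (ler_normB _ _) _; apply: lerD.
    by rewrite !normrM !normfV !normrX -/q exprVn.
  rewrite !normrM !normfV !normrX normr_nat -/q le_eqVlt; apply/orP; left; apply/eqP.
  by field; rewrite gt_eqF.
rewrite -exprVn; apply: ler_pM => //; last first.
  rewrite (_ : M * _ = M + 4 * (M * K) + 3 * (M * K ^+ 2)); last by ring.
  have t1 : `|chi1 x| * (`|phi2 x| / q) <= M * K by exact: ler_pM.
  have t2 : `|chi x| * (`|phi3 x| / q) <= M * K by exact: ler_pM.
  have t3 : `|chi x| * (`|phi2 x| / q) ^+ 2 <= M * K ^+ 2.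
    by apply: ler_pM => //; rewrite ?sqr_ge0// lerXn2r ?nnegrE.
  lra.
- by rewrite sqr_ge0.
- have t1 : 0 <= `|chi1 x| * (`|phi2 x| / q) by exact: mulr_ge0.
  have t2 : 0 <= `|chi x| * (`|phi3 x| / q) by exact: mulr_ge0.
  have t3 : 0 <= `|chi x| * (`|phi2 x| / q) ^+ 2 by apply: mulr_ge0 => //; exact: sqr_ge0.
  have := normr_ge0 (chi2 x); lra.
Qed.

(** Two integrations by parts, each gaining a factor [1 / nu]. Since [K] measures the higher
    derivatives of the phase in units of [nu], the four terms of [A2] contribute [1], [3 K], [K] and
    [3 K^2]. *)
Lemma nonstationary th : `|\int[mu]_(x in `[a, b]) (chi x * cos (phi x + th))| <=
  M * (1 + 4 * K + 3 * K ^+ 2) * (b - a) / nu ^+ 2.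
Proof.
have -> : \int[(@lebesgue_measure R)]_(x in `[a, b]) (chi x * cos (phi x + th)) =
    \int[mu]_(x in `[a, b]) (chi x * (phi1 x)^-1 * (phi1 x * cos (phi x + th))).
  apply: eq_Rintegral => x; rewrite inE /= in_itv /= => /p0 h.
  by rewrite mulrA divfK.
rewrite (osc_ibp th ab dA cA1 dphi cphi1) ?chia ?chib ?mul0r//.
have -> : \int[(@lebesgue_measure R)]_(x in `[a, b]) (A1 x * sin (phi x + th)) =
    \int[mu]_(x in `[a, b]) (A1 x * (phi1 x)^-1 * (phi1 x * cos (phi x + (th - pi / 2)))).
  apply: eq_Rintegral => x; rewrite inE /= in_itv /= => /p0 h.
  by rewrite mulrA divfK// addrA cosB cos_pihalf sin_pihalf mulr0 mulr1 add0r.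
rewrite (osc_ibp _ ab dA1 cA2 dphi cphi1); last 2 first.
- by rewrite /A1 chia chi1a !mul0r subrr mul0r.
- by rewrite /A1 chib chi1b !mul0r subrr mul0r.
rewrite opprK; set T := M * _.
have -> : T * (b - a) / nu ^+ 2 = T / nu ^+ 2 * (b - a) by rewrite mulrAC.
apply: Rint_le_bound => //.
  apply: cont_onM => //; apply: cont_on_sin; apply: cont_onD => //; exact: cont_on_cst.
move=> x xab; rewrite normrM; apply: le_trans (A2_le xab).
by rewrite ler_piMr// ler_norml sin_geN1 sin_le1.
Qed.

End nonstationary.

(** * Oscillatory integrals with a lower bound on the second derivative *)

Section stationary.
Context {R : realType}.
Variables (chi chi1 phi phi1 phi2 : R -> R) (a b M m : R).
Hypotheses (ab : a < b).
Hypotheses (dchi : deriv_on chi chi1 a b) (cchi1 : cont_on chi1 a b).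
Hypotheses (chia : chi a = 0) (chib : chi b = 0).
Hypotheses (dphi : deriv_on phi phi1 a b) (dphi1 : deriv_on phi1 phi2 a b).
Hypothesis (cphi2 : cont_on phi2 a b).
Hypothesis bchi : forall x, a <= x <= b -> `|chi x| <= M /\ `|chi1 x| <= M.
Hypothesis m0 : 0 < m.
Hypothesis bphi2 : forall x, a <= x <= b -> m <= phi2 x.

Let q x := phi1 x ^+ 2 + m.
Let q0 x : 0 < q x. Proof. by rewrite ltr_wpDl ?sqr_ge0. Qed.
Let q0' x : q x != 0. Proof. by rewrite gt_eqF. Qed.
Let cphi := deriv_on_cont dphi.
Let cphi1 := deriv_on_cont dphi1.
Let cchi := deriv_on_cont dchi.
Let cq : cont_on (fun x => (q x)^-1) a b.
Proof.
by apply: cont_onV => //; apply: cont_onD; [exact: cont_onX|exact: cont_on_cst].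
Qed.

Let dq x : a <= x <= b -> is_derive x 1 (fun y => (q y)^-1) (- (2 * phi1 x * phi2 x) / q x ^+ 2).
Proof.
move=> xab; have dx := dphi1 xab.
have dqx : is_derive x 1 q (2 * phi1 x * phi2 x).
  have -> : q = fun x => phi1 x * phi1 x + m by apply/funext => z; rewrite /q expr2.
  by apply: is_derive_eq; rewrite /GRing.scale /=; ring.
have := is_deriveV (q0' x) dqx.
by rewrite (_ : _ *: _ = - (2 * phi1 x * phi2 x) / q x ^+ 2)// /GRing.scale /= mulrC mulrN mulNr.
Qed.

(* The weight is split as 1 = phi'^2 / (phi'^2 + m) + m / (phi'^2 + m): the first
   part is integrated by parts, and both remainders are controlled by the total
   variation of [atan (phi' / sqrt m)]. *)
Let A x := chi x * (phi1 x * (q x)^-1).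
Let A1 x := chi1 x * (phi1 x * (q x)^-1) + chi x * (phi2 x * (m - phi1 x ^+ 2) / q x ^+ 2).

Let dA : deriv_on A A1 a b.
Proof.
move=> x xab; have d1 := dchi xab; have d2 := dq xab; have d3 := dphi1 xab.
apply: is_derive_eq; rewrite /GRing.scale /= /A1 /q; field; exact: q0'.
Qed.

Let cA1 : cont_on A1 a b.
Proof.
apply: cont_onD; apply: cont_onM => //; first exact: cont_onM.
apply: cont_onM; last first.
  apply: cont_onV; first by move=> x _; rewrite expf_neq0.
  by apply: cont_onX; apply: cont_onD; [exact: cont_onX|exact: cont_on_cst].
apply: cont_onM => //; apply: cont_onD; first exact: cont_on_cst.
by apply: cont_onN; exact: cont_onX.
Qed.

Let sm := Num.sqrt m.
Let sm0 : 0 < sm. Proof. by rewrite sqrtr_gt0. Qed.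
Let sm2 : sm ^+ 2 = m. Proof. by rewrite sqr_sqrtr// ltW. Qed.

Let g x := phi2 x * (q x)^-1.
Let cg : cont_on g a b. Proof. exact: cont_onM. Qed.

Let intg : \int[mu]_(x in `[a, b]) g x <= pi / sm.
Proof.
have dat : deriv_on (fun x => sm^-1 * atan (sm^-1 * phi1 x)) g a b.
  move=> x xab; have d1 := dphi1 xab.
  have -> : g x = sm^-1 * ((1 + (sm^-1 * phi1 x) ^+ 2)^-1 * (sm^-1 * phi2 x)).
    rewrite /g /q -sm2; field; rewrite gt_eqF//= gt_eqF//.
    by rewrite addrC ltr_wpDl ?sqr_ge0// exprn_gt0.
  have dm : is_derive x 1 (fun x => sm^-1 * phi1 x) (sm^-1 * phi2 x).
    by apply: is_derive_eq; rewrite /GRing.scale /=; ring.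
  have da : is_derive x 1 (fun x => atan (sm^-1 * phi1 x))
     ((1 + (sm^-1 * phi1 x) ^+ 2)^-1 * (sm^-1 * phi2 x)).
    exact: is_derive1_comp.
  by apply: is_derive_eq; rewrite /GRing.scale /=; ring.
rewrite (Rint_FTC2 ab dat cg) -mulrBr mulrC ler_wpM2r ?invr_ge0 ?(ltW sm0)//.
have := atan_ltpi2 (sm^-1 * phi1 b); have := atan_gtNpi2 (sm^-1 * phi1 a); lra.
Qed.

Let M0 : 0 <= M.
Proof. by have [h _] := bchi (x := a) (introT andP (conj (lexx a) (ltW ab))); exact: le_trans h. Qed.

Let psi_le x : `|phi1 x * (q x)^-1| <= (2 * sm)^-1.
Proof.
rewrite normrM normfV (gtr0_norm (q0 x)) ler_pdivrMr//.
rewrite mulrC ler_pdivlMr ?mulr_gt0// /q -sm2 -(real_normK (num_real (phi1 x))).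
rewrite -subr_ge0 (_ : _ - _ = (`|phi1 x| - sm) ^+ 2) ?sqr_ge0//; ring.
Qed.

Let A1_le x : a <= x <= b -> `|A1 x| <= M * (2 * sm)^-1 + M * g x.
Proof.
move=> xab; have [c0 c1] := bchi xab; have p2 := bphi2 xab.
have p20 : 0 < phi2 x by exact: lt_le_trans p2.
apply: le_trans (ler_normD _ _) _; apply: lerD; rewrite normrM ler_pM// /g.
rewrite -mulrA normrM (gtr0_norm p20) ler_wpM2l ?(ltW p20)//.
rewrite normrM normfV (gtr0_norm (exprn_gt0 2 (q0 x))) ler_pdivrMr ?exprn_gt0//.
rewrite (_ : (q x)^-1 * q x ^+ 2 = q x); last by field; exact: q0'.
by rewrite ler_norml /q; have := sqr_ge0 (phi1 x); have := m0; move=> ? ?; apply/andP; split; lra.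
Qed.

(** Van der Corput's second derivative bound. The part integrated by parts costs
    [M (b - a) / (2 sqrt m)] for the derivative of [chi] and [M pi / sqrt m] for that of [phi1 / q];
    the remaining part, where [m / q <= phi2 / q], costs another [M pi / sqrt m]. *)
Lemma stationary th : `|\int[mu]_(x in `[a, b]) (chi x * cos (phi x + th))| <=
  M * ((b - a) / 2 + 2 * pi) / Num.sqrt m.
Proof.
have cth : cont_on (fun x => phi x + th) a b.
  by apply: cont_onD => //; exact: cont_on_cst.
have cc := cont_on_cos cth; have cs := cont_on_sin cth.
have cmq : cont_on (fun x => m * (q x)^-1) a b.
  by apply: cont_onM => //; exact: cont_on_cst.
have c1 : cont_on (fun x => A x * (phi1 x * cos (phi x + th))) a b.
  apply: cont_onM; last exact: cont_onM.
  by apply: cont_onM => //; exact: cont_onM.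
have c2 : cont_on (fun x => chi x * (m * (q x)^-1) * cos (phi x + th)) a b.
  by apply: cont_onM => //; exact: cont_onM.
have -> : \int[(@lebesgue_measure R)]_(x in `[a, b]) (chi x * cos (phi x + th)) =
  \int[mu]_(x in `[a, b]) (A x * (phi1 x * cos (phi x + th))) +
  \int[mu]_(x in `[a, b]) (chi x * (m * (q x)^-1) * cos (phi x + th)).
  rewrite -RintegralD//; try exact: cont_on_int.
  by apply: eq_Rintegral => x _; rewrite /A /q; field; exact: q0'.
apply: le_trans (ler_normD _ _) _.
have -> : M * ((b - a) / 2 + 2 * pi) / Num.sqrt m =
  (M * (2 * sm)^-1 * (b - a) + M * (pi / sm)) + M * (pi / sm).
  by rewrite -/sm; field; rewrite gt_eqF.
have cMg : cont_on (fun x => M * g x) a b by apply: cont_onM => //; exact: cont_on_cst.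
have iMg : \int[mu]_(x in `[a, b]) (M * g x) <= M * (pi / sm).
  by rewrite RintegralZl//; [exact: ler_wpM2l|exact: cont_on_int].
apply: lerD.
  rewrite (osc_ibp th ab dA cA1 dphi cphi1) /A ?chia ?chib ?mul0r// normrN.
  apply: (@le_trans _ _ (\int[mu]_(x in `[a, b]) (M * (2 * sm)^-1 + M * g x))).
    apply: Rint_norm_le.
    - exact: cont_onM.
    - by apply: cont_onD => //; exact: cont_on_cst.
    - move=> x xab; rewrite normrM; apply: le_trans (A1_le xab).
      by rewrite ler_piMr// ler_norml sin_geN1 sin_le1.
  rewrite RintegralD//; [|exact/cont_on_int/cont_on_cst|exact: cont_on_int].
  by rewrite Rint_cst//; exact: lerD.
apply: le_trans iMg; apply: Rint_norm_le => //.
move=> x xab; have [c0 _] := bchi xab.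
rewrite -mulrA normrM ler_pM// normrM -[X in _ <= X]mulr1 ler_pM//.
  rewrite normrM normfV (gtr0_norm m0) (gtr0_norm (q0 x)) ler_wpM2r ?invr_ge0 ?(ltW (q0 x))//.
  exact: bphi2.
by rewrite ler_norml cos_geN1 cos_le1.
Qed.

End stationary.

(** * Polynomial cutoffs and the kernel of a linear phase *)

Section bump.
Context {R : realType}.
Implicit Types (a b u : R).

(** A polynomial with double zeros at both end points: the value and the first derivative vanish
    there, which is what two integrations by parts require, and all derivatives are explicit. Its
    exact shape on the segment is immaterial. *)
Definition bump a b u : R := ((u - a) * (b - u)) ^+ 2.
Definition bump1 a b u : R := 2 * ((u - a) * (b - u)) * (a + b - 2 * u).
Definition bump2 a b u : R := 2 * (a + b - 2 * u) ^+ 2 - 4 * ((u - a) * (b - u)).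

Lemma bump_ge0 a b u : 0 <= bump a b u. Proof. exact: sqr_ge0. Qed.

Lemma is_derive_bump a b u : is_derive u 1 (bump a b) (bump1 a b u).
Proof.
have -> : bump a b = fun x => (x - a) * (b - x) * ((x - a) * (b - x)).
  by apply/funext => x; rewrite /bump expr2.
by apply: is_derive_eq; rewrite /GRing.scale /= /bump1; ring.
Qed.

Lemma is_derive_bump1 a b u : is_derive u 1 (bump1 a b) (bump2 a b u).
Proof.
have -> : bump1 a b = fun x => 2 * ((x - a) * (b - x)) * (a + b - 2 * x) by [].
by apply: is_derive_eq; rewrite /GRing.scale /= /bump2; ring.
Qed.

Lemma continuous_bump a b : continuous (bump a b).
Proof. by move=> x; exact: is_derive_cont (is_derive_bump a b x). Qed.

Lemma continuous_bump1 a b : continuous (bump1 a b).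
Proof. by move=> x; exact: is_derive_cont (is_derive_bump1 a b x). Qed.

Lemma continuous_bump2 a b : continuous (bump2 a b).
Proof.
move=> x; have -> : bump2 a b = fun x => 2 * ((a + b - 2 * x) * (a + b - 2 * x)) - 4 * ((x - a) * (b - x)).
  by apply/funext => z; rewrite /bump2 expr2.
by apply: (@is_derive_cont _ _ x); apply: is_derive_eq.
Qed.

Lemma bump_bound a b : a < b -> exists2 M, 0 < M & forall x, a <= x <= b ->
  [/\ `|bump a b x| <= M, `|bump1 a b x| <= M & `|bump2 a b x| <= M].
Proof.
move=> ab; pose d := b - a; have d0 : 0 < d by rewrite subr_gt0.
exists (d ^+ 4 + 2 * d ^+ 3 + 6 * d ^+ 2).
  by rewrite !addr_gt0 ?mulr_gt0 ?exprn_gt0.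
move=> x /andP[ax xb].
have p0 : 0 <= (x - a) * (b - x) by rewrite mulr_ge0 ?subr_ge0.
have p1 : (x - a) * (b - x) <= d ^+ 2.
  by rewrite expr2 ler_pM ?subr_ge0// /d; lra.
have q1 : `|a + b - 2 * x| <= d by rewrite ler_norml /d; apply/andP; split; lra.
have d2 : 0 <= d ^+ 2 by rewrite sqr_ge0.
have d3 : 0 <= d ^+ 3 by rewrite exprn_ge0 ?ltW.
have d4 : 0 <= d ^+ 4 by rewrite exprn_ge0 ?ltW.
have b0 : `|bump a b x| <= d ^+ 4.
  rewrite ger0_norm ?bump_ge0// /bump (_ : d ^+ 4 = (d ^+ 2) ^+ 2); last by rewrite -exprM.
  by rewrite lerXn2r ?nnegrE.
have b1 : `|bump1 a b x| <= 2 * d ^+ 3.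
  rewrite /bump1 normrM (ger0_norm (mulr_ge0 _ p0))// (_ : 2 * d ^+ 3 = 2 * d ^+ 2 * d); last by ring.
  by apply: ler_pM => //; [rewrite mulr_ge0|exact: ler_wpM2l].
have b2 : `|bump2 a b x| <= 6 * d ^+ 2.
  rewrite /bump2; apply: le_trans (ler_normB _ _) _.
  rewrite (_ : 6 * d ^+ 2 = 2 * d ^+ 2 + 4 * d ^+ 2); last by ring.
  apply: lerD; rewrite normrM ger0_norm// ler_wpM2l//.
    by rewrite normrX; apply: lerXn2r; rewrite ?nnegrE ?(ltW d0).
  by rewrite ger0_norm.
by split; lra.
Qed.

Lemma bump_left a b : bump a b a = 0.
Proof. by rewrite /bump subrr mul0r expr0n. Qed.
Lemma bump_right a b : bump a b b = 0.
Proof. by rewrite /bump subrr mulr0 expr0n. Qed.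
Lemma bump1_left a b : bump1 a b a = 0.
Proof. by rewrite /bump1 subrr mul0r mulr0 mul0r. Qed.
Lemma bump1_right a b : bump1 a b b = 0.
Proof. by rewrite /bump1 subrr !mulr0 mul0r. Qed.

Lemma bump_osc_trivial a b M (phi : R -> R) : a < b -> cont_on phi a b ->
  (forall x, a <= x <= b -> `|bump a b x| <= M) ->
  `|\int[mu]_(x in `[a, b]) (bump a b x * cos (phi x))| <= M * (b - a).
Proof.
move=> ab cphi bM; apply: Rint_le_bound => //.
  by apply: cont_onM; [move=> x _; exact: continuous_bump|exact: cont_on_cos].
move=> x xab; rewrite normrM; apply: le_trans (bM x xab).
by rewrite ler_piMr// ler_norml cos_geN1 cos_le1.
Qed.

(** The constant depends on the segment and on [K] only, not on the phase. This uniformity is what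
    allows rescaling to arbitrary frequencies and times. *)
Lemma bump_nonstat a b K : a < b -> 0 <= K -> exists2 C, 0 < C &
  forall phi phi1 phi2 phi3 : R -> R, forall nu th : R, 0 < nu ->
  deriv_on phi phi1 a b -> deriv_on phi1 phi2 a b -> deriv_on phi2 phi3 a b ->
  cont_on phi3 a b ->
  (forall x, a <= x <= b -> nu <= `|phi1 x|) ->
  (forall x, a <= x <= b -> `|phi2 x| <= K * nu) ->
  (forall x, a <= x <= b -> `|phi3 x| <= K * nu) ->
  `|\int[mu]_(x in `[a, b]) (bump a b x * cos (phi x + th))| <= C / nu ^+ 2.
Proof.
move=> ab K0; have [M M0 bM] := bump_bound ab.
exists (M * (1 + 4 * K + 3 * K ^+ 2) * (b - a)).
  by rewrite !mulr_gt0 ?subr_gt0// -addrA ltr_pwDl// addr_ge0 ?mulr_ge0 ?sqr_ge0.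
move=> phi phi1 phi2 phi3 nu th nu0 d0 d1 d2 c3 p1 p2 p3.
apply: (@nonstationary _ _ (bump1 a b) (bump2 a b) phi phi1 phi2 phi3) => //.
- by move=> x _; exact: is_derive_bump.
- by move=> x _; exact: is_derive_bump1.
- by move=> x _; exact: continuous_bump2.
- exact: bump_left.
- exact: bump_right.
- exact: bump1_left.
- exact: bump1_right.
Qed.

(** For [|y| <= 1] the trivial bound is enough. Otherwise the phase has constant derivative [y], so
    the nonstationary bound applies with [K = 0] and [nu = |y|], and [1 + y^2 <= 2 y^2]. *)
Lemma linear_kernel a b : a < b -> exists2 C, 0 < C & forall y th : R,
  `|\int[mu]_(x in `[a, b]) (bump a b x * cos (y * x + th))| <= C / (1 + y ^+ 2).
Proof.
move=> ab; have [M M0 bM] := bump_bound ab.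
have [C C0 bC] := bump_nonstat ab (lexx 0).
have Mab : 0 < M * (b - a) by rewrite mulr_gt0 ?subr_gt0.
exists (2 * (M * (b - a) + C)); first by rewrite mulr_gt0 ?addr_gt0.
move=> y th; have s0 : 0 < 1 + y ^+ 2 by rewrite ltr_pwDl ?sqr_ge0.
have dl : deriv_on (fun x => y * x) (fun=> y) a b.
  by move=> x _; apply: is_derive_eq; rewrite /GRing.scale /=; ring.
rewrite ler_pdivlMr//; have [y1|y1] := leP `|y| 1.
  have y2 : y ^+ 2 <= 1 by rewrite -real_normK ?num_real// expr_le1.
  have h : `|\int[mu]_(x in `[a, b]) (bump a b x * cos (y * x + th))| <= M * (b - a).
    apply: bump_osc_trivial => //; last by move=> x /bM[].
    by apply: cont_onD; [exact: deriv_on_cont dl|exact: cont_on_cst].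
  apply: (@le_trans _ _ (M * (b - a) * 2)); last lra.
  by rewrite ler_pM//; lra.
have y0 : 0 < `|y| by rewrite (lt_trans ltr01).
have y2 : 1 <= y ^+ 2 by rewrite -real_normK ?num_real// expr_ge1 ?ltW.
have dc (c : R) : deriv_on (fun=> c) (fun=> 0) a b by move=> x _; exact: is_derive_cst.
have h : `|\int[mu]_(x in `[a, b]) (bump a b x * cos (y * x + th))| <= C / y ^+ 2.
  rewrite -(real_normK (num_real y)).
  apply: (bC (fun x => y * x) (fun=> y) (fun=> 0) (fun=> 0)) => //.
  - exact: cont_on_cst.
  - by move=> x _; rewrite normr0 mul0r.
  - by move=> x _; rewrite normr0 mul0r.
apply: (@le_trans _ _ (C / y ^+ 2 * (y ^+ 2 + y ^+ 2))).
  by rewrite ler_pM// ?addr_ge0 ?sqr_ge0//; lra.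
rewrite mulrDr divfK; last by rewrite sqrf_eq0 -normr_gt0.
lra.
Qed.

End bump.

Section power_kernel.
Context {R : realType}.
Variables (al be a : R).
Hypotheses (al0 : 0 < al) (ab : al < be) (a0 : 0 < a) (a1 : a != 1).

Lemma ler_powRl (p u v : R) : 0 <= p -> 0 <= u -> u <= v -> u `^ p <= v `^ p.
Proof. by move=> p0 u0 uv; apply: ge0_ler_powR; rewrite ?nnegrE// (le_trans u0). Qed.

Lemma powR_between p : exists2 m, 0 < m & forall u, al <= u <= be -> u `^ p <= m.
Proof.
have be0 : 0 < be by exact: lt_trans ab.
exists (al `^ p + be `^ p); first by rewrite addr_gt0 ?powR_gt0.
move=> u /andP[au ub]; have u0 : 0 < u by exact: lt_le_trans au.
have [p0|p0] := leP 0 p.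
  by apply: ler_wpDl; [exact: powR_ge0|apply: ler_powRl => //; exact: ltW].
apply: ler_wpDr; first exact: powR_ge0.
rewrite -[p]opprK !(powRN _ (- p)) lef_pV2 ?posrE ?powR_gt0//.
by apply: ler_powRl => //; rewrite ?oppr_ge0 ltW.
Qed.

Lemma powR_between_low p : exists2 m, 0 < m & forall u, al <= u <= be -> m <= u `^ p.
Proof.
have [m m0 hm] := powR_between (- p).
exists m^-1; first by rewrite invr_gt0.
move=> u uab; have u0 : 0 < u by case/andP: uab => au _; exact: lt_le_trans au.
by rewrite -[p]opprK powRN lef_pV2 ?posrE ?powR_gt0// hm.
Qed.

Let deriv_pow (c p : R) : deriv_on (fun u => c * u `^ p) (fun u => c * p * u `^ (p - 1)) al be.
Proof.
move=> u /andP[au _]; have u0 : 0 < u by exact: lt_le_trans au.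
have d := is_derive1_powR p u0.
by apply: is_derive_eq; rewrite /GRing.scale /=; ring.
Qed.

Let deriv_lin (y : R) (f g : R -> R) : deriv_on f g al be ->
  deriv_on (fun u => y * u + f u) (fun u => y + g u) al be.
Proof.
move=> fg u uab; have d := fg u uab.
by apply: is_derive_eq; rewrite /GRing.scale /=; ring.
Qed.

Let deriv_cst (y : R) (f g : R -> R) : deriv_on f g al be ->
  deriv_on (fun u => y + f u) g al be.
Proof.
move=> fg u uab; have d := fg u uab.
by apply: is_derive_eq; rewrite /GRing.scale /=; ring.
Qed.

(** The derivative of the phase is [y + sg * a * u^(a-1)]. If [|y|] dominates [|sg|] there is no
    stationary point and the decay is quadratic. Otherwise the second derivative has size at least a
    constant times [|sg|], hence times [|y|], and only [|y|^(-1/2)] is gained. The constants are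
    uniform in [y], [sg] and [th]. *)
Lemma power_kernel : exists C D : R, [/\ 0 < C, 0 < D & forall y sg th : R,
  `|\int[mu]_(u in `[al, be]) (bump al be u * cos (y * u + sg * u `^ a + th))| <=
  C / (1 + y ^+ 2) + (if `|y| <= D * `|sg| then C / Num.sqrt (1 + `|y|) else 0)].
Proof.
have [M M0 bM] := bump_bound ab.
have [m1 m10 hm1] := powR_between (a - 1).
have [m2 m20 hm2] := powR_between (a - 1 - 1).
have [m3 m30 hm3] := powR_between (a - 1 - 1 - 1).
have [c2 c20 hc2] := powR_between_low (a - 1 - 1).
(* Chosen so that [D |sg| < |y|] forces [|sg a u^(a-1)| <= |y| / 2], leaving a derivative of size at
   least [|y| / 2]. *)
pose D := 2 * (a * m1); have D0 : 0 < D by rewrite !mulr_gt0.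
pose e2 := `|a * (a - 1)| * m2; pose e3 := `|a * (a - 1) * (a - 1 - 1)| * m3.
have e20 : 0 <= e2 by rewrite mulr_ge0// ltW.
have e30 : 0 <= e3 by rewrite mulr_ge0// ltW.
(* With [nu = |y| / 2] this makes [K * nu = (e2 + e3) |y| / D], which is at least [(e2 + e3) |sg|]
   in the nonstationary regime. *)
pose K := 2 * (e2 + e3) / D.
have K0 : 0 <= K by apply: divr_ge0; [apply: mulr_ge0 => //; exact: addr_ge0|exact: ltW].
have [C1 C10 bC1] := bump_nonstat ab K0.
pose Mab := M * (be - al); have Mab0 : 0 < Mab by rewrite mulr_gt0 ?subr_gt0.
(* Lower bound for the second derivative of [u^a] on the segment; its positivity is where [a <> 1]
   is used. *)
pose g2 := `|a * (a - 1)| * c2.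
have g20 : 0 < g2.
  by rewrite mulr_gt0// normr_gt0 mulf_neq0//; [exact: lt0r_neq0|rewrite subr_eq0].
pose M2 := M * ((be - al) / 2 + 2 * pi).
have M20 : 0 <= M2.
  apply: mulr_ge0; first exact: ltW.
  by have := @pi_gt0 R; move: ab; rewrite -subr_gt0 => h1 h2; lra.
pose C2 := M2 * Num.sqrt (2 * D / g2).
have C20 : 0 <= C2 by rewrite mulr_ge0 ?sqrtr_ge0.
pose C := 2 * Mab + 8 * C1 + C2.
have C0 : 0 < C by rewrite /C; lra.
have MabC : Mab * 2 <= C by rewrite /C; lra.
have C1C : 4 * C1 * 2 <= C by rewrite /C; lra.
have C2C : C2 <= C by rewrite /C; lra.
exists C, D; split => // y sg th.
have d0 := deriv_lin y (deriv_pow sg a).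
have d1 := deriv_cst y (deriv_pow (sg * a) (a - 1)).
have d2 := deriv_pow (sg * a * (a - 1)) (a - 1 - 1).
have d3 := deriv_pow (sg * a * (a - 1) * (a - 1 - 1)) (a - 1 - 1 - 1).
have triv : `|\int[mu]_(u in `[al, be]) (bump al be u * cos (y * u + sg * u `^ a + th))| <= Mab.
  apply: bump_osc_trivial => //; last by move=> x /bM[].
  by apply: cont_onD; [exact: deriv_on_cont d0|exact: cont_on_cst].
have s0 : 0 < 1 + y ^+ 2 by rewrite ltr_pwDl ?sqr_ge0.
have q0 : 0 <= C / Num.sqrt (1 + `|y|) by rewrite divr_ge0 ?sqrtr_ge0 ?ltW.
have [y1|y1] := leP `|y| 1.
  have y2 : y ^+ 2 <= 1 by rewrite -real_normK ?num_real// expr_le1.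
  apply: (@le_trans _ _ (C / (1 + y ^+ 2))); last by rewrite lerDl; case: ifP.
  rewrite (ler_pdivlMr _ _ s0); apply: le_trans MabC.
  by apply: (ler_pM (normr_ge0 _) (ltW s0) triv); exact: (lerD (lexx 1) y2).
have y0 : 0 < `|y| by rewrite (lt_trans ltr01).
have y2 : 1 <= y ^+ 2 by rewrite -real_normK ?num_real// expr_ge1 ?ltW.
have C1i : 0 <= C / (1 + y ^+ 2) by rewrite divr_ge0 ?ltW.
case: ifPn => [yD|]; last first.
  rewrite -ltNge addr0 => yD; have n0 : 0 < `|y| / 2 by rewrite divr_gt0.
  have DK : K * (`|y| / 2) = (e2 + e3) * (`|y| / D) by rewrite /K; field; rewrite gt_eqF.
  have sgle : `|sg| <= `|y| / D by rewrite ler_pdivlMr// mulrC ltW.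
  have hh : `|\int[mu]_(u in `[al, be]) (bump al be u * cos (y * u + sg * u `^ a + th))|
     <= C1 / (`|y| / 2) ^+ 2.
    apply: (bC1 _ _ _ _ (`|y| / 2) th n0 d0 d1 d2 (deriv_on_cont d3)) => x xab.
    - have h1 : `|sg * a * x `^ (a - 1)| <= `|y| / 2.
        rewrite !normrM (gtr0_norm a0) (ger0_norm (powR_ge0 _ _)).
        apply: (@le_trans _ _ (`|sg| * a * m1)); last first.
          rewrite ler_pdivlMr// (_ : _ * 2 = D * `|sg|) ?ltW//; rewrite /D; ring.
        by apply: ler_wpM2l; [rewrite mulr_ge0 ?(ltW a0)|exact: hm1].
      have := lerB_dist y (- (sg * a * x `^ (a - 1))); rewrite opprK normrN.
      by apply: le_trans; rewrite lerBrDr [leRHS]splitr lerD2l.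
    - rewrite DK; apply: (@le_trans _ _ (e2 * `|sg|)).
        rewrite (_ : sg * a * (a - 1) * _ = a * (a - 1) * x `^ (a - 1 - 1) * sg); last by ring.
        rewrite normrM ler_wpM2r// normrM (ger0_norm (powR_ge0 _ _)) ler_wpM2l//; exact: hm2.
      by rewrite ler_pM// lerDl.
    - rewrite DK; apply: (@le_trans _ _ (e3 * `|sg|)).
        rewrite (_ : sg * a * (a - 1) * _ * _ =
          a * (a - 1) * (a - 1 - 1) * x `^ (a - 1 - 1 - 1) * sg); last by ring.
        rewrite normrM ler_wpM2r// normrM (ger0_norm (powR_ge0 _ _)) ler_wpM2l//; exact: hm3.
      by rewrite ler_pM// lerDr.
  apply: le_trans hh _; rewrite exprMn real_normK ?num_real// ler_pdivlMr//.
  rewrite (_ : C1 / _ * _ = 4 * C1 * ((1 + y ^+ 2) / y ^+ 2)); last first.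
    by field; rewrite -normr_gt0.
  apply: le_trans C1C.
  apply: ler_wpM2l; first by rewrite mulr_ge0// ltW.
  by rewrite ler_pdivrMr ?(lt_le_trans ltr01 y2)// mulr_natl mulr2n lerD2r.
have sg0 : 0 < `|sg| by rewrite -(pmulr_rgt0 _ D0) (lt_le_trans y0).
apply: (@le_trans _ _ (C / Num.sqrt (1 + `|y|))); last by rewrite lerDr.
apply: (@le_trans _ _ (M2 / Num.sqrt (g2 * `|sg|))); last first.
  apply: (@le_trans _ _ (C2 / Num.sqrt (1 + `|y|))); last first.
    by rewrite ler_wpM2r ?invr_ge0 ?sqrtr_ge0.
  have r1 : 0 < Num.sqrt (g2 * `|sg|) by rewrite sqrtr_gt0 mulr_gt0.
  have r2 : 0 < Num.sqrt (1 + `|y|) by rewrite sqrtr_gt0 addr_gt0.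
  rewrite ler_pdivrMr// mulrAC ler_pdivlMr// /C2 -[X in _ <= X]mulrA.
  apply: ler_wpM2l => //.
  have t0 : 0 <= 2 * D / g2.
    by apply: divr_ge0; [apply: mulr_ge0 => //; exact: ltW|exact: ltW].
  rewrite -(sqrtrM _ t0).
  rewrite (_ : 2 * D / g2 * _ = 2 * (D * `|sg|)); last by field; rewrite gt_eqF.
  by apply: ler_wsqrtr; rewrite mulr_natl mulr2n lerD// (le_trans (ltW y1)).
have st (y' sg' th' : R) : 0 < sg' * (a * (a - 1)) ->
  `|\int[mu]_(u in `[al, be]) (bump al be u * cos (y' * u + sg' * u `^ a + th'))| <=
    M2 / Num.sqrt (g2 * `|sg'|).
  move=> sa0; have e0 := deriv_lin y' (deriv_pow sg' a).
  have e1 := deriv_cst y' (deriv_pow (sg' * a) (a - 1)).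
  have e2' := deriv_pow (sg' * a * (a - 1)) (a - 1 - 1).
  have sg'0 : 0 < `|sg'|.
    by rewrite normr_gt0; apply: contraTneq sa0 => ->; rewrite mul0r ltxx.
  apply: (@stationary _ _ (bump1 al be) _ _ _ al be M _ ab _ _ _ _ e0 e1 (deriv_on_cont e2')).
  - by move=> x _; exact: is_derive_bump.
  - by move=> x _; exact: continuous_bump1.
  - exact: bump_left.
  - exact: bump_right.
  - by move=> x /bM[].
  - exact: mulr_gt0.
  - move=> x xab; rewrite (_ : sg' * a * (a - 1) * _ = sg' * (a * (a - 1)) * x `^ (a - 1 - 1)); last by ring.
    rewrite -(gtr0_norm sa0) normrM /g2 mulrC mulrA ler_pM//.
    + exact: ltW.
    + exact: hc2.
have sa : sg * (a * (a - 1)) != 0.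
  rewrite mulf_neq0//; first by rewrite -normr_gt0.
  by rewrite mulf_neq0//; [exact: lt0r_neq0|rewrite subr_eq0].
(* The stationary bound wants a positive second derivative. In the other case the whole phase is
   negated, which the evenness of cosine allows. *)
have [sn|sp] := ltP (sg * (a * (a - 1))) 0; last first.
  by apply: st; rewrite lt_neqAle eq_sym sa.
have -> : \int[(@lebesgue_measure R)]_(u in `[al, be]) (bump al be u * cos (y * u + sg * u `^ a + th)) =
   \int[mu]_(u in `[al, be]) (bump al be u * cos ((- y) * u + (- sg) * u `^ a + (- th))).
  by apply: eq_Rintegral => u _; rewrite -cosN; congr (_ * cos _); ring.
by rewrite -(normrN sg); apply: st; rewrite mulNr oppr_gt0.
Qed.
End power_kernel.

(** * An explicit integrable majorant of the kernels, and changes of variable *)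

Section majorant.
Context {R : realType}.
Implicit Types (v S : R).

(** A substitute for [(1 + |v|)^(-1/2)] cut off at [1 + |v| <= S]. The sharp cutoff is replaced by a
    rational factor, at least 1/2 in that range (hence the leading 2), so that the function is
    continuous and has an elementary primitive. *)
Definition tailmaj S v : R := 2 * (Num.sqrt (1 + `|v|))^-1 * (1 + (1 + `|v|) / S)^-1.
Definition kmaj S v : R := (oneDsqr v)^-1 + tailmaj S v.

Let s0 v : 0 < Num.sqrt (1 + `|v|). Proof. by rewrite sqrtr_gt0 ltr_pwDl. Qed.

Let t0 S v : 0 < S -> 0 < 1 + (1 + `|v|) / S.
Proof. by move=> S0; rewrite ltr_pwDl// divr_ge0 ?(ltW S0)// addr_ge0. Qed.

Lemma tailmaj_ge0 S v : 0 < S -> 0 <= tailmaj S v.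
Proof.
move=> S0; apply: mulr_ge0; last by rewrite invr_ge0; exact: ltW (t0 _ S0).
by apply: mulr_ge0 => //; rewrite invr_ge0; exact: ltW.
Qed.

Lemma oneDsqr_gt0 v : 0 < oneDsqr v.
Proof. by rewrite (lt_le_trans ltr01)// oneDsqr_ge1. Qed.

Lemma kmaj_ge0 S v : 0 < S -> 0 <= kmaj S v.
Proof.
by move=> S0; apply: addr_ge0; [rewrite invr_ge0; exact: ltW (oneDsqr_gt0 v)|exact: tailmaj_ge0].
Qed.

Lemma kmajN S v : kmaj S (- v) = kmaj S v.
Proof. by rewrite /kmaj /tailmaj /oneDsqr sqrrN normrN. Qed.

Lemma continuous_tailmaj S : 0 < S -> continuous (tailmaj S).
Proof.
move=> S0 v; suff: cont_on (tailmaj S) v v by apply; rewrite lexx.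
have cn : cont_on (fun v : R => 1 + `|v|) v v.
  by apply: cont_onD; [exact: cont_on_cst|move=> x _; exact: norm_continuous].
apply: cont_onM; last first.
  apply: cont_onV; first by move=> x _; rewrite gt_eqF// t0.
  apply: cont_onD; first exact: cont_on_cst.
  by apply: cont_onM => //; exact: cont_on_cst.
apply: cont_onM; first exact: cont_on_cst.
apply: cont_onV; first by move=> x _; rewrite gt_eqF.
by move=> x /cn cx; apply: continuous_comp cx _; exact: sqrt_continuous.
Qed.

Lemma continuous_kmaj S : 0 < S -> continuous (kmaj S).
Proof.
move=> S0 v; suff: cont_on (kmaj S) v v by apply; rewrite lexx.
apply: cont_onD; first by move=> x _; exact: continuous_oneDsqrV.
by move=> x _; exact: continuous_tailmaj.
Qed.

Lemma tailmaj_low S v : 0 < S -> 1 + `|v| <= S -> (Num.sqrt (1 + `|v|))^-1 <= tailmaj S v.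
Proof.
move=> S0 vS; rewrite /tailmaj -mulrA mulrCA ler_peMr ?invr_ge0 ?(ltW (s0 v))//.
rewrite ler_pdivlMr ?t0// mul1r.
have : (1 + `|v|) / S <= 1 by rewrite ler_pdivrMr// mul1r.
lra.
Qed.

(** The square root of [S] is the growth of the integral of [|v|^(-1/2)] up to [S]; it becomes the
    loss [sqrt (b L^a)] of the maximal estimate. *)
Lemma integral_tailmaj S : 0 < S ->
  (\int[mu]_v (tailmaj S v)%:E <= (4 * pi * Num.sqrt S)%:E)%E.
Proof.
move=> S0; have q0 : 0 < Num.sqrt S by rewrite sqrtr_gt0.
rewrite ge0_symfun_integralT; last 3 first.
- by move=> v; exact: tailmaj_ge0.
- exact: continuous_tailmaj.
- by move=> v; rewrite /= /tailmaj normrN.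
(* A primitive of [tailmaj S] on the half-line, bounded by [2 pi sqrt S]; evenness doubles this. *)
pose F v := 4 * Num.sqrt S * atan ((Num.sqrt S)^-1 * Num.sqrt (1 + v)).
have dF v : 0 < 1 + v -> is_derive v 1 F (2 * (Num.sqrt (1 + v))^-1 * (1 + (1 + v) / S)^-1).
  move=> v0; have sv : 0 < Num.sqrt (1 + v) by rewrite sqrtr_gt0.
  have d1 : is_derive v 1 (fun v => 1 + v) 1 by apply: is_derive_eq; ring.
  have d2 : is_derive v 1 (fun v => Num.sqrt (1 + v)) ((2 * Num.sqrt (1 + v))^-1).
    rewrite -[X in is_derive _ _ _ X]mulr1.
    have ds := is_derive1_sqrt v0; exact: is_derive1_comp.
  have d3 : is_derive v 1 (fun v => (Num.sqrt S)^-1 * Num.sqrt (1 + v))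
      ((Num.sqrt S)^-1 * (2 * Num.sqrt (1 + v))^-1).
    by apply: is_derive_eq; rewrite /GRing.scale /=; ring.
  have d4 : is_derive v 1 (fun v => atan ((Num.sqrt S)^-1 * Num.sqrt (1 + v)))
      ((1 + ((Num.sqrt S)^-1 * Num.sqrt (1 + v)) ^+ 2)^-1 *
        ((Num.sqrt S)^-1 * (2 * Num.sqrt (1 + v))^-1)).
    exact: is_derive1_comp.
  rewrite /F; apply: is_derive_eq; rewrite /GRing.scale /= exprMn exprVn !sqr_sqrtr ?(ltW S0) ?(ltW v0)//.
  field; rewrite !gt_eqF//=; exact: addr_gt0.
rewrite -set_itvcy (@ge0_continuous_FTC2y _ _ F _ (4 * Num.sqrt S * (pi / 2))).
- rewrite -EFinB -EFinM lee_fin.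
  have : 0 <= F 0.
    rewrite /F; apply: mulr_ge0; first by apply: mulr_ge0 => //; exact: ltW.
    by rewrite -atan0 le_atan// mulr_ge0 ?invr_ge0 ?sqrtr_ge0.
  lra.
- by move=> v _; exact: tailmaj_ge0.
- by apply: continuous_subspaceT; exact: continuous_tailmaj.
- apply: cvgM; first exact: cvg_cst.
  suff h : (Num.sqrt S)^-1 * Num.sqrt (1 + v) @[v --> +oo%R] --> +oo%R.
    exact: (cvg_comp _ _ h (@cvgy_atan R)).
  apply/cvgryPge => M; near=> v.
  have : (Num.sqrt S * (1 + `|M|)) ^+ 2 <= v.
    by near: v; apply: nbhs_pinfty_ge; rewrite num_real.
  move=> hv; rewrite mulrC ler_pdivlMr//.
  apply: (@le_trans _ _ (Num.sqrt S * (1 + `|M|))).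
    rewrite mulrC ler_wpM2l ?(ltW q0)//; have := ler_norm M; lra.
  rewrite -[X in X <= _](@ger0_norm _ (Num.sqrt S * (1 + `|M|))); last first.
    by apply: mulr_ge0; [exact: ltW|exact: addr_ge0].
  by rewrite -sqrtr_sqr; apply: ler_wsqrtr; rewrite (le_trans hv)// lerDr.
- by move=> v v0; have := dF v (addr_gt0 ltr01 v0); case.
- have p0 : 0 < 1 + 0 :> R by rewrite addr0.
  have c0 := is_derive_cont (dF 0 p0); exact: cvg_at_right_filter c0.
- move=> v; rewrite in_itv /= andbT => v0.
  rewrite derive1E; have [_ ->] := dF v (addr_gt0 ltr01 v0).
  by rewrite /tailmaj gtr0_norm.
Unshelve. all: by end_near. Qed.

Lemma integral_kmaj S : 0 < S ->
  (\int[mu]_v (kmaj S v)%:E <= (pi + 4 * pi * Num.sqrt S)%:E)%E.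
Proof.
move=> S0; under eq_integral do rewrite EFinD.
rewrite ge0_intD.
- by rewrite integralT_oneDsqr [X in (_ <= X)%E]EFinD; apply: leeD => //; exact: integral_tailmaj.
- by move=> v; rewrite lee_fin invr_ge0; exact: ltW (oneDsqr_gt0 v).
- apply/measurable_EFinP; exact: int_meas int_oneDsqr.
- by move=> v; rewrite lee_fin; exact: tailmaj_ge0.
- apply/measurable_EFinP; apply: continuous_measurable_fun; exact: continuous_tailmaj.
Qed.

Lemma integral_affine (g : R -> R) (L y : R) : 0 < L -> continuous g -> (forall v, 0 <= g v) ->
  (\int[mu]_x (L * g (L * (x - y)))%:E = \int[mu]_x (g x)%:E)%E.
Proof.
move=> L0 cg g0; pose F x := L * (x - y).
have dF (x : R) : is_derive x 1 F L.
  by apply: is_derive_eq; rewrite /GRing.scale /=; ring.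
have F'E : F^`()%classic = cst L.
  by apply/funext => x; rewrite derive1E; have [_ ->] := dF x.
rewrite [RHS](@increasing_ge0_integration_by_substitutionT _ F).
- by apply: eq_integral => x _; rewrite F'E /= mulrC.
- by move=> x z xz; rewrite /F ltr_pM2l// ltrD2r.
- by rewrite F'E => x; exact: cst_continuous.
- by rewrite F'E; exact: is_cvg_cst.
- by rewrite F'E; exact: is_cvg_cst.
- by move=> x; have [] := dF x.
- apply/cvgrNyPle => M; near=> x.
  have : x <= M / L + y by near: x; apply: nbhs_ninfty_le; rewrite num_real.
  by rewrite -lerBlDr ler_pdivlMr// mulrC.
- apply/cvgryPge => M; near=> x.
  have : M / L + y <= x by near: x; apply: nbhs_pinfty_ge; rewrite num_real.
  by rewrite -lerBrDr ler_pdivrMr// mulrC.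
- exact: cg.
- exact: g0.
Unshelve. all: by end_near. Qed.

Lemma Rint_scale (f : R -> R) (L al be : R) : 0 < L -> al < be ->
  cont_on f (al * L) (be * L) ->
  \int[mu]_(x in `[al * L, be * L]) f x = L * \int[mu]_(u in `[al, be]) f (u * L).
Proof.
move=> L0 ab cf; pose F (x : R) := x * L.
have dF (x : R) : is_derive x 1 F L.
  by apply: is_derive_eq; rewrite /GRing.scale /=; ring.
have F'E : F^`()%classic = cst L.
  by apply/funext => x; rewrite derive1E; have [_ ->] := dF x.
have cfL : cont_on (fun u => f (u * L)) al be.
  move=> u /andP[au ub].
  have uu : al * L <= u * L <= be * L by rewrite !ler_pM2r// au ub.
  by apply: (@continuous_comp _ _ _ F f); [exact: is_derive_cont (dF u)|exact: cf].
rewrite -RintegralZl//; last exact: cont_on_int.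
rewrite /Rintegral (@integration_by_substitution_increasing _ F f al be (ltW ab)).
- by congr fine; apply: eq_integral => x _; rewrite F'E /= mulrC.
- by move=> x z _ _ xz; rewrite /F ltr_pM2r.
- by rewrite F'E => x _; exact: cst_continuous.
- by rewrite F'E; exact: is_cvg_cst.
- by rewrite F'E; exact: is_cvg_cst.
- by apply: (@deriv_on_LR _ F (cst L)) => // x _; exact: dF.
- exact: cont_onW.
Qed.

Lemma Rint_opp (f : R -> R) (al be : R) : al < be -> cont_on f (- be) (- al) ->
  \int[mu]_(x in `[- be, - al]) f x = \int[mu]_(u in `[al, be]) f (- u).
Proof.
move=> ab cf; rewrite /Rintegral (@integration_by_substitution_oppr _ f al be (ltW ab))//.
exact: cont_onW.
Qed.

End majorant.

(** * Kernels localised to a ball or to an annulus of frequencies *)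

Section kernels.
Context {R : realType}.

Lemma cont_on_lin (c a b : R) : cont_on (fun x => c * x) a b.
Proof.
apply: (@deriv_on_cont _ _ (fun=> c)) => x _.
by apply: is_derive_eq; rewrite /GRing.scale /=; ring.
Qed.

Lemma int_patch (f : R -> R) (a b : R) : cont_on f a b -> (f \_ `[a, b]) \is_int.
Proof.
move=> cf; have := cont_on_int cf.
by rewrite integrable_mkcond//= restrict_EFin.
Qed.

(** The cutoff only has to dominate the indicator of [|xi| <= L]; the segment [[-2, 2]] leaves room
    for the double zeros. *)
Definition ball_bump (L xi : R) : R := ((fun x => bump (-2) 2 (x / L)) \_ `[(-2) * L, 2 * L]) xi.

(** Two mirrored cutoffs with support away from the origin, where [|xi|^a] is smooth. On
    [1 <= u <= 2] the product [(u - 1/2) (4 - u)] is at least [1/2 * 2 = 1], so their sum dominates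
    the indicator of [L <= |xi| <= 2 L]. *)
Definition annulus_bump (L xi : R) : R :=
  ((fun x => bump 2^-1 4 (x / L)) \_ `[2^-1 * L, 4 * L]) xi +
  ((fun x => bump 2^-1 4 (- x / L)) \_ `[- (4 * L), - (2^-1 * L)]) xi.

Let cont_bump (c a b u v : R) : cont_on (fun x => bump a b (c * x)) u v.
Proof.
move=> x _; apply: (@continuous_comp _ _ _ (fun x => c * x) (bump a b)).
  by apply: (@cont_on_lin c x x); rewrite lexx.
exact: continuous_bump.
Qed.

Let cont_bump1 (L a b u v : R) : cont_on (fun x => bump a b (x / L)) u v.
Proof. by under [X in cont_on X]eq_fun do rewrite mulrC; exact: cont_bump. Qed.

Let cont_bump2 (L a b u v : R) : cont_on (fun x => bump a b (- x / L)) u v.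
Proof.
rewrite (_ : (fun x => _) = fun x => bump a b (- L^-1 * x)); first exact: cont_bump.
by apply/funext => x; congr bump; ring.
Qed.

Let patch_ge0 (f : R -> R) (A : set R) x : (forall x, 0 <= f x) -> 0 <= (f \_ A) x.
Proof. by move=> f0; rewrite patchE; case: ifP. Qed.

Lemma ball_bump_ge0 L x : 0 <= ball_bump L x.
Proof. by apply: patch_ge0 => z; exact: bump_ge0. Qed.

Lemma annulus_bump_ge0 L x : 0 <= annulus_bump L x.
Proof. by apply: addr_ge0; apply: patch_ge0 => z; exact: bump_ge0. Qed.

Lemma int_ball_bump L : ball_bump L \is_int.
Proof. exact: int_patch. Qed.

Lemma int_annulus_bump L : annulus_bump L \is_int.
Proof.
exact: (intD (int_patch (@cont_bump1 L _ _ _ _)) (int_patch (@cont_bump2 L _ _ _ _))).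
Qed.

Lemma ball_bump_ge1 L x : 0 < L -> `|x| <= L -> 1 <= ball_bump L x.
Proof.
move=> L0; rewrite ler_norml => /andP[x1 x2]; rewrite /ball_bump patchE mem_set; last first.
  by rewrite /= in_itv /=; apply/andP; split; lra.
have u1 : -1 <= x / L by rewrite ler_pdivlMr// mulN1r.
have u2 : x / L <= 1 by rewrite ler_pdivrMr// mul1r.
rewrite /bump; set u := x / L in u1 u2 *; apply: exprn_ege1.
apply: (@le_trans _ _ (1 * 1)); first by rewrite mulr1.
by apply: ler_pM => //; lra.
Qed.

Let bump_ann_ge1 u : 1 <= u <= 2 -> 1 <= bump 2^-1 4 (u : R).
Proof.
move=> /andP[u1 u2]; rewrite /bump; apply: exprn_ege1.
apply: (@le_trans _ _ (2^-1 * 2)); first by rewrite mulVf.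
by apply: ler_pM => //; lra.
Qed.

Lemma annulus_bump_ge1 L x : 0 < L -> L <= `|x| <= 2 * L -> 1 <= annulus_bump L x.
Proof.
move=> L0 /andP[x1 x2]; rewrite /annulus_bump; have [x0|x0] := leP 0 x.
  rewrite ger0_norm// in x1 x2.
  apply: ler_wpDr; first by apply: patch_ge0 => z; exact: bump_ge0.
  rewrite patchE mem_set; last by rewrite /= in_itv /=; apply/andP; split; lra.
  by apply: bump_ann_ge1; rewrite ler_pdivlMr// ler_pdivrMr// mul1r x1.
rewrite ltr0_norm// in x1 x2.
apply: ler_wpDl; first by apply: patch_ge0 => z; exact: bump_ge0.
rewrite patchE mem_set; last by rewrite /= in_itv /=; apply/andP; split; lra.
by apply: bump_ann_ge1; rewrite ler_pdivlMr// ler_pdivrMr// mul1r x1.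
Qed.

(** The real and imaginary parts are the real oscillatory integrals with shifts [0] and [- pi / 2];
    hence the factor 2. *)
Lemma cabs_osc_le (chi phi : R -> R) (B : R) : chi \is_int -> measurable_fun setT phi ->
  (forall th, `|\int[mu]_x (chi x * cos (phi x + th))| <= B) ->
  cabs (cintegral (fun x => (chi x)%:C%C * cis (phi x))) <= 2 * B.
Proof.
move=> ichi mphi hB; apply: le_trans (cabs_ReIm _) _.
rewrite (_ : 2 * B = B + B); last by ring.
apply: lerD.
  rewrite (_ : complex.Re _ = \int[mu]_x (chi x * cos (phi x + 0))) ?hB//.
  by apply: eq_Rintegral => x _; rewrite /re_part ReM /= mul0r subr0 addr0.
rewrite (_ : complex.Im _ = \int[mu]_x (chi x * cos (phi x + - (pi / 2)))) ?hB//.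
apply: eq_Rintegral => x _; rewrite /im_part ImM /= mul0r addr0.
by rewrite cosB cos_pihalf sin_pihalf mulr0 mulr1 add0r.
Qed.

Let Rint_patch (f g : R -> R) (a b : R) :
  \int[mu]_x ((f \_ `[a, b]) x * g x) = \int[mu]_(x in `[a, b]) (f x * g x).
Proof.
rewrite [RHS]Rintegral_mkcond; apply: eq_Rintegral => x _.
by rewrite !patchE; case: ifP => //; rewrite mul0r.
Qed.

Lemma ball_kernel : exists2 C, 0 < C & forall L z : R, 0 < L ->
  cabs (cintegral (fun xi => (ball_bump L xi)%:C%C * cis (z * xi))) <=
    C * (L * kmaj 1 (L * z)).
Proof.
have [C C0 hC] := @linear_kernel R (-2) 2 ltac:(lra).
exists (2 * C); first exact: mulr_gt0.
move=> L z L0; rewrite -mulrA; apply: cabs_osc_le.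
- exact: int_ball_bump.
- exact: measurable_funM.
move=> th; rewrite Rint_patch Rint_scale//; last 2 first.
- lra.
- apply: cont_onM => //; apply: cont_on_cos; apply: cont_onD; last exact: cont_on_cst.
  exact: cont_on_lin.
rewrite normrM (gtr0_norm L0) mulrCA ler_wpM2l ?(ltW L0)//.
rewrite (_ : Rintegral _ _ _ = \int[mu]_(u in `[-2, 2]) (bump (-2) 2 u * cos ((L * z) * u + th))); last first.
  apply: eq_Rintegral => u _; rewrite mulfK ?gt_eqF//; congr (_ * cos _); ring.
apply: le_trans (hC _ _) _; rewrite ler_wpM2l ?(ltW C0)// /kmaj /oneDsqr lerDl.
exact: tailmaj_ge0.
Qed.

(** The substitution [xi = L u] turns the phase into [(L z) u + (L^a tau) u^a] on a fixed segment,
    and the negative half-line gives the same with [z] replaced by [- z]. Here [tau] will be the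
    difference of two selected times, so only its bound [b] may enter. *)
Lemma annulus_kernel (a : R) : 0 < a -> a != 1 -> exists C D : R, [/\ 0 < C, 0 < D &
  forall L z tau b : R, 0 < L -> `|tau| <= b ->
  cabs (cintegral (fun xi => (annulus_bump L xi)%:C%C * cis (z * xi + tau * `|xi| `^ a))) <=
    C * (L * kmaj (1 + D * (b * L `^ a)) (L * z))].
Proof.
move=> a0 a1; have [C [D [C0 D0 hC]]] := @power_kernel R 2^-1 4 a ltac:(lra) ltac:(lra) a0 a1.
exists (4 * C), D; split => //; first exact: mulr_gt0.
move=> L z tau b L0 taub.
have b0 : 0 <= b by exact: le_trans taub.
have La0 : 0 < L `^ a by exact: powR_gt0.
(* Points with [|y| <= D L^a |tau|] satisfy [1 + |y| <= S], the range in which [tailmaj S] dominates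
   the slowly decaying part of the kernel. *)
pose S := 1 + D * (b * L `^ a).
have S0 : 0 < S by rewrite ltr_pwDl// !mulr_ge0// ltW.
have kb (y th : R) : `|\int[mu]_(u in `[2^-1, 4]) (bump 2^-1 4 u *
    cos (y * u + (L `^ a * tau) * u `^ a + th))| <= C * kmaj S y.
  apply: le_trans (hC _ _ _) _; rewrite /kmaj /oneDsqr mulrDr lerD2l.
  case: ifPn => yD; last by apply: mulr_ge0; [exact: ltW|exact: tailmaj_ge0].
  rewrite ler_wpM2l ?(ltW C0)//; apply: tailmaj_low => //.
  rewrite /S lerD2l (le_trans yD)// ler_wpM2l ?(ltW D0)//.
  by rewrite normrM (gtr0_norm La0) mulrC ler_wpM2r// ltW.
have mpow : measurable_fun setT (fun xi : R => `|xi| `^ a).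
  by apply: (measurableT_comp (measurable_powR a)); exact: normr_measurable.
rewrite (_ : 4 * C * _ = 2 * (2 * (C * (L * kmaj S (L * z))))); last by rewrite -/S; ring.
apply: cabs_osc_le.
- exact: int_annulus_bump.
- by apply: measurable_funD; exact: measurable_funM.
move=> th; pose g xi := cos (z * xi + tau * `|xi| `^ a + th).
have cg (u v : R) : (0 < u) || (v < 0) -> cont_on g u v.
  move=> uv; apply: cont_on_cos; apply: cont_onD; last exact: cont_on_cst.
  apply: cont_onD; first exact: cont_on_lin.
  apply: cont_onM; first exact: cont_on_cst.
  move=> x /andP[ux xv]; apply: (@continuous_comp _ _ _ (fun x : R => `|x|) (fun x : R => x `^ a)).
    exact: norm_continuous.
  have x0 : 0 < `|x|.
    rewrite normr_gt0; case/orP: uv => h; first by rewrite gt_eqF// (lt_le_trans h).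
    by rewrite lt_eqF// (le_lt_trans xv).
  exact: is_derive_cont (is_derive1_powR a x0).
have cp1 u v : (0 < u) || (v < 0) -> cont_on (fun x => bump 2^-1 4 (x / L) * g x) u v.
  by move=> uv; apply: cont_onM => //; exact: cg.
have cp2 u v : (0 < u) || (v < 0) -> cont_on (fun x => bump 2^-1 4 (- x / L) * g x) u v.
  by move=> uv; apply: cont_onM => //; exact: cg.
have pL : (0 < 2^-1 * L) || (4 * L < 0) by rewrite mulr_gt0.
have nL : (0 < - (4 * L)) || (- (2^-1 * L) < 0) by rewrite oppr_lt0 mulr_gt0// orbT.
have i1 : (fun x => ((fun x => bump 2^-1 4 (x / L)) \_ `[2^-1 * L, 4 * L]) x * g x) \is_int.
  have := int_patch (cp1 _ _ pL); congr (integrable _ _ (EFin \o _)).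
  by apply/funext => x; rewrite !patchE; case: ifP => //; rewrite mul0r.
have i2 : (fun x => ((fun x => bump 2^-1 4 (- x / L)) \_ `[- (4 * L), - (2^-1 * L)]) x * g x) \is_int.
  have := int_patch (cp2 _ _ nL); congr (integrable _ _ (EFin \o _)).
  by apply/funext => x; rewrite !patchE; case: ifP => //; rewrite mul0r.
rewrite (_ : Rintegral _ _ _ = \int[mu]_x (
   ((fun x => bump 2^-1 4 (x / L)) \_ `[2^-1 * L, 4 * L]) x * g x +
   ((fun x => bump 2^-1 4 (- x / L)) \_ `[- (4 * L), - (2^-1 * L)]) x * g x)); last first.
  by apply: eq_Rintegral => x _; rewrite -mulrDl.
have c24 : 2^-1 < 4 :> R by lra.
rewrite RintegralD// !Rint_patch Rint_opp//; [|by rewrite ltr_pM2r|exact: cp2].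
have cp3 : cont_on (fun x => bump 2^-1 4 (- - x / L) * g (- x)) (2^-1 * L) (4 * L).
  move=> x /andP[x1 _]; apply: (@continuous_comp _ _ _ (fun x : R => - x) (fun x => bump 2^-1 4 (- x / L) * g x)).
    exact: opp_continuous.
  by apply: (cp2 (- x) (- x)); rewrite ?lexx// oppr_lt0 (lt_le_trans _ x1) ?orbT// mulr_gt0.
rewrite (Rint_scale L0 c24 (cp1 _ _ pL)) (Rint_scale L0 c24 cp3).
rewrite (_ : 2 * _ = L * (C * kmaj S (L * z)) + L * (C * kmaj S (- (L * z)))); last by rewrite kmajN; ring.
apply: le_trans (ler_normD _ _) _; apply: lerD; rewrite normrM (gtr0_norm L0) ler_wpM2l ?(ltW L0)//.
  rewrite (_ : Rintegral _ _ _ = \int[mu]_(u in `[2^-1, 4]) (bump 2^-1 4 u *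
    cos ((L * z) * u + (L `^ a * tau) * u `^ a + th))); first exact: kb.
  apply: eq_Rintegral => u; rewrite inE /= in_itv /= => /andP[u1 u2].
  have u0 : 0 <= u by lra.
  rewrite mulfK ?gt_eqF// /g ger0_norm ?mulr_ge0 ?(ltW L0)// powRM ?(ltW L0)//.
  by congr (_ * cos _); ring.
rewrite (_ : Rintegral _ _ _ = \int[mu]_(u in `[2^-1, 4]) (bump 2^-1 4 u *
  cos (- (L * z) * u + (L `^ a * tau) * u `^ a + th))); first exact: kb.
apply: eq_Rintegral => u; rewrite inE /= in_itv /= => /andP[u1 u2].
have u0 : 0 <= u by lra.
rewrite opprK mulfK ?gt_eqF// /g normrN ger0_norm ?mulr_ge0 ?(ltW L0)// powRM ?(ltW L0)//.
by congr (_ * cos _); ring.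
Qed.

End kernels.

(** * Maximal estimates on a frequency band *)

Section oscillatory.
Context {R : realType}.

Definition osc (a : R) (G : R -> R[i]) (t x : R) : R[i] :=
  cintegral (fun xi => G xi * cis (x * xi + t * `|xi| `^ a)).

Lemma measurable_abspow (a : R) : measurable_fun setT (fun xi : R => `|xi| `^ a).
Proof. by apply: (measurableT_comp (measurable_powR a)); exact: normr_measurable. Qed.

(** On the bounded support [|G| <= 1 + |G|^2], so the square integrable [G] is integrable. *)
Lemma int_supported (G : R -> R[i]) (r : R) : cmeas G ->
  (forall xi, cabs (G xi) != 0 -> `|xi| <= r) ->
  (fun xi => cabs (G xi) ^+ 2) \is_int -> (fun xi => cabs (G xi)) \is_int.
Proof.
move=> mG sG iG.
apply: (@int_le _ _ (fun xi => \1_(`[- r, r]%classic) xi + cabs (G xi) ^+ 2)).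
- exact: measurable_cabs.
- move=> xi; rewrite ger0_norm ?cabs_ge0//; have [g0|g0] := eqVneq (cabs (G xi)) 0.
    by rewrite g0 addr_ge0 ?sqr_ge0// indicE.
  rewrite indicE mem_set /=; last by rewrite in_itv /= -ler_norml sG.
  set c := cabs _; have := sqr_ge0 (c - 2^-1); rewrite sqrrB; lra.
- apply: intD => //; exact: integrable_indic_itv.
Qed.

Let Bof (C S : R) := C * (pi + 4 * pi * Num.sqrt S).

Let kB (C L S y : R) : 0 < C -> 0 < L -> 0 < S ->
  (\int[mu]_x (C * (L * kmaj S (L * (x - y))))%:E <= (Bof C S)%:E)%E.
Proof.
move=> C0 L0 S0; under eq_integral do rewrite EFinM.
rewrite ge0_intZ ?(ltW C0)//.
- rewrite integral_affine//.
  + rewrite EFinM lee_wpmul2l ?lee_fin ?(ltW C0)//; exact: integral_kmaj.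
  + exact: continuous_kmaj.
  + by move=> v; exact: kmaj_ge0.
- by move=> x; rewrite lee_fin mulr_ge0 ?(ltW L0)// kmaj_ge0.
- apply/measurable_EFinP; apply: measurable_funM => //.
  have mk : measurable_fun setT (@kmaj R S).
    by apply: continuous_measurable_fun; exact: continuous_kmaj.
  apply: (measurableT_comp mk); apply: measurable_funM => //.
  exact: measurable_funB.
Qed.

Let Bof_gt0 (C S : R) : 0 < C -> 0 < Bof C S.
Proof.
move=> C0; apply: mulr_gt0 => //; apply: ltr_pwDl; first exact: pi_gt0.
by rewrite !mulr_ge0 ?pi_ge0 ?sqrtr_ge0.
Qed.

Let mkmaj (C L S : R) : 0 < S -> measurable_fun setT (fun z : R => C * (L * kmaj S (L * z))).
Proof.
move=> S0; apply: measurable_funM => //; apply: measurable_funM => //.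
have mk : measurable_fun setT (@kmaj R S).
  by apply: continuous_measurable_fun; exact: continuous_kmaj.
by apply: (measurableT_comp mk); exact: measurable_funM.
Qed.

(** The function [T] is arbitrary apart from measurability and its range, so this is a maximal
    estimate over [[0, b]]. The factor is the Schur bound of the kernel, using
    [sqrt (1 + D X) <= 1 + sqrt D sqrt X] for [X = b L^a]. *)
Lemma annulus_bound (a : R) : 0 < a -> a != 1 -> exists2 C, 0 < C &
  forall (L b : R) (T : R -> R) (G : R -> R[i]), 0 < L ->
  measurable_fun setT T -> (forall x, 0 <= T x <= b) -> cmeas G ->
  (forall xi, cabs (G xi) != 0 -> L <= `|xi| <= 2 * L) ->
  (fun xi => cabs (G xi) ^+ 2) \is_int ->
  (\int[mu]_x (cabs (osc a G (T x) x) ^+ 2)%:E <=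
    (C * (1 + Num.sqrt (b * L `^ a)) * \int[mu]_xi (cabs (G xi) ^+ 2))%:E)%E.
Proof.
move=> a0 a1; have [C [D [C0 D0 hC]]] := annulus_kernel a0 a1.
exists (C * (5 * pi + 4 * pi * Num.sqrt D)).
  apply: mulr_gt0 => //; apply: ltr_pwDl; first by rewrite mulr_gt0// pi_gt0.
  by rewrite !mulr_ge0 ?pi_ge0 ?sqrtr_ge0.
move=> L b T G L0 mT Tb mG sG iG.
have b0 : 0 <= b by have /andP[t0 tb] := Tb 0; exact: le_trans tb.
have X0 : 0 <= b * L `^ a by rewrite mulr_ge0// powR_ge0.
pose S := 1 + D * (b * L `^ a).
have S0 : 0 < S by rewrite ltr_pwDl// mulr_ge0// ltW.
have iG1 : (fun xi => cabs (G xi)) \is_int.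
  by apply: (@int_supported G (2 * L)) => // xi /sG /andP[].
have key := @TTstar R G T (fun xi => `|xi| `^ a) (annulus_bump L)
  (fun z => C * (L * kmaj S (L * z))) (Bof C S) mG iG1 iG mT (measurable_abspow a)
  (int_annulus_bump L) (annulus_bump_ge0 L).
apply: le_trans (key _ (mkmaj _ _ S0) _ (Bof_gt0 _ C0) _ _) _.
- move=> xi; have [->|/sG g0] := eqVneq (cabs (G xi)) 0; first by rewrite expr0n mulr0.
  by rewrite ler_peMl ?sqr_ge0// annulus_bump_ge1.
- by move=> z; rewrite mulrN kmajN.
- by move=> y; exact: kB.
- move=> x y; apply: hC => //; rewrite ler_norml.
  have /andP[? ?] := Tb x; have /andP[? ?] := Tb y.
  by apply/andP; split; lra.
rewrite lee_fin; apply: ler_wpM2r; first by apply: Rintegral_ge0 => x _; exact: sqr_ge0.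
rewrite /Bof -[X in _ <= X]mulrA; apply: ler_wpM2l; first exact: ltW.
set w := Num.sqrt (b * _); have w0 : 0 <= w by exact: sqrtr_ge0.
set d := Num.sqrt D; have d0 : 0 <= d by exact: sqrtr_ge0.
have sS : Num.sqrt S <= 1 + d * w.
  rewrite -[X in _ <= X]ger0_norm ?addr_ge0 ?mulr_ge0// -sqrtr_sqr; apply: ler_wsqrtr.
  rewrite sqrrD expr1n mul1r exprMn !sqr_sqrtr ?(ltW D0)// /S.
  by have := mulr_ge0 d0 w0; lra.
have p0 := @pi_gt0 R.
have := ler_wpM2l (mulr_ge0 (ler0n _ 4) (ltW p0)) sS.
have := mulr_ge0 (ltW p0) d0; have := mulr_ge0 (ltW p0) w0.
rewrite (_ : 4 * pi * (1 + d * w) = 4 * pi + 4 * (pi * d * w)); last by ring.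
rewrite (_ : _ * (1 + w) = 5 * pi + 4 * (pi * d) + 5 * (pi * w) + 4 * (pi * d * w)); last by ring.
lra.
Qed.

(** Half of Plancherel up to a constant: the case of zero time and zero dispersion of [TTstar]. The
    constant is independent of the radius because the ball kernel is an [L^1]-normalised
    dilation. *)
Lemma bessel : exists2 C : R, 0 < C & forall (r : R) (G : R -> R[i]), 0 < r -> cmeas G ->
  (forall xi, cabs (G xi) != 0 -> `|xi| <= r) ->
  (fun xi => cabs (G xi) ^+ 2) \is_int ->
  (\int[mu]_x (cabs (cintegral (fun xi => G xi * cis (x * xi))) ^+ 2)%:E <=
    (C * \int[mu]_xi (cabs (G xi) ^+ 2))%:E)%E.
Proof.
have [C C0 hC] := @ball_kernel R.
exists (Bof C 1); first exact: Bof_gt0.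
move=> r G r0 mG sG iG; have iG1 := int_supported mG sG iG.
have key := @TTstar R G (fun=> 0) (fun=> 0) (ball_bump r)
  (fun z => C * (r * kmaj 1 (r * z))) (Bof C 1) mG iG1 iG (measurable_cst _) (measurable_cst _)
  (int_ball_bump r) (ball_bump_ge0 r).
have z0 (x xi : R) : x * xi + 0 * 0 = x * xi by rewrite mul0r addr0.
apply: le_trans (key _ (mkmaj _ _ ltr01) _ (Bof_gt0 _ C0) _ _).
- rewrite le_eqVlt; apply/orP; left; apply/eqP; apply: eq_integral => x _.
  by congr ((cabs _ ^+ 2)%:E); apply: eq_cintegral => xi; rewrite z0.
- move=> xi; have [->|/sG g0] := eqVneq (cabs (G xi)) 0; first by rewrite expr0n mulr0.
  by rewrite ler_peMl ?sqr_ge0// ball_bump_ge1.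
- by move=> z; rewrite mulrN kmajN.
- by move=> y; exact: kB.
- move=> x y.
  rewrite (@eq_cintegral _ _ (fun xi => (ball_bump r xi)%:C%C * cis ((x - y) * xi))); first exact: hC.
  by move=> xi; rewrite subrr mul0r addr0.
Qed.

Lemma cmeas_osc_t (a : R) (G : R -> R[i]) (T : R -> R) : cmeas G ->
  (fun xi => cabs (G xi)) \is_int -> measurable_fun setT T ->
  cmeas (fun x => osc a G (T x) x).
Proof. by move=> mG iG mT; exact: (cmeas_osc mG iG mT (measurable_abspow a)). Qed.

(** At a fixed time the dispersive factor is unimodular and can be moved into [G]. *)
Lemma osc_bessel : exists2 C : R, 0 < C & forall (a r t : R) (G : R -> R[i]), 0 < r -> cmeas G ->
  (forall xi, cabs (G xi) != 0 -> `|xi| <= r) ->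
  (fun xi => cabs (G xi) ^+ 2) \is_int ->
  (\int[mu]_x (cabs (osc a G t x) ^+ 2)%:E <=
    (C * \int[mu]_xi (cabs (G xi) ^+ 2))%:E)%E.
Proof.
have [C C0 hC] := bessel; exists C => // a r t G r0 mG sG iG.
pose H xi := G xi * cis (t * `|xi| `^ a).
have HG xi : cabs (H xi) = cabs (G xi) by rewrite cabsM cis_abs mulr1.
have mH : cmeas H.
  by apply: cmeasM => //; apply: cmeas_cis; apply: measurable_funM => //; exact: measurable_abspow.
have sH xi : cabs (H xi) != 0 -> `|xi| <= r by rewrite HG; exact: sG.
have QH : (fun xi => cabs (H xi) ^+ 2) = fun xi => cabs (G xi) ^+ 2.
  by apply/funext => xi; rewrite HG.
have := hC r H r0 mH sH; rewrite QH => /(_ iG); apply: le_trans.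
rewrite le_eqVlt; apply/orP; left; apply/eqP; apply: eq_integral => x _.
have E : osc a G t x = cintegral (fun xi => H xi * cis (x * xi)).
  by apply: eq_cintegral => xi; rewrite /H -mulrA -cisD addrC.
by rewrite E.
Qed.

(** Finitely many times at once, restricted to the indices in [P]. Being finite and real-valued, the
    maximum stays integrable and the full supremum is reached by monotone limits. *)
Fixpoint maxsq (N : nat) (P : pred nat) (h : nat -> R -> R[i]) (x : R) : R :=
  if N is n.+1 then Num.max (maxsq n P h x) (if P n then cabs (h n x) ^+ 2 else 0) else 0.

Lemma maxsq_ge0 N (P : pred nat) (h : nat -> R -> R[i]) x : 0 <= maxsq N P h x.
Proof. by elim: N => [|N ih] //=; rewrite le_max ih. Qed.

Lemma le_maxsq N (P : pred nat) (h : nat -> R -> R[i]) x n :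
  (n < N)%N -> P n -> cabs (h n x) ^+ 2 <= maxsq N P h x.
Proof.
elim: N => // N ih; rewrite ltnS leq_eqVlt /= le_max => /predU1P[-> ->|nN Pn].
  by rewrite lexx orbT.
by rewrite ih.
Qed.

Lemma maxsq_le N (P : pred nat) (h : nat -> R -> R[i]) x B : 0 <= B ->
  (forall n, (n < N)%N -> P n -> cabs (h n x) ^+ 2 <= B) -> maxsq N P h x <= B.
Proof.
move=> B0; elim: N => // N ih hB; rewrite /= ge_max ih; last first.
  by move=> n nN; apply: hB; exact: ltnW.
by case: ifP => // PN; exact: hB.
Qed.

Lemma measurable_maxsq N (P : pred nat) (h : nat -> R -> R[i]) :
  (forall n, cmeas (h n)) -> measurable_fun setT (maxsq N P h).
Proof.
move=> mh; elim: N => [|N ih]; first exact: measurable_cst.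
apply: measurable_maxr => //; case: (P N); last exact: measurable_cst.
by apply: measurable_funX; exact: measurable_cabs.
Qed.

(** The maximum over finitely many times is attained at a measurably chosen time: at each step the
    new time is compared with the current choice. When no index is admissible the default is time
    0. *)
Lemma select_time (a b : R) (G : R -> R[i]) (t : nat -> R) (N : nat) (P : pred nat) :
  cmeas G -> (fun xi => cabs (G xi)) \is_int -> 0 <= b ->
  (forall n, P n -> 0 <= t n <= b) ->
  exists T : R -> R, [/\ measurable_fun setT T, forall x, 0 <= T x <= b &
    forall n x, (n < N)%N -> P n -> cabs (osc a G (t n) x) ^+ 2 <= cabs (osc a G (T x) x) ^+ 2].
Proof.
move=> mG iG b0 tb; elim: N => [|N [T [mT Tb hT]]].
  by exists (fun=> 0); split => //= x; rewrite lexx.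
case PN: (P N); last first.
  exists T; split => // n x; rewrite ltnS leq_eqVlt => /predU1P[->|nN]; first by rewrite PN.
  exact: hT.
pose c x := cabs (osc a G (T x) x) ^+ 2 < cabs (osc a G (t N) x) ^+ 2.
exists (fun x => if c x then t N else T x); split.
- apply: measurable_fun_ifT => //; apply: measurable_fun_ltr.
    by apply: measurable_funX; apply: measurable_cabs; exact: cmeas_osc_t.
  apply: measurable_funX; apply: measurable_cabs.
  by apply: (@cmeas_osc_t a G (fun=> t N)).
- by move=> x; case: ifP => // _; exact: tb.
- move=> n x; rewrite ltnS leq_eqVlt /c => /predU1P[->|nN] Pn; case: ltP => h.
  + exact: lexx.
  + exact: h.
  + by apply: le_trans (ltW h); exact: hT.
  + exact: hT.
Qed.

Lemma annulus_maximal (a : R) : 0 < a -> a != 1 -> exists2 C, 0 < C &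
  forall (L b : R) (G : R -> R[i]) (t : nat -> R) (N : nat) (P : pred nat), 0 < L -> 0 <= b ->
  (forall n, P n -> 0 <= t n <= b) -> cmeas G ->
  (forall xi, cabs (G xi) != 0 -> L <= `|xi| <= 2 * L) ->
  (fun xi => cabs (G xi) ^+ 2) \is_int ->
  (\int[mu]_x (maxsq N P (fun n => osc a G (t n)) x)%:E <=
    (C * (1 + Num.sqrt (b * L `^ a)) * \int[mu]_xi (cabs (G xi) ^+ 2))%:E)%E.
Proof.
move=> a0 a1; have [C C0 hC] := annulus_bound a0 a1; exists C => //.
move=> L b G t N P L0 b0 tb mG sG iG.
have iG1 : (fun xi => cabs (G xi)) \is_int.
  by apply: (@int_supported G (2 * L)) => // xi /sG /andP[].
have [T [mT Tb hT]] := select_time a N mG iG1 b0 tb.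
apply: le_trans (hC L b T G L0 mT Tb mG sG iG); apply: ge0_le_int.
- by move=> x; rewrite lee_fin maxsq_ge0.
- apply/measurable_EFinP; apply: measurable_maxsq => n.
  by apply: (@cmeas_osc_t a G (fun=> t n)).
- apply/measurable_EFinP; apply: measurable_funX; apply: measurable_cabs; exact: cmeas_osc_t.
- by move=> x; rewrite lee_fin; apply: maxsq_le => [|n nN Pn]; [exact: sqr_ge0|exact: hT].
Qed.

End oscillatory.

(** * Uniqueness and construction of densities *)

Section almost_everywhere_line.
Context {R : realType}.
Implicit Types P Q : R -> Prop.

Lemma aeS P Q : (forall x, P x -> Q x) -> {ae mu, forall x, P x} -> {ae mu, forall x, Q x}.
Proof. by apply: filterS; exact: (ae_filter_ringOfSetsType mu). Qed.

Lemma aeI P Q : {ae mu, forall x, P x} -> {ae mu, forall x, Q x} ->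
  {ae mu, forall x, P x /\ Q x}.
Proof. by apply: filterI; exact: (ae_filter_ringOfSetsType mu). Qed.

Lemma Rdominated_convergence (f_ : nat -> R -> R) (f g : R -> R) :
  (forall m, measurable_fun setT (f_ m)) -> measurable_fun setT f ->
  {ae mu, forall x, f_ m x @[m --> \oo] --> f x} -> g \is_int ->
  {ae mu, forall x, forall m, `|f_ m x| <= g x} ->
  f \is_int /\ \int[mu]_x f_ m x @[m --> \oo] --> \int[mu]_x f x.
Proof.
move=> mf_ mf cv ig dom.
have mfe m : measurable_fun setT (EFin \o f_ m) by exact/measurable_EFinP.
have mfl : measurable_fun setT (EFin \o f) by exact/measurable_EFinP.
have cve : {ae mu, forall x : R, setT x -> (EFin \o f_ m) x @[m --> \oo] --> (EFin \o f) x}.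
  by apply: aeS cv => x h _; apply: cvg_EFin => //; exact: nearW.
have dme : {ae mu, forall (x : R) m, setT x -> (`|(EFin \o f_ m) x| <= (EFin \o g) x)%E}.
  by apply: aeS dom => x dx m _; rewrite lee_fin.
have [il _ lim] := @dominated_convergence _ _ _ (@lebesgue_measure R) setT measurableT
  (fun m => EFin \o f_ m) (EFin \o f) (EFin \o g) mfe mfl cve ig dme.
split => //.
have := fine_cvg (_ : (fun n => \int[mu]_(x in setT) (EFin \o f_ n) x)%E @ \oo -->
  (\int[mu]_x f x)%:E); apply.
by rewrite Rint_EFin.
Qed.

End almost_everywhere_line.

Section plateau_functions.
Context {R : realType}.
Implicit Types (p q : {poly R}) (c r : R).

(** This class is closed under differentiation, so all derivatives of the test functions below are
    known without computing them. *)
Definition polyexp p q (x : R) : R := p.[x] * expR (- q.[x]).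

Lemma is_derive_polyexp p q (x : R) :
  is_derive x 1 (polyexp p q) (polyexp (p^`() - p * q^`()) q x).
Proof.
have dp := is_derive_poly p x; have dq := is_derive_poly q x.
have de : is_derive x 1 (fun x => expR (- q.[x])) (expR (- q.[x]) * - q^`().[x]).
  exact: (@is_derive1_comp _ expR (fun x => - q.[x])).
have := is_deriveM dp de; rewrite (_ : _ + _ = polyexp (p^`() - p * q^`()) q x)//.
have key (A B C E : R) : A * (E * - C) + E * B = (B - A * C) * E by ring.
by rewrite /polyexp hornerD hornerN hornerM; exact: key.
Qed.

Lemma derive1n_polyexp p q n : exists p', derive1n n (polyexp p q) = polyexp p' q.
Proof.
elim: n => [|n [p' ih]]; first by exists p.
exists (p'^`() - p' * q^`()); rewrite derive1nS ih; apply/funext => x.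
by rewrite derive1E; have [] := is_derive_polyexp p' q x.
Qed.

Lemma derive1n0cst n : derive1n n (fun=> 0 : R) = (fun=> 0 : R).
Proof.
by elim: n => // n ih; rewrite derive1nS ih; apply/funext => x; rewrite derive1_cst.
Qed.

Lemma poly_growth p : exists (C : R) (n : nat), 0 <= C /\
  forall x : R, `|p.[x]| <= C * (1 + `|x|) ^+ n.
Proof.
elim/poly_ind: p => [|p c [C [n [C0 hC]]]].
  by exists 0, 0%N; split => // x; rewrite horner0 normr0 mul0r.
exists (C + `|c|), n.+1; split; first exact: addr_ge0.
move=> x; rewrite !hornerE; apply: le_trans (ler_normD _ _) _.
have x1 : 1 <= 1 + `|x| by rewrite lerDl.
have xn : 1 <= (1 + `|x|) ^+ n.+1 by exact: exprn_ege1.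
rewrite mulrDl; apply: lerD; last by rewrite ler_peMr.
rewrite normrM exprSr mulrA; apply: ler_pM => //; lra.
Qed.

Definition plateau_poly c r (m : nat) : {poly R} := (((r^-1)%:P * ('X - c%:P)) ^+ 2) ^+ m.+1.

Lemma plateau_polyE c r m x : (plateau_poly c r m).[x] = (((x - c) / r) ^+ 2) ^+ m.+1.
Proof. by rewrite /plateau_poly !hornerE mulrC. Qed.

Lemma expr_ge_sub1 (u : R) m : 0 <= u -> u - 1 <= u ^+ m.+1.
Proof.
move=> u0; have [u1|u1] := leP u 1.
  by rewrite (@le_trans _ _ 0) ?exprn_ge0// subr_le0.
have := exprn_ege1 m (ltW u1); rewrite exprS => h.
by have := ler_wpM2l u0 h; lra.
Qed.

(** For positive [n], [1 + u <= n (1 + u / n) <= n exp (u / n)], raised to the power [n]. *)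
Lemma pow_exp_bounded n (u : R) : 0 <= u -> (1 + u) ^+ n <= n%:R ^+ n * expR u.
Proof.
move=> u0; case: n => [|n]; first by rewrite !expr0 mul1r -expR0 ler_expR.
have n0 : 0 < n.+1%:R :> R by [].
have h : 1 + u <= n.+1%:R * expR (u / n.+1%:R).
  apply: (@le_trans _ _ (n.+1%:R * (1 + u / n.+1%:R))); last first.
    by rewrite ler_pM2l// expR_ge1Dx.
  rewrite mulrDr mulr1 mulrCA divff ?gt_eqF// mulr1 lerD2r.
  by rewrite ler1n.
rewrite (_ : expR u = expR (u / n.+1%:R) ^+ n.+1); last first.
  by rewrite -expRM_natl mulrC divfK// gt_eqF.
by rewrite -exprMn; apply: lerXn2r => //; rewrite nnegrE ?addr_ge0// mulr_ge0 ?expR_ge0.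
Qed.

(** With [u = ((x - c) / r)^2] the exponent [u^(m+1)] is at least [u - 1], and [1 + |x|] is at most
    a constant times [1 + u]; a polynomial in [u] against [exp (- u)] is bounded. *)
Lemma polyexp_bounded p c r m : 0 < r -> exists C : R,
  forall x, `|polyexp p (plateau_poly c r m) x| <= C.
Proof.
move=> r0; have [C [n [C0 hC]]] := poly_growth p.
pose A := 1 + `|c| + r.
have A0 : 0 <= A by rewrite /A; have := normr_ge0 c; lra.
exists (C * A ^+ n * (n%:R ^+ n * expR 1)) => x.
rewrite /polyexp normrM (ger0_norm (expR_ge0 _)) plateau_polyE.
pose u := ((x - c) / r) ^+ 2; rewrite -/u.
have u0 : 0 <= u by exact: sqr_ge0.
have xA : 1 + `|x| <= A * (1 + u).
  have v : `|x - c| <= r * (1 + u).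
    have -> : `|x - c| = r * `|(x - c) / r|.
      by rewrite normrM normfV (gtr0_norm r0) mulrCA divff ?gt_eqF ?mulr1.
    rewrite ler_pM2l//; set w := (x - c) / r in u u0 *.
    have : 0 <= (`|w| - 2^-1) ^+ 2 by exact: sqr_ge0.
    rewrite sqrrB real_normK ?num_real// -/u; lra.
  have : `|x| <= `|x - c| + `|c| by rewrite -{1}(subrK c x) ler_normD.
  have cu : `|c| <= `|c| * (1 + u) by rewrite ler_peMr// lerDl.
  by rewrite /A !mulrDl; lra.
apply: (@le_trans _ _ (C * (A * (1 + u)) ^+ n * (expR 1 * expR (- u)))).
  apply: ler_pM; rewrite ?expR_ge0//.
    apply: le_trans (hC x) _; apply: ler_wpM2l => //.
    by apply: lerXn2r; rewrite ?nnegrE ?addr_ge0// mulr_ge0// addr_ge0.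
  by rewrite -expRD ler_expR; have := expr_ge_sub1 m u0; lra.
rewrite exprMn -!mulrA; apply: ler_wpM2l => //; apply: ler_wpM2l; first exact: exprn_ge0.
rewrite (mulrCA _ (expR 1)) (mulrC _ (expR 1)) mulrA -mulrA.
apply: ler_wpM2l; first exact: expR_ge0.
have := ler_wpM2r (expR_ge0 (- u)) (pow_exp_bounded n u0).
by rewrite -mulrA -expRD subrr expR0 mulr1.
Qed.

(* Schwartz functions converging boundedly to the indicator of [`]c - r, c + r[]: they are
   test functions with elementary derivatives that detect integrals over intervals. *)
Definition plateau c r m (x : R) : R := expR (- (((x - c) / r) ^+ 2) ^+ m.+1).

Lemma plateauE c r m : plateau c r m = polyexp 1 (plateau_poly c r m).
Proof. by apply/funext => x; rewrite /polyexp plateau_polyE hornerE mul1r. Qed.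

Lemma plateau_schwartz c r m : 0 < r -> schwartz (fun x => (plateau c r m x)%:C%C).
Proof.
move=> r0; set f := fun x => _.
have re : re_part f = polyexp 1 (plateau_poly c r m) by rewrite -plateauE.
have im : im_part f = fun=> 0 by [].
split.
  move=> n x; rewrite re im derive1n0cst; split; last exact: derivable_cst.
  have [p' ->] := derive1n_polyexp 1 (plateau_poly c r m) n.
  by have [] := is_derive_polyexp p' (plateau_poly c r m) x.
move=> k n; have [p' p'E] := derive1n_polyexp 1 (plateau_poly c r m) n.
have [C hC] := polyexp_bounded ('X ^+ k * p') c m r0.
apply: (@le_lt_trans _ _ C%:E); last by rewrite ltry.
apply: ge_ereal_sup => _ [x _ <-]; rewrite lee_fin.
rewrite /cderiven re im derive1n0cst p'E.
apply: le_trans (hC x); rewrite (cabsR (polyexp p' (plateau_poly c r m) x)).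
by rewrite /polyexp hornerM hornerXn -mulrA (normrM (x ^+ k)) normrX.
Qed.

(** A majorant independent of [m]: it allows dominated convergence of the plateaux against any
    function whose product with the zeroth one is integrable. *)
Lemma plateau_dom c r m x : plateau c r m x <= expR 1 * plateau c r 0 x.
Proof.
rewrite /plateau -expRD ler_expR expr1.
by have := expr_ge_sub1 m (sqr_ge0 ((x - c) / r)); lra.
Qed.

Lemma plateau_cvg c r x : 0 < r -> `|x - c| != r ->
  plateau c r m x @[m --> \oo] --> (\1_(`]c - r, c + r[%classic) x : R).
Proof.
move=> r0 xr; pose u := ((x - c) / r) ^+ 2.
have nr : `|(x - c) / r| = `|x - c| / r by rewrite normrM normfV (gtr0_norm r0).
have u0 : 0 <= u by exact: sqr_ge0.
have uE : u = (`|x - c| / r) ^+ 2 by rewrite -nr real_normK ?num_real.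
have bE : (x \in (`]c - r, c + r[%classic : set R)) = (`|x - c| < r).
  by apply/idP/idP; rewrite inE /= in_itv /= ltr_distl.
rewrite indicE bE; have [xlt|xgt|//] := ltgtP `|x - c| r; last first.
  by move/eqP: xr => /[swap] ->.
- have u1 : 1 < u.
    by rewrite uE exprn_egt1// ltr_pdivlMr// mul1r.
  apply: (@squeeze_cvgr _ _ _ _ (fun=> 0) (fun m => (u^-1) ^+ m.+1)).
  + apply: nearW => m; rewrite expR_ge0/=.
    have um : 0 < u ^+ m.+1 by apply: exprn_gt0; exact: lt_trans u1.
    rewrite /plateau -/u expRN exprVn lef_pV2 ?posrE ?expR_gt0//.
    by have := expR_ge1Dx (u ^+ m.+1); lra.
  + exact: cvg_cst.
  + rewrite (cvg_shiftS (fun m => u^-1 ^+ m)); apply: cvg_expr.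
    by rewrite normfV ger0_norm// invf_lt1// (lt_trans ltr01).
- have u1 : `|u| < 1.
    by rewrite ger0_norm// uE exprn_ilt1// ?divr_ge0 ?(ltW r0)// ltr_pdivrMr ?mul1r.
  rewrite /= -expR0 -oppr0; apply: (@continuous_cvg _ _ _ _ _ _ (fun y : R => expR y)).
    exact: continuous_expR.
  apply: cvgN; rewrite (cvg_shiftS (fun m => u ^+ m)); exact: cvg_expr.
Qed.

End plateau_functions.

Section null_functions.
Context {R : realType}.

(** By Lebesgue differentiation: if [f] has integral 0 over a ball around [x], then [|f x|] is at
    most the mean deviation of [f] from [f x] on that ball, and this tends to 0 at almost every
    [x]. *)
Lemma ae0_of_itv_integrals (f : R -> R) : measurable_fun setT f ->
  (forall c r : R, 0 < r -> (fun x => f x * \1_(`]c - r, c + r[%classic) x) \is_int) ->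
  (forall c r : R, 0 < r -> \int[mu]_x (f x * \1_(`]c - r, c + r[%classic) x) = 0) ->
  {ae mu, forall x : R, f x = 0}.
Proof.
move=> mf fi f0.
have ballE c r (x : R) : (f \_ `]c - r, c + r[) x = f x * \1_(`]c - r, c + r[%classic) x.
  by rewrite patchE indicE; case: ifP; rewrite ?mulr1 ?mulr0.
have ib c (r : R) : 0 < r -> mu.-integrable `]c - r, c + r[ (EFin \o f).
  move=> r0; apply/integrable_mkcond => //.
  have := fi c r r0; congr (integrable _ _ _); apply/funext => x /=.
  by rewrite restrict_EFin /= ballE.
have locf : locally_integrable setT f.
  split => //; first exact: openT.
  move=> K _ cK; have [M [_ hM]] := compact_bounded cK.
  have M0 : 0 < `|M| + 2 by rewrite ltr_wpDl.
  have Kb : K `<=` `]0 - (`|M| + 2), 0 + (`|M| + 2)[.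
    move=> x Kx; rewrite /= in_itv /= sub0r add0r -ltr_norml.
    have := hM (`|M| + 1) _ x Kx; rewrite (le_lt_trans (ler_norm M)) ?ltrDl//= => /(_ isT).
    by move=> h; rewrite (le_lt_trans h)// ltrD2l ltr1n.
  have mK : measurable K by apply: closed_measurable; exact: compact_closed.
  have /integrableP[_] := ib 0 _ M0; apply: le_lt_trans.
  apply: ge0_subset_integral => //.
  by apply/measurable_EFinP; apply: measurableT_comp => //; exact: measurable_funTS.
apply: aeS (lebesgue_differentiation locf) => x lx; apply/eqP; rewrite -normr_le0 -lee_fin.
apply: (@cvge_ge _ _ _ _ (fun r => davg f x r) _ _ _ lx).
near=> r; have r0 : 0 < r by near: r; exact: nbhs_right_gt.
rewrite /davg /iavg ball_itv.
have r20 : 0 < r *+ 2 by rewrite mulrn_wgt0.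
have muB : mu (`]x - r, x + r[%classic : set R) = (r *+ 2)%:E.
  by have := lebesgue_measure_ball x (ltW r0); rewrite ball_itv.
set B := `]x - r, x + r[%classic in muB *.
have mB : measurable B by exact: measurable_itv.
have cstI : (\int[mu]_(y in B) (f x)%:E = (f x * (r *+ 2))%:E)%E.
  by rewrite EFinM -muB integral_cst.
have cfin : mu.-integrable B (EFin \o cst (f x)).
  apply/integrableP; split; first exact/measurable_EFinP/measurable_cst.
  apply: (@le_lt_trans _ _ (`|f x|%:E * mu B)%E); first by rewrite /= integral_cst.
  by rewrite muB -EFinM ltry.
have If0 : (\int[mu]_(y in B) (f y)%:E = 0)%E.
  rewrite integral_mkcond -[RHS](_ : (0:R)%:E = _)// -(f0 x r r0) Rint_EFin; last exact: fi.
  by apply: eq_integral => y _; rewrite restrict_EFin /= ballE.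
have IB : (\int[mu]_(y in B) ((f y)%:E - (f x)%:E) = - (f x * (r *+ 2))%:E)%E.
  rewrite (integralB_EFin _ (ib x r r0) cfin); first by rewrite If0 sub0e -cstI.
  exact: measurable_itv.
have h : ((`|f x| * (r *+ 2))%:E <= \int[mu]_(y in B) `|(f y - f x)%:E|)%E.
  have -> : (`|f x| * (r *+ 2))%:E = `|\int[mu]_(y in B) ((f y)%:E - (f x)%:E)|%E.
    by rewrite IB abseN /= normrM (gtr0_norm r20).
  apply: le_abse_integral => //; apply/measurable_EFinP; apply: measurable_funB => //.
  exact: measurable_funTS.
rewrite muB inver gt_eqF//.
rewrite (_ : `|f x|%:E = ((r *+ 2)^-1)%:E * (`|f x| * (r *+ 2))%:E)%E; last first.
  by rewrite -EFinM mulrCA mulVf ?mulr1// gt_eqF.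
by apply: (lee_wpmul2l _ h); rewrite lee_fin invr_ge0 ltW.
Unshelve. all: by end_near. Qed.

(** Testing against plateaux and letting them tend to the indicator of an interval shows that all
    interval integrals of the real and imaginary parts vanish. *)
Lemma density_ae0 (g : R -> R[i]) : cmeasurable g ->
  (forall phi : R -> R[i], schwartz phi -> cintegrable (fun x => g x * phi x) /\
     cintegral (fun x => g x * phi x) = 0) ->
  {ae mu, forall x : R, g x = 0}.
Proof.
move=> mg g0.
have real0 (f : R -> R) : measurable_fun setT f ->
   (forall c r m, 0 < r -> (fun x => f x * plateau c r m x) \is_int /\
       \int[mu]_x (f x * plateau c r m x) = 0) ->
   {ae mu, forall x : R, f x = 0}.
  move=> mf hf.
  have dom (c r : R) : 0 < r -> (fun x => f x * \1_(`]c - r, c + r[%classic) x) \is_int /\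
     \int[mu]_x (f x * \1_(`]c - r, c + r[%classic) x) = 0.
    move=> r0; have [i0 _] := hf c r 0%N r0.
    have mfm m : measurable_fun setT (fun x => f x * plateau c r m x).
      by have [/int_meas] := hf c r m r0.
    have ml : measurable_fun setT (fun x => f x * \1_(`]c - r, c + r[%classic) x).
      apply: measurable_funM => //; by apply: measurable_indic; exact: measurable_itv.
    have cv : {ae mu, forall x : R, f x * plateau c r m x @[m --> \oo] -->
        f x * \1_(`]c - r, c + r[%classic) x}.
      (* At the two end points every plateau equals [exp (-1)], so they are put into the null
         set. *)
      exists [set c - r; c + r]; split.
      - by apply: measurableU; exact: measurable_set1.
      - by apply: null_set_setU; [exact: measurable_set1|exact: measurable_set1|
          exact: lebesgue_measure_set1|exact: lebesgue_measure_set1].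
      - move=> x /= h; apply: contrapT => xn; apply: h.
        apply: cvgM; first exact: cvg_cst.
        apply: plateau_cvg => //; apply: contra_notN xn => /eqP xr.
        have [h|h] := leP 0 (x - c).
          by right; move: xr; rewrite ger0_norm// => <-; ring.
        by left; move: xr; rewrite ltr0_norm// => <-; ring.
    have iG : (fun x => expR 1 * `|f x * plateau c r 0 x|) \is_int.
      by apply: intZ; exact: integrable_norm.
    have dm m x : `|f x * plateau c r m x| <= expR 1 * `|f x * plateau c r 0 x|.
      rewrite !normrM mulrCA ler_wpM2l//.
      by rewrite !ger0_norm ?expR_ge0// plateau_dom.
    have dm' : {ae mu, forall x m, `|f x * plateau c r m x| <= expR 1 * `|f x * plateau c r 0 x|}.
      by apply: aeW => x m; exact: dm.
    have [il lim] := Rdominated_convergence mfm ml cv iG dm'.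
    split => //; move: lim.
    have -> : (fun n => \int[mu]_x (f x * plateau c r n x)) = fun=> 0.
      by apply/funext => m; have [_ ->] := hf c r m r0.
    by move=> lim; apply/esym; apply: (cvg_unique _ _ lim) => //; exact: cvg_cst.
  exact: (ae0_of_itv_integrals mf (fun c r h => (dom c r h).1) (fun c r h => (dom c r h).2)).
have [mr mi] := mg.
have hre : {ae mu, forall x : R, complex.Re (g x) = 0}.
  apply: real0 => // c r m r0; have [[i1 _] e] := g0 _ (plateau_schwartz c m r0).
  have E x : complex.Re (g x * (plateau c r m x)%:C%C) = complex.Re (g x) * plateau c r m x.
    by rewrite ReM /= mulr0 subr0.
  have i2 : (fun x => complex.Re (g x) * plateau c r m x) \is_int.
    by under eq_fun do rewrite -E.
  split => //.
  transitivity (complex.Re (cintegral (fun x => g x * (plateau c r m x)%:C%C))); last by rewrite e.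
  by apply: eq_Rintegral => x _; rewrite /re_part E.
have him : {ae mu, forall x : R, complex.Im (g x) = 0}.
  apply: real0 => // c r m r0; have [[_ i1] e] := g0 _ (plateau_schwartz c m r0).
  have E x : complex.Im (g x * (plateau c r m x)%:C%C) = complex.Im (g x) * plateau c r m x.
    by rewrite ImM /= mulr0 add0r.
  have i2 : (fun x => complex.Im (g x) * plateau c r m x) \is_int.
    by under eq_fun do rewrite -E.
  split => //.
  transitivity (complex.Im (cintegral (fun x => g x * (plateau c r m x)%:C%C))); last by rewrite e.
  by apply: eq_Rintegral => x _; rewrite /im_part E.
by apply: aeS (aeI hre him) => x [h1 h2]; exact: cplx_ext.
Qed.

(** Since [density] picks some representative, this is the only way to learn anything about the
    chosen one from an explicit one. *)
Lemma density_unique (u : functional R) (g1 g2 : R -> R[i]) :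
  is_density u g1 -> is_density u g2 -> {ae mu, forall x : R, g1 x = g2 x}.
Proof.
move=> [m1 h1] [m2 h2].
have h : {ae mu, forall x : R, g1 x - g2 x = 0}.
  apply: density_ae0; first by apply: cmeasD => //; exact: cmeasN.
  move=> phi sphi; have [i1 e1] := h1 phi sphi; have [i2 e2] := h2 phi sphi.
  have E : (fun x => (g1 x - g2 x) * phi x) = fun x => g1 x * phi x + (-1) * (g2 x * phi x).
    by apply/funext => x; rewrite mulrBl mulN1r.
  have i3 : cintegrable (fun x => -1 * (g2 x * phi x)).
    apply: (@cintegrable_le _ _ (fun x => cabs (g2 x * phi x))); last exact: cintegrable_cabs.
      by apply: cmeasM; [exact: cmeas_cst|exact: cintegrable_cmeas].
    by move=> x; rewrite mulN1r cabsN.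
  rewrite E; split.
    case: i1 i3 => [a1 a2] [b1 b2]; split.
      by have := intD a1 b1; congr (integrable _ _ _); apply/funext => x; rewrite /= /re_part ReD.
    by have := intD a2 b2; congr (integrable _ _ _); apply/funext => x; rewrite /= /im_part ImD.
  rewrite cintegralD// cintegralZ// mulN1r -[cintegral _]/(distr_of_fun g1 phi) -e1.
  by rewrite -[cintegral _]/(distr_of_fun g2 phi) -e2 subrr.
by apply: aeS h => x /eqP; rewrite subr_eq0 => /eqP.
Qed.

End null_functions.

(** * Limits, dominated convergence and series of complex functions *)

Section complex_limits.
Context {R : realType}.

Definition ccvg (z_ : nat -> R[i]) (z : R[i]) : Prop :=
  (complex.Re (z_ m) @[m --> \oo] --> complex.Re z) /\
  (complex.Im (z_ m) @[m --> \oo] --> complex.Im z).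

Lemma ccvg_unique z_ z w : ccvg z_ z -> ccvg z_ w -> z = w.
Proof.
move=> [r1 i1] [r2 i2]; apply: cplx_ext.
  exact: (cvg_unique _ r1 r2).
exact: (cvg_unique _ i1 i2).
Qed.

Lemma ccvg_cst z : ccvg (fun=> z) z.
Proof. by split; exact: cvg_cst. Qed.

Lemma ccvgM z_ z w_ w : ccvg z_ z -> ccvg w_ w -> ccvg (fun m => z_ m * w_ m) (z * w).
Proof.
move=> [r1 i1] [r2 i2]; split.
  under eq_cvg do rewrite ReM; rewrite ReM; apply: cvgB; exact: cvgM.
by under eq_cvg do rewrite ImM; rewrite ImM; apply: cvgD; exact: cvgM.
Qed.

Lemma ccvg_cabs2 z_ z : ccvg z_ z -> cabs (z_ m) ^+ 2 @[m --> \oo] --> cabs z ^+ 2.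
Proof.
move=> [r1 i1]; rewrite cabs2.
have -> : (fun m => cabs (z_ m) ^+ 2) = fun m =>
    complex.Re (z_ m) * complex.Re (z_ m) + complex.Im (z_ m) * complex.Im (z_ m).
  by apply/funext => m; rewrite cabs2 !expr2.
by rewrite !expr2; apply: cvgD; apply: cvgM.
Qed.

Lemma Re_sum (u : nat -> R[i]) K : complex.Re (\sum_(k < K) u k) = \sum_(k < K) complex.Re (u k).
Proof. by elim: K => [|K ih]; rewrite ?big_ord0// !big_ord_recr /= ReD ih. Qed.

Lemma Im_sum (u : nat -> R[i]) K : complex.Im (\sum_(k < K) u k) = \sum_(k < K) complex.Im (u k).
Proof. by elim: K => [|K ih]; rewrite ?big_ord0// !big_ord_recr /= ImD ih. Qed.

Lemma cabs_sum (u : nat -> R[i]) K : cabs (\sum_(k < K) u k) <= \sum_(k < K) cabs (u k).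
Proof.
elim: K => [|K ih]; first by rewrite !big_ord0 cabs0.
by rewrite !big_ord_recr /=; apply: le_trans (cabsD _ _) _; exact: lerD.
Qed.

Lemma cmeas_sum d (T : measurableType d) (u : nat -> T -> R[i]) K : (forall k, cmeas (u k)) ->
  cmeas (fun x => \sum_(k < K) u k x).
Proof.
move=> mu_; elim: K => [|K ih].
  have -> : (fun x => \sum_(k < 0) u k x) = (fun=> 0) by apply/funext => x; rewrite big_ord0.
  exact: cmeas_cst.
have -> : (fun x => \sum_(k < K.+1) u k x) = fun x => \sum_(k < K) u k x + u K x.
  by apply/funext => x; rewrite big_ord_recr.
exact: cmeasD.
Qed.

Lemma cdominated_convergence (f_ : nat -> R -> R[i]) (f : R -> R[i]) (g : R -> R) :
  (forall m, cmeas (f_ m)) -> cmeas f ->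
  {ae mu, forall x, ccvg (f_ ^~ x) (f x)} -> g \is_int ->
  {ae mu, forall x m, cabs (f_ m x) <= g x} ->
  cintegrable f /\ ccvg (fun m => cintegral (f_ m)) (cintegral f).
Proof.
move=> mf_ [mr mi] cv ig dom.
have [ir lr] : (fun x => complex.Re (f x)) \is_int /\
    \int[mu]_x complex.Re (f_ m x) @[m --> \oo] --> \int[mu]_x complex.Re (f x).
  apply: (@Rdominated_convergence _ _ _ g) => //.
  - by move=> m; have [] := mf_ m.
  - by apply: aeS cv => x [].
  - by apply: aeS dom => x h m; exact: le_trans (Re_cabs _) (h m).
have [ii li] : (fun x => complex.Im (f x)) \is_int /\
    \int[mu]_x complex.Im (f_ m x) @[m --> \oo] --> \int[mu]_x complex.Im (f x).
  apply: (@Rdominated_convergence _ _ _ g) => //.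
  - by move=> m; have [] := mf_ m.
  - by apply: aeS cv => x [].
  - by apply: aeS dom => x h m; exact: le_trans (Im_cabs _) (h m).
by [].
Qed.

Lemma Rfatou (f_ : nat -> R -> R) (f : R -> R) (C : \bar R) :
  (forall m, measurable_fun setT (f_ m)) -> measurable_fun setT f ->
  (forall m x, 0 <= f_ m x) -> (forall x, 0 <= f x) ->
  {ae mu, forall x, f_ m x @[m --> \oo] --> f x} ->
  (forall m, (\int[mu]_x (f_ m x)%:E <= C)%E) -> (\int[mu]_x (f x)%:E <= C)%E.
Proof.
move=> mf_ mf f0_ f0 cv hC.
have me m : measurable_fun setT (fun x => (f_ m x)%:E) by exact/measurable_EFinP.
have e0 m (x : R) : setT x -> (0 <= (f_ m x)%:E)%E by rewrite lee_fin.
apply: (@le_trans _ _ (\int[mu]_x limn_einf (fun m => (f_ m x)%:E))%E).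
  apply: ae_ge0_le_integral => //.
  - by move=> x _; rewrite lee_fin.
  - exact/measurable_EFinP.
  - move=> x _; rewrite limn_einf_lim; apply: lime_ge; first exact: is_cvg_einfs.
    by apply: nearW => m; apply: le_ereal_inf_tmp => _ [k _ <-]; rewrite lee_fin.
  - rewrite /limn_einf; apply: measurableT_comp => //; apply: measurable_fun_limn_esup => m.
    apply: (eq_measurable_fun (fun x => (- f_ m x)%:E)) => //.
    by apply/measurable_EFinP; exact: measurable_funN.
  - apply: aeS cv => x h _.
    have /cvg_limn_einf_sup[-> _] // : (fun m => (f_ m x)%:E) @ \oo --> (f x)%:E.
    by apply: cvg_EFin => //; exact: nearW.
apply: le_trans (fatou (@lebesgue_measure R) measurableT me e0) _.
rewrite limn_einf_lim; apply: lime_le; first exact: is_cvg_einfs.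
apply: nearW => m; apply: le_trans (hC m); apply: ereal_inf_lbound; exists m => //=.
Qed.

(* [|u| <= 1/w + w |u|^2], so weighted square summability gives absolute convergence. *)
Lemma ae_summable (u : nat -> R -> R[i]) (w : nat -> R) (S : R) :
  (forall k, cmeas (u k)) -> (forall k, 0 < w k) -> cvgn (series (fun k => (w k)^-1)) ->
  (forall K, (\sum_(k < K) (\int[mu]_x (w k * cabs (u k x) ^+ 2)%:E) <= S%:E)%E) ->
  exists (h : R -> R[i]) (c : R) (Phi : R -> R),
  [/\ cmeas h, 0 <= c, Phi \is_int, forall x, 0 <= Phi x &
   {ae mu, forall x, ccvg (fun K => \sum_(k < K) u k x) (h x) /\
      forall K, cabs (\sum_(k < K) u k x) <= c + Phi x}].
Proof.
move=> mu_ w0 cw hS.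
pose v k x : R := w k * cabs (u k x) ^+ 2.
have v0 k x : 0 <= v k x by rewrite mulr_ge0 ?sqr_ge0// ltW.
have mv k : measurable_fun setT (fun x => (v k x)%:E).
  apply/measurable_EFinP; apply: measurable_funM => //.
  by apply: measurable_funX; exact: measurable_cabs.
pose Fe x := (\sum_(k <oo) (v k x)%:E)%E.
have Fe0 x : (0 <= Fe x)%E by apply: nneseries_ge0 => k _ _; rewrite lee_fin.
have mFe : measurable_fun setT Fe.
  apply: ge0_emeasurable_sum; first by move=> k x _ _; rewrite lee_fin.
  by move=> k _; exact: mv.
have iFe : (\int[mu]_x Fe x <= S%:E)%E.
  rewrite integral_nneseries//; last by move=> k x _; rewrite lee_fin.
  apply: lime_le.
    by apply: is_cvg_nneseries => k _ _; apply: integral_ge0 => x _; rewrite lee_fin.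
  by apply: nearW => K; rewrite big_mkord; exact: hS.
have intFe : mu.-integrable setT Fe.
  apply/integrableP; split => //; under eq_integral do rewrite gee0_abs//.
  by apply: le_lt_trans iFe _; rewrite ltry.
have aeF : {ae mu, forall x, Fe x \is a fin_num}.
  by have := integrable_ae measurableT intFe; apply: aeS => x; apply.
pose D := [set x | Fe x \is a fin_num].
have mD : measurable D.
  by have := @emeasurable_fin_num _ _ _ setT Fe measurableT mFe; rewrite setTI.
pose Phi x := fine (Fe x).
have mPhi : measurable_fun setT Phi.
  by apply: (measurableT_comp (fine_measurable measurableT)).
have iPhi : Phi \is_int.
  apply: intP => //; apply: (@le_lt_trans _ _ (\int[mu]_x Fe x)%E); last first.
    by apply: le_lt_trans iFe _; rewrite ltry.
  apply: ge0_le_int => //.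
  - by apply/measurable_EFinP; exact: measurableT_comp.
  - move=> x; rewrite /Phi; have := Fe0 x; case: (Fe x) => [r| |]//=.
    by move=> r0; rewrite ger0_norm.
    by rewrite normr0.
set c := limn (series (fun k => (w k)^-1)).
have wK K : \sum_(k < K) (w k)^-1 <= c.
  have := nondecreasing_cvgn_le _ cw K; rewrite /series /= big_mkord; apply.
  by apply: nondecreasing_series => k _ _; rewrite invr_ge0 ltW.
have c0 : 0 <= c by apply: le_trans (wK 0%N); rewrite big_ord0.
have am k x : cabs (u k x) <= (w k)^-1 + v k x.
  rewrite /v; set y := cabs _; have y0 : 0 <= y by exact: cabs_ge0.
  have wk := w0 k; have h : 0 <= w k * (y - (w k)^-1) ^+ 2.
    by rewrite mulr_ge0 ?sqr_ge0// ltW.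
  have E : w k * (y - (w k)^-1) ^+ 2 = w k * y ^+ 2 - 2 * y + (w k)^-1.
    by field; rewrite gt_eqF.
  by rewrite E in h; lra.
have bnd K x : D x -> \sum_(k < K) cabs (u k x) <= c + Phi x.
  move=> Dx; apply: (@le_trans _ _ (\sum_(k < K) ((w k)^-1 + v k x))).
    by apply: ler_sum => k _; exact: am.
  rewrite big_split /=; apply: lerD; first exact: wK.
  rewrite -lee_fin /Phi fineK// -sumEFin -(big_mkord xpredT (fun k => (v k x)%:E)).
  by apply: nneseries_lim_ge => k _ _; rewrite lee_fin.
have cvgD (r : nat -> R) x : D x -> (forall k, `|r k| <= cabs (u k x)) ->
    cvgn (fun K => \sum_(k < K) r k).
  move=> Dx hr.
  have -> : (fun K => \sum_(k < K) r k) = series r.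
    by apply/funext => K; rewrite /series /= big_mkord.
  apply: normed_cvg; apply: nondecreasing_is_cvgn.
    by apply: nondecreasing_series => k _ _; exact: normr_ge0.
  have ub K : [normed series r] K <= c + Phi x.
    rewrite (_ : [normed series r] K = \sum_(k < K) `|r k|); last first.
      exact: (big_mkord xpredT (fun k => `|r k|)).
    by apply: le_trans (bnd K x Dx); apply: ler_sum => k _; exact: hr.
  by exists (c + Phi x) => _ [K _ <-]; exact: ub.
(* Off the set [D], whose complement is null, the series may diverge; there both the limit and the
   modified partial sums are set to 0, so that they converge everywhere and [h] is measurable. *)
pose h x : R[i] := if x \in D then
   (limn (fun K => \sum_(k < K) complex.Re (u k x)) +i*
    limn (fun K => \sum_(k < K) complex.Im (u k x)))%C else 0.
have cv x : D x -> ccvg (fun K => \sum_(k < K) u k x) (h x).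
  move=> Dx; rewrite /h mem_set//; split.
    have -> : (fun K => complex.Re (\sum_(k < K) u k x)) = fun K => \sum_(k < K) complex.Re (u k x).
      by apply/funext => K; exact: (Re_sum (u^~ x)).
    by apply: (@cvgD (fun k => complex.Re (u k x)) x) => // k; exact: Re_cabs.
  have -> : (fun K => complex.Im (\sum_(k < K) u k x)) = fun K => \sum_(k < K) complex.Im (u k x).
    by apply/funext => K; exact: (Im_sum (u^~ x)).
  by apply: (@cvgD (fun k => complex.Im (u k x)) x) => // k; exact: Im_cabs.
have ms K : cmeas (fun x => if x \in D then \sum_(k < K) u k x else 0).
  apply: cmeas_if; [|exact: cmeas_sum|exact: cmeas_cst].
  apply: (measurable_fun_bool true); rewrite setTI.
  by rewrite (_ : _ @^-1` _ = D)//; apply/seteqP; split => x; [move/set_mem|move/mem_set].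
have cv' x : ccvg (fun K => if x \in D then \sum_(k < K) u k x else 0) (h x).
  have [xD|xD] := boolP (x \in D); first by apply: cv; rewrite -inE.
  by rewrite /h (negbTE xD); exact: ccvg_cst.
exists h, c, Phi; split => //.
- split.
    apply: (measurable_fun_cvg (fun K => (ms K).1)) => x _; exact: (cv' x).1.
  apply: (measurable_fun_cvg (fun K => (ms K).2)) => x _; exact: (cv' x).2.
- by move=> x; exact: fine_ge0.
- apply: aeS aeF => x Dx; split; first exact: cv.
  by move=> K; exact: (le_trans (cabs_sum (u^~ x) K) (bnd K x Dx)).
Qed.

End complex_limits.

(** * Dyadic bands and the Sobolev weight on them *)

Section bands.
Context {R : realType}.

Definition band (k : nat) (xi : R) : bool :=
  if k is j.+1 then 2 ^+ j < `|xi| <= 2 ^+ k else `|xi| <= 1.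

Lemma band_le k xi : band k xi -> `|xi| <= 2 ^+ k.
Proof. by case: k => [|k] //= /andP[]. Qed.

Lemma sum_band (V : nmodType) (v : V) (xi : R) K :
  \sum_(k < K.+1) (if band k xi then v else 0) = if `|xi| <= 2 ^+ K then v else 0.
Proof.
elim: K => [|K ih]; first by rewrite big_ord_recr big_ord0 /= add0r.
rewrite big_ord_recr ih /= leNgt; case: ltP => /= [h|h].
  by rewrite add0r.
by rewrite addr0 (le_trans h)// ler_weXn2l// ler1n.
Qed.

Lemma measurable_band k : measurable_fun setT (band k).
Proof.
have mn : measurable_fun setT (fun xi : R => `|xi|) by exact: normr_measurable.
case: k => [|k]; first exact: measurable_fun_ler.
by apply: measurable_and; [exact: measurable_fun_ltr|exact: measurable_fun_ler].
Qed.

Definition piece (g : R -> R[i]) k xi : R[i] := if band k xi then g xi else 0.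

Lemma cmeas_piece g k : cmeas g -> cmeas (piece g k).
Proof. by move=> mg; apply: cmeas_if => //; exact: measurable_band. Qed.

Lemma cabs_piece g k xi : cabs (piece g k xi) <= cabs (g xi).
Proof. by rewrite /piece; case: ifP; rewrite // cabs0 cabs_ge0. Qed.

Lemma piece_supp g k xi : cabs (piece g k xi) != 0 -> `|xi| <= 2 ^+ k.
Proof. by rewrite /piece; case: ifP => [/band_le//|]; rewrite cabs0 eqxx. Qed.

Lemma piece_annulus g k xi : cabs (piece g k.+1 xi) != 0 ->
  2 ^+ k <= `|xi| <= 2 * 2 ^+ k.
Proof.
rewrite /piece; case: ifP => [/andP[/ltW -> +] _|]; last by rewrite cabs0 eqxx.
by rewrite exprS.
Qed.

Definition bessel_weight (s xi : R) : R := (1 + `|xi| ^+ 2) `^ s.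

Lemma bessel_weight_ge1 s xi : 0 <= s -> 1 <= bessel_weight s xi.
Proof.
move=> s0; apply: (@le_trans _ _ (1 `^ s)); first by rewrite powR1.
by apply: ler_powRl => //; rewrite lerDl sqr_ge0.
Qed.

(** Above band 0 one has [|xi| > 2^(k-1)], so the weight is at least [4^(s (k-1))]; the factor [4^s]
    makes up for the shift by one. *)
Lemma band_weight s k xi : 0 <= s -> band k xi ->
  (4 `^ s) ^+ k <= 4 `^ s * bessel_weight s xi.
Proof.
move=> s0; case: k => [_|k /= /andP[h _]].
  apply: (@le_trans _ _ (1 * 1)); first by rewrite expr0 mulr1.
  apply: ler_pM => //.
    apply: (@le_trans _ _ (1 `^ s)); first by rewrite powR1.
    by apply: ler_powRl => //; rewrite ler1n.
  exact: bessel_weight_ge1.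
rewrite exprS ler_wpM2l ?powR_ge0// -powR_mulrn ?powR_ge0// -powRrM mulrC powRrM powR_mulrn//.
apply: ler_powRl => //.
have -> : (4 : R) ^+ k = (2 ^+ k) ^+ 2 by rewrite -exprM mulnC exprM (_ : 2 ^+ 2 = 4)//; ring.
rewrite ler_wpDl//; by apply: lerXn2r; rewrite ?nnegrE ?exprn_ge0// ltW.
Qed.

End bands.

Section schwartz_bounds.
Context {R : realType}.
Implicit Type phi : R -> R[i].

Lemma schwartz_cmeas phi : schwartz phi -> cmeas phi.
Proof.
move=> [sm _]; split; apply: continuous_measurable_fun => x;
  apply: differentiable_continuous; apply/derivable1_diffP; by have [] := sm 0%N x.
Qed.

Lemma schwartz_decay phi : schwartz phi -> exists2 M : R, 0 <= M &
  forall x, cabs (phi x) <= M * (oneDsqr x)^-1.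
Proof.
move=> [_ sn].
have ub k : exists M : R, forall x, `|x| ^+ k * cabs (phi x) <= M.
  have := sn k 0%N; rewrite /schwartz_seminorm /cderiven /=.
  set A := (X in ereal_sup X) => fin.
  exists (fine (ereal_sup A)) => x.
  have le : ((`|x| ^+ k * cabs (phi x))%:E <= ereal_sup A)%E.
    apply: ereal_sup_ubound; exists x => //; rewrite /re_part /im_part.
    by congr ((_ * cabs _)%:E); exact: cplx_ext.
  rewrite -lee_fin fineK// ge0_fin_numE//; apply: le_trans le.
  by rewrite lee_fin mulr_ge0 ?exprn_ge0// cabs_ge0.
have [M0 h0] := ub 0%N; have [M2 h2] := ub 2%N.
exists (M0 + M2).
  by have := h0 0; have := h2 0; rewrite normr0 expr0n/= mul0r expr0 mul1r; have := cabs_ge0 (phi 0); lra.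
move=> x; rewrite ler_pdivlMr ?oneDsqr_gt0// /oneDsqr /=.
have := h0 x; have := h2 x; rewrite real_normK ?num_real// expr0 mul1r => ? ?.
by rewrite mulrDr mulr1 mulrC -/(x ^+ 2); lra.
Qed.

Lemma oneDsqrV_le1 (x : R) : (oneDsqr x)^-1 <= 1.
Proof. by rewrite invf_le1 ?oneDsqr_gt0// /oneDsqr lerDl sqr_ge0. Qed.

Lemma decay_int phi M : cmeas phi -> (forall x, cabs (phi x) <= M * (oneDsqr x)^-1) ->
  [/\ cintegrable phi, (fun x => cabs (phi x)) \is_int & (fun x => cabs (phi x) ^+ 2) \is_int].
Proof.
move=> mp hM; have ic : cintegrable phi.
  by apply: (cintegrable_le mp hM); apply: intZ; exact: int_oneDsqr.
have M0 : 0 <= M.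
  by have := le_trans (cabs_ge0 _) (hM 0); rewrite pmulr_lge0// invr_gt0 oneDsqr_gt0.
split => //; first exact: cintegrable_cabs.
apply: (@int_le _ _ (fun x => M * cabs (phi x))).
- by apply: measurable_funX; exact: measurable_cabs.
- move=> x; rewrite ger0_norm ?sqr_ge0// expr2; apply: ler_wpM2r; first exact: cabs_ge0.
  apply: le_trans (hM x) _; apply: ler_piMr => //; exact: oneDsqrV_le1.
- by apply: intZ; exact: cintegrable_cabs.
Qed.

Lemma cmeas_fourier_kernel phi (u : R -> R) : cmeas phi -> measurable_fun setT u ->
  cmeas (fun x => phi x * cis (u x)).
Proof. by move=> mp mu_; apply: cmeasM => //; exact: cmeas_cis. Qed.

Lemma cintegrable_osc phi (u : R -> R) : cmeas phi -> (fun x => cabs (phi x)) \is_int ->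
  measurable_fun setT u -> cintegrable (fun x => phi x * cis (u x)).
Proof.
move=> mp ip mu_; apply: (cintegrable_le _ _ ip); first exact: cmeas_fourier_kernel.
by move=> x; rewrite cabsM cis_abs mulr1.
Qed.

Lemma cmeas_cint_kernel phi : cmeas phi -> (fun x => cabs (phi x)) \is_int ->
  cmeas (fun xi : R => cintegral (fun x => phi x * cis (xi * x))).
Proof.
move=> mp ip.
apply: (@cmeas_cint_unif _ (fun z => phi z.1 * cis (z.2 * z.1)) (fun x => cabs (phi x))) => //.
  apply: cmeasM; first by apply: cmeas_comp => //; exact: measurable_fst.
  by apply: cmeas_cis; apply: measurable_funM; [exact: measurable_snd|exact: measurable_fst].
by move=> x y /=; rewrite cabsM cis_abs mulr1.
Qed.

Lemma cmeas_inv_fourier phi : cmeas phi -> (fun x => cabs (phi x)) \is_int ->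
  cmeas (inv_fourier phi).
Proof.
by move=> mp ip; apply: cmeasM; [exact: cmeas_cst|exact: cmeas_cint_kernel].
Qed.

(** The Bessel inequality needs a bounded support, so [phi] is truncated to growing balls. The
    transforms converge pointwise by dominated convergence, and Fatou's lemma keeps the uniform
    bound. *)
Lemma inv_fourier_L2 phi : cmeas phi -> (fun x => cabs (phi x)) \is_int ->
  (fun x => cabs (phi x) ^+ 2) \is_int -> (fun xi => cabs (inv_fourier phi xi) ^+ 2) \is_int.
Proof.
move=> mp ip ip2; have [C C0 hC] := @bessel R.
have mI := cmeas_inv_fourier mp ip.
apply: intP; first by apply: measurable_funX; exact: measurable_cabs.
pose c := (2 * pi)^-1 : R; have c0 : 0 <= c by rewrite invr_ge0 mulr_ge0// pi_ge0.
pose p m x : R[i] := if `|x| <= m.+1%:R then phi x else 0.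
have mpm m : cmeas (p m).
  by apply: cmeas_if => //; apply: measurable_fun_ler => //; exact: normr_measurable.
have ple m x : cabs (p m x) <= cabs (phi x).
  by rewrite /p; case: ifP; rewrite // cabs0 cabs_ge0.
have ipm m : (fun x => cabs (p m x)) \is_int.
  by apply: (int_le _ _ ip) => [|x]; [exact: measurable_cabs|rewrite ger0_norm ?cabs_ge0].
have ipm2 m : (fun x => cabs (p m x) ^+ 2) \is_int.
  apply: (int_le _ _ ip2) => [|x]; first by apply: measurable_funX; exact: measurable_cabs.
  by rewrite ger0_norm ?sqr_ge0//; apply: lerXn2r; rewrite ?nnegrE ?cabs_ge0.
pose E := \int[mu]_x (cabs (phi x) ^+ 2).
pose F m xi : R := cabs (cintegral (fun x => p m x * cis (xi * x))) ^+ 2.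
have mF m : measurable_fun setT (F m).
  by apply: measurable_funX; apply: measurable_cabs; exact: cmeas_cint_kernel.
pose F0 xi : R := cabs (cintegral (fun x => phi x * cis (xi * x))) ^+ 2.
have FE xi : cabs (inv_fourier phi xi) ^+ 2 = c ^+ 2 * F0 xi.
  by rewrite cabsM exprMn cabsR (ger0_norm c0).
have mF0 : measurable_fun setT F0.
  by apply: measurable_funX; apply: measurable_cabs; exact: cmeas_cint_kernel.
have bnd m : (\int[mu]_xi (F m xi)%:E <= (C * E)%:E)%E.
  apply: le_trans (hC m.+1%:R (p m) _ (mpm m) _ (ipm2 m)) _ => //.
    by move=> x; rewrite /p; case: ifP => //; rewrite cabs0 eqxx.
  rewrite lee_fin; apply: ler_wpM2l; first exact: ltW.
  apply: le_Rintegral => // x _; apply: lerXn2r; rewrite ?nnegrE ?cabs_ge0//.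
have cvF : {ae mu, forall xi, F m xi @[m --> \oo] --> F0 xi}.
  apply: aeW => xi; apply: ccvg_cabs2.
  have mk : measurable_fun setT (fun x : R => xi * x) by exact: measurable_funM.
  apply: (@cdominated_convergence _ _ _ (fun x => cabs (phi x)) _ _ _ ip _).2.
  - by move=> m; exact: cmeas_fourier_kernel.
  - exact: cmeas_fourier_kernel.
  - apply: aeW => x; apply: ccvgM; last exact: ccvg_cst.
    have near_eq : \forall m \near \oo, phi x = p m x.
      near=> m; rewrite /p ifT//.
      apply: (@le_trans _ _ m%:R); last by rewrite ler_nat.
      by near: m; exact: nbhs_infty_ger.
    by split; apply: cvg_near_cst; near=> m; congr (_ _); apply/esym; near: m.
  - by apply: aeW => x m; rewrite cabsM cis_abs mulr1.
have le : (\int[mu]_xi (F0 xi)%:E <= (C * E)%:E)%E.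
  by apply: (Rfatou mF mF0 _ _ cvF bnd) => *; exact: sqr_ge0.
have -> : (\int[mu]_x `|cabs (inv_fourier phi x) ^+ 2|%:E = \int[mu]_x ((c ^+ 2)%:E * (F0 x)%:E))%E.
  by apply: eq_integral => x _; rewrite ger0_norm ?sqr_ge0// FE.
rewrite ge0_intZ ?sqr_ge0//; last exact/measurable_EFinP.
  by apply: le_lt_trans (lee_wpmul2l _ le) _; rewrite ?lee_fin ?sqr_ge0// -EFinM ltry.
by move=> x; rewrite lee_fin sqr_ge0.
Unshelve. all: by end_near. Qed.

End schwartz_bounds.

Section oscillatory_pairing.
Context {R : realType}.

Lemma measurable_phase (a t x : R) : measurable_fun setT (fun xi : R => x * xi + t * `|xi| `^ a).
Proof.
apply: measurable_funD; first exact: measurable_funM.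
by apply: measurable_funM => //; exact: measurable_abspow.
Qed.

(** Fubini moves the oscillation from [G] to the test function. This identifies the explicit
    oscillatory integral, divided by [2 pi], with the distribution that defines the mean. *)
Lemma osc_pairing (a t : R) (G phi : R -> R[i]) : cmeas G -> (fun xi => cabs (G xi)) \is_int ->
  cmeas phi -> (fun x => cabs (phi x)) \is_int ->
  cintegral (fun x => ((2 * pi)^-1)%:C%C * osc a G t x * phi x) =
  cintegral (fun xi => cis (t * `|xi| `^ a) * G xi * inv_fourier phi xi).
Proof.
move=> mG iG mp ip; pose c : R[i] := ((2 * pi)^-1)%:C%C.
pose F (z : R * R) := c * phi z.1 * (G z.2 * cis (z.1 * z.2 + t * `|z.2| `^ a)).
have mF : cmeas F.
  apply: cmeasM; first by apply: cmeasM; [exact: cmeas_cst|apply: cmeas_comp => //; exact: measurable_fst].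
  apply: cmeasM; first by apply: cmeas_comp => //; exact: measurable_snd.
  apply: cmeas_cis; apply: measurable_funD.
    by apply: measurable_funM; [exact: measurable_fst|exact: measurable_snd].
  by apply: measurable_funM => //; apply: (measurableT_comp (measurable_abspow a)); exact: measurable_snd.
have iu : (fun x => cabs c * cabs (phi x)) \is_int by exact: intZ.
have bF x y : cabs (F (x, y)) <= cabs c * cabs (phi x) * cabs (G y).
  by rewrite /F !cabsM /= cis_abs mulr1.
transitivity (cintegral (fun x => cintegral (fun xi => F (x, xi)))).
  apply: eq_cintegral => x; rewrite -/c mulrAC.
  by rewrite -(cintegralZ (c * phi x)) //; apply: cintegrable_osc => //; exact: measurable_phase.
rewrite (cfubini mF iu iG bF); apply: eq_cintegral => xi.
rewrite /inv_fourier -/c mulrA -cintegralZ; last first.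
  by apply: cintegrable_osc => //; exact: measurable_funM.
have key (c' p l e f : R[i]) : c' * p * (l * (f * e)) = e * l * c' * (p * f) by ring.
by apply: eq_cintegral => x; rewrite /F /= cisD (mulrC x xi) key.
Qed.

End oscillatory_pairing.

(** * The means as almost everywhere limits of dyadic sums *)

Section band_decomposition.
Context {R : realType}.
Variables (g : R -> R[i]) (s : R).
Hypotheses (mg : cmeas g) (s_gt0 : 0 < s).
Hypothesis ig : (fun xi => bessel_weight s xi * cabs (g xi) ^+ 2) \is_int.

Let E := \int[mu]_xi (bessel_weight s xi * cabs (g xi) ^+ 2).
Let B : R := 4 `^ s.

Let B1 : 1 < B.
Proof.
by rewrite /B /powR pnatr_eq0 /= expR_gt1 mulr_gt0// ln_gt0// ltr1n.
Qed.

Let w1 xi : 1 <= bessel_weight s xi.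
Proof. by apply: bessel_weight_ge1; exact: ltW. Qed.

Lemma weighted_int2 : (fun xi => cabs (g xi) ^+ 2) \is_int.
Proof.
apply: (int_le _ _ ig) => [|xi]; first by apply: measurable_funX; exact: measurable_cabs.
by rewrite ger0_norm ?sqr_ge0//; apply: ler_peMl => //; exact: sqr_ge0.
Qed.

Lemma piece_int2 k : (fun xi => cabs (piece g k xi) ^+ 2) \is_int.
Proof.
apply: (int_le _ _ weighted_int2) => [|xi].
  by apply: measurable_funX; apply: measurable_cabs; exact: cmeas_piece.
by rewrite ger0_norm ?sqr_ge0//; apply: lerXn2r; rewrite ?nnegrE ?cabs_ge0// cabs_piece.
Qed.

Lemma piece_int k : (fun xi => cabs (piece g k xi)) \is_int.
Proof.
apply: (@int_supported _ _ (2 ^+ k)); [exact: cmeas_piece|exact: piece_supp|exact: piece_int2].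
Qed.

Lemma sum_piece_le K xi : \sum_(k < K) cabs (piece g k xi) ^+ 2 <= cabs (g xi) ^+ 2.
Proof.
case: K => [|K]; first by rewrite big_ord0 sqr_ge0.
rewrite (eq_bigr (fun k : 'I_K.+1 => if band k xi then cabs (g xi) ^+ 2 else 0)).
  by rewrite sum_band; case: ifP => // _; exact: sqr_ge0.
by move=> k _; rewrite /piece; case: ifP => //; rewrite cabs0 expr0n.
Qed.

Lemma band_energy K :
  \sum_(k < K) B ^+ k * \int[mu]_xi (cabs (piece g k xi) ^+ 2) <= B * E.
Proof.
pose F K xi := \sum_(k < K) B ^+ k * cabs (piece g k xi) ^+ 2.
have [iF <-] : F K \is_int /\ \int[mu]_xi F K xi =
    \sum_(k < K) B ^+ k * \int[mu]_xi (cabs (piece g k xi) ^+ 2).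
  elim: K => [|K [ih1 ih2]].
    have -> : F 0%N = fun=> 0 by apply/funext => xi; rewrite /F big_ord0.
    split; first exact: integrable0.
    by rewrite big_ord0 /Rintegral integral0.
  have FS : F K.+1 = fun xi => F K xi + B ^+ K * cabs (piece g K xi) ^+ 2.
    by apply/funext => xi; rewrite /F big_ord_recr.
  have iK : (fun xi => B ^+ K * cabs (piece g K xi) ^+ 2) \is_int.
    by apply: intZ; exact: piece_int2.
  rewrite FS; split; first exact: intD.
  rewrite big_ord_recr /= -ih2 RintegralD//.
  by congr (_ + _); rewrite RintegralZl//; exact: piece_int2.
rewrite /E -RintegralZl//; apply: le_Rintegral => //; first exact: intZ.
move=> xi _; apply: (@le_trans _ _ (\sum_(k < K) (B * bessel_weight s xi) * cabs (piece g k xi) ^+ 2)).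
  apply: ler_sum => k _; rewrite /piece; case: ifP => [b|_]; last by rewrite cabs0 expr0n !mulr0.
  by apply: ler_wpM2r; [exact: sqr_ge0|apply: band_weight => //; exact: ltW].
rewrite -mulr_sumr -mulrA; apply: ler_wpM2l; first exact: powR_ge0.
apply: ler_wpM2l; first exact: le_trans (w1 xi).
exact: sum_piece_le.
Qed.

Definition partial (a t : R) K x : R[i] := \sum_(k < K) osc a (piece g k) t x.

Let low K xi := \sum_(k < K) piece g k xi.

Let low_le K xi : cabs (low K xi) <= cabs (g xi).
Proof.
case: K => [|K]; first by rewrite /low big_ord0 cabs0 cabs_ge0.
by rewrite /low /piece sum_band; case: ifP; rewrite // cabs0 cabs_ge0.
Qed.

Let low_eq K m xi : (m < K)%N -> `|xi| <= m%:R -> low K xi = g xi.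
Proof.
case: K => // K; rewrite ltnS => mK hm; rewrite /low /piece sum_band ifT//.
apply: le_trans hm _; apply: (@le_trans _ _ (2 ^ K)%:R); last by rewrite natrX.
by rewrite ler_nat (leq_trans mK)// ltnW// ltn_expl.
Qed.

Let mlow K : cmeas (low K).
Proof. by apply: cmeas_sum => k; exact: cmeas_piece. Qed.

Let ilow K : (fun xi => cabs (low K xi)) \is_int.
Proof.
case: K => [|K].
  have -> : (fun xi => cabs (low 0 xi)) = fun=> 0.
    by apply/funext => xi; rewrite /low big_ord0 cabs0.
  exact: integrable0.
apply: (@int_supported _ _ (2 ^+ K)) => //.
  by move=> xi; rewrite /low /piece sum_band; case: ifP => //; rewrite cabs0 eqxx.
apply: (int_le _ _ weighted_int2) => [|xi].
  by apply: measurable_funX; exact: measurable_cabs.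
by rewrite ger0_norm ?sqr_ge0//; apply: lerXn2r; rewrite ?nnegrE ?cabs_ge0.
Qed.

Let partialE a t K x : partial a t K x = cintegral (fun xi => low K xi * cis (x * xi + t * `|xi| `^ a)).
Proof.
elim: K => [|K ih].
  rewrite /partial big_ord0 (@eq_cintegral _ _ (fun=> 0)); last first.
    by move=> xi; rewrite /low big_ord0 mul0r.
  by rewrite /cintegral /re_part /im_part /= /Rintegral integral0.
rewrite /partial big_ord_recr /= -/(partial a t K x) ih /osc -cintegralD.
- by apply: eq_cintegral => xi; rewrite -mulrDl /low big_ord_recr.
- by apply: cintegrable_osc => //; exact: measurable_phase.
- by apply: cintegrable_osc; [exact: cmeas_piece|exact: piece_int|exact: measurable_phase].
Qed.

Let cmeas_osc_piece a t k : cmeas (osc a (piece g k) t).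
Proof. by apply: (@cmeas_osc_t _ a (piece g k) (fun=> t)); [exact: cmeas_piece|exact: piece_int|]. Qed.

Lemma cmeas_partial a t K : cmeas (partial a t K).
Proof. exact: (cmeas_sum K (cmeas_osc_piece a t)). Qed.

Let partial_pairing (a t : R) K (phi : R -> R[i]) : cmeas phi -> (fun x => cabs (phi x)) \is_int ->
  cintegral (fun x => ((2 * pi)^-1)%:C%C * partial a t K x * phi x) =
  cintegral (fun xi => cis (t * `|xi| `^ a) * low K xi * inv_fourier phi xi).
Proof.
move=> mp ip; rewrite -(osc_pairing a t (mlow K) (ilow K) mp ip).
by apply: eq_cintegral => x; rewrite partialE.
Qed.

(** The [L^2] norms of the band contributions, weighted by [B^k], are summable by [band_energy] and
    the Bessel inequality, so the series converges absolutely almost everywhere. To see that its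
    limit is a density, the pairing identity for partial sums is passed to the limit on both
    sides. *)
Lemma band_representation (a t : R) : exists h : R -> R[i],
  is_density (distr_inv_fourier (distr_of_fun (fun xi => cis (t * `|xi| `^ a) * g xi))) h /\
  {ae mu, forall x, ccvg (fun K => ((2 * pi)^-1)%:C%C * partial a t K x) (h x)}.
Proof.
have [C C0 hC] := @osc_bessel R.
have wB k : 0 < B ^+ k by apply: exprn_gt0; exact: lt_trans ltr01 B1.
have cB : cvgn (series (fun k => (B ^+ k)^-1)).
  have -> : (fun k => (B ^+ k)^-1) = geometric 1 B^-1.
    by apply/funext => k; rewrite /geometric /= mul1r exprVn.
  have B0 : 0 < B by exact: lt_trans ltr01 B1.
  by apply: is_cvg_geometric_series; rewrite ger0_norm ?invr_ge0 ?(ltW B0)// invf_lt1.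
have hS K : (\sum_(k < K) (\int[mu]_x (B ^+ k * cabs (osc a (piece g k) t x) ^+ 2)%:E) <= (C * (B * E))%:E)%E.
  apply: (@le_trans _ _ (\sum_(k < K) (B ^+ k * (C * \int[mu]_xi (cabs (piece g k xi) ^+ 2)))%:E)%E).
    apply: lee_sum => k _.
    have -> : (\int[mu]_x (B ^+ k * cabs (osc a (piece g k) t x) ^+ 2)%:E =
        (B ^+ k)%:E * \int[mu]_x (cabs (osc a (piece g k) t x) ^+ 2)%:E)%E.
      rewrite -ge0_intZ; first by apply: eq_integral => x _; rewrite EFinM.
      - by apply: ltW.
      - by move=> x; rewrite lee_fin sqr_ge0.
      - by apply/measurable_EFinP; apply: measurable_funX; exact: measurable_cabs.
    rewrite EFinM; apply: lee_wpmul2l; first by rewrite lee_fin ltW.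
    apply: (hC a (2 ^+ k) t); [by rewrite exprn_gt0|exact: cmeas_piece|exact: piece_supp|exact: piece_int2].
  rewrite sumEFin lee_fin.
  under eq_bigr do rewrite mulrCA.
  by rewrite -mulr_sumr; apply: ler_wpM2l; [exact: ltW|exact: band_energy].
have [h0 [c0 [Phi [mh0 c00 iPhi Phi0 aeh]]]] := ae_summable (cmeas_osc_piece a t) wB cB hS.
pose c : R[i] := ((2 * pi)^-1)%:C%C.
exists (fun x => c * h0 x); split; last first.
  by apply: aeS aeh => x [cv _]; apply: ccvgM => //; exact: ccvg_cst.
have mh : cmeas (fun x => c * h0 x) by apply: cmeasM => //; exact: cmeas_cst.
split => // phi sphi; have mp := schwartz_cmeas sphi.
have [M M0 hM] := schwartz_decay sphi; have [_ ip ip2] := decay_int mp hM.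
(* Majorant on the space side: the partial sums are at most [c0 + Phi], with [c0] paired with the
   integrable [phi], and the integrable [Phi] with its bound [M]. *)
have iD : (fun x => cabs c * (c0 * cabs (phi x) + M * Phi x)) \is_int.
  by apply: intZ; apply: intD; exact: intZ.
have phiM x : cabs (phi x) <= M.
  by apply: le_trans (hM x) _; rewrite ler_piMr// oneDsqrV_le1.
have dom : {ae mu, forall x K, cabs (c * partial a t K x * phi x) <=
    cabs c * (c0 * cabs (phi x) + M * Phi x)}.
  apply: aeS aeh => x [_ hb] K; rewrite !cabsM -mulrA; apply: ler_wpM2l; first exact: cabs_ge0.
  apply: (@le_trans _ _ ((c0 + Phi x) * cabs (phi x))).
    by apply: ler_wpM2r; [exact: cabs_ge0|exact: hb].
  by rewrite mulrDl lerD2l mulrC; apply: ler_wpM2r.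
have cvh : {ae mu, forall x, ccvg (fun K => c * partial a t K x * phi x) (c * h0 x * phi x)}.
  apply: aeS aeh => x [cv _]; apply: ccvgM; last exact: ccvg_cst.
  by apply: ccvgM => //; exact: ccvg_cst.
have mS K : cmeas (fun x => c * partial a t K x * phi x).
  apply: cmeasM => //; apply: cmeasM; [exact: cmeas_cst|exact: cmeas_partial].
have mhp : cmeas (fun x => c * h0 x * phi x) by exact: cmeasM.
have [ih lh] := cdominated_convergence mS mhp cvh iD dom.
split => //.
have ipsi := inv_fourier_L2 mp ip ip2.
have mpsi := cmeas_inv_fourier mp ip.
have mcis : cmeas (fun xi : R => cis (t * `|xi| `^ a)).
  by apply: cmeas_cis; apply: measurable_funM => //; exact: measurable_abspow.
have cvg_low : {ae mu, forall xi, ccvg (fun K => cis (t * `|xi| `^ a) * low K xi * inv_fourier phi xi)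
    (cis (t * `|xi| `^ a) * g xi * inv_fourier phi xi)}.
  apply: aeW => xi; apply: ccvgM; last exact: ccvg_cst.
  apply: ccvgM; first exact: ccvg_cst.
  have near_eq : \forall K \near \oo, g xi = low K xi.
    near=> K; apply/esym; apply: (@low_eq K (Num.bound `|xi|)); last by rewrite ltW// archi_boundP.
    by near: K; exact: nbhs_infty_gt.
  by split; apply: cvg_near_cst; near=> K; congr (_ _); apply/esym; near: K.
(* On the frequency side [g] is only square integrable, so the majorant is
   [|g|^2 + |inv_fourier phi|^2]. *)
have iL : (fun xi => cabs (g xi) ^+ 2 + cabs (inv_fourier phi xi) ^+ 2) \is_int.
  by apply: intD => //; exact: weighted_int2.
have dom2 : {ae mu, forall xi K, cabs (cis (t * `|xi| `^ a) * low K xi * inv_fourier phi xi) <=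
    cabs (g xi) ^+ 2 + cabs (inv_fourier phi xi) ^+ 2}.
  apply: aeW => xi K; rewrite (cabsM _ (inv_fourier phi xi)) (cabsM (cis _)) cis_abs mul1r.
  set p := cabs (inv_fourier _ _); have p0 : 0 <= p by exact: cabs_ge0.
  apply: (@le_trans _ _ (cabs (g xi) * p)); first exact: ler_wpM2r.
  set q := cabs (g xi); have q0 : 0 <= q by exact: cabs_ge0.
  have := sqr_ge0 (p - q); have := mulr_ge0 p0 q0; rewrite sqrrB; lra.
have mL K : cmeas (fun xi : R => cis (t * `|xi| `^ a) * low K xi * inv_fourier phi xi).
  by apply: cmeasM => //; exact: cmeasM.
have mG : cmeas (fun xi : R => cis (t * `|xi| `^ a) * g xi * inv_fourier phi xi).
  by apply: cmeasM => //; exact: cmeasM.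
have [_ ll] := cdominated_convergence mL mG cvg_low iL dom2.
apply: (ccvg_unique ll); move: lh.
by under eq_fun do rewrite partial_pairing//.
Unshelve. all: by end_near. Qed.

End band_decomposition.

(** * Summing the bands *)

Section mass.
Context {R : realType}.
Implicit Types f g : R -> R.

Definition mass_le f (c : R) : Prop :=
  [/\ measurable_fun setT f, forall x, 0 <= f x & (\int[mu]_x (f x)%:E <= c%:E)%E].

Lemma mass_leD f g c d : mass_le f c -> mass_le g d -> mass_le (fun x => f x + g x) (c + d).
Proof.
move=> [mf f0 fc] [mg g0 gd]; split.
- exact: measurable_funD.
- by move=> x; rewrite addr_ge0.
- under eq_integral do rewrite EFinD.
  rewrite ge0_intD; [by rewrite EFinD leeD| | | |];
    by [move=> x; rewrite lee_fin|exact/measurable_EFinP].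
Qed.

Lemma mass_leZ f c d : 0 <= d -> mass_le f c -> mass_le (fun x => d * f x) (d * c).
Proof.
move=> d0 [mf f0 fc]; split.
- exact: measurable_funM.
- by move=> x; rewrite mulr_ge0.
- under eq_integral do rewrite EFinM.
  rewrite ge0_intZ//; last exact/measurable_EFinP.
  by rewrite EFinM; exact: lee_wpmul2l.
Qed.

Lemma mass_le0 : mass_le (fun=> 0) 0.
Proof. by split => //; rewrite integral0. Qed.

Lemma mass_le_sum (f : nat -> R -> R) (c : nat -> R) K : (forall k, mass_le (f k) (c k)) ->
  mass_le (fun x => \sum_(k < K) f k x) (\sum_(k < K) c k).
Proof.
move=> fc; elim: K => [|K ih].
  have -> : (fun x => \sum_(k < 0) f k x) = fun=> 0 by apply/funext => x; rewrite big_ord0.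
  by rewrite big_ord0; exact: mass_le0.
have -> : (fun x => \sum_(k < K.+1) f k x) = fun x => \sum_(k < K) f k x + f K x.
  by apply/funext => x; rewrite big_ord_recr.
by rewrite big_ord_recr /=; exact: mass_leD.
Qed.

Lemma mass_le_trans f g c d : measurable_fun setT f -> (forall x, 0 <= f x <= g x) ->
  mass_le g c -> c <= d -> mass_le f d.
Proof.
move=> mf fg [mg g0 gc] cd; split => //.
  by move=> x; have /andP[] := fg x.
apply: (@le_trans _ _ c%:E); last by rewrite lee_fin.
apply: le_trans gc; apply: ge0_le_int.
- by move=> x; rewrite lee_fin; have /andP[] := fg x.
- exact/measurable_EFinP.
- exact/measurable_EFinP.
- by move=> x; rewrite lee_fin; have /andP[] := fg x.
Qed.

Lemma mass_leW f c d : mass_le f c -> c <= d -> mass_le f d.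
Proof.
by move=> [mf f0 fc] cd; split => //; apply: le_trans fc _; rewrite lee_fin.
Qed.

End mass.

Section weighted_sums.
Context {R : realType}.

(* Cauchy-Schwarz, from [0 <= sum_k (l - v_k x_k)^2 / v_k] at [l = (sum x_k) / (sum v_k^-1)]. *)
Lemma weighted_sqr_sum (v x : nat -> R) (c : R) K : (forall k, 0 < v k) ->
  \sum_(k < K) (v k)^-1 <= c ->
  (\sum_(k < K) x k) ^+ 2 <= c * \sum_(k < K) v k * x k ^+ 2.
Proof.
move=> v0 hc; set V := \sum_(k < K) _ * _.
have V0 : 0 <= V by apply: sumr_ge0 => k _; rewrite mulr_ge0 ?sqr_ge0// ltW.
apply: (@le_trans _ _ ((\sum_(k < K) (v k)^-1) * V)); last exact: ler_wpM2r.
have [->|K0] := posnP K; first by rewrite !big_ord0 expr0n /= mul0r.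
set W := \sum_(k < K) (v k)^-1; set S := \sum_(k < K) x k.
have W0 : 0 < W.
  rewrite /W -(prednK K0) big_ord_recl; apply: ltr_pwDl; first by rewrite invr_gt0.
  by apply: sumr_ge0 => k _; rewrite invr_ge0 ltW.
pose l := S / W.
have : 0 <= \sum_(k < K) (v k)^-1 * (l - v k * x k) ^+ 2.
  by apply: sumr_ge0 => k _; rewrite mulr_ge0 ?sqr_ge0// invr_ge0 ltW.
have -> : \sum_(k < K) (v k)^-1 * (l - v k * x k) ^+ 2 = l ^+ 2 * W - 2 * l * S + V.
  rewrite /W /S /V !mulr_sumr -sumrB -big_split /=; apply: eq_bigr => k _.
  by field; rewrite gt_eqF.
have -> : l ^+ 2 * W - 2 * l * S + V = V - S ^+ 2 / W.
  by rewrite /l; field; rewrite gt_eqF.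
by rewrite subr_ge0 ler_pdivrMr// mulrC.
Qed.

Lemma geom_sum_le (q : R) K : 0 <= q -> q < 1 -> \sum_(k < K) q ^+ k <= (1 - q)^-1.
Proof.
move=> q0 q1; have d0 : 0 < 1 - q by rewrite subr_gt0.
suff -> : \sum_(k < K) q ^+ k = (1 - q ^+ K) / (1 - q).
  by rewrite ler_pdivrMr// mulVf ?gt_eqF// gerBl exprn_ge0.
elim: K => [|K ih]; first by rewrite big_ord0 expr0 subrr mul0r.
by rewrite big_ord_recr /= ih exprS; field; rewrite gt_eqF.
Qed.

Definition gap (j k : nat) : nat := (j - k) + (k - j).

Lemma gapC j k : gap j k = gap k j. Proof. exact: addnC. Qed.

(** A geometric series on either side of [j]. The bound does not depend on [j] or [K], and by
    symmetry serves for sums over either index. *)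
Lemma gap_sum_le (q : R) j K : 0 < q -> q < 1 -> \sum_(k < K) q ^+ gap j k <= 2 / (1 - q).
Proof.
move=> q0 q1; have d0 : 0 < 1 - q by rewrite subr_gt0.
have h1 n : \sum_(k < n) q ^+ (n - k) <= (1 - q)^-1.
  apply: le_trans (geom_sum_le n.+1 (ltW q0) q1).
  rewrite big_ord_recl /= expr0 ler_wpDl// (reindex_inj rev_ord_inj) /=.
  apply: ler_sum => k _; rewrite /fintype.bump leq0n add1n.
  by rewrite subKn.
have -> : \sum_(k < K) q ^+ gap j k = \sum_(0 <= k < K) q ^+ gap j k by rewrite big_mkord.
have tail n : \sum_(j <= k < j + n) q ^+ gap j k <= (1 - q)^-1.
  rewrite -{1}[j]add0n (addnC j n) big_addn addnK big_mkord.
  apply: le_trans (geom_sum_le n (ltW q0) q1).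
  by apply: ler_sum => k _; rewrite /gap addnK (_ : (j - (k + j))%N = 0%N)//; apply/eqP; rewrite subn_eq0 leq_addl.
have head n : (n <= j)%N -> \sum_(0 <= k < n) q ^+ gap j k <= (1 - q)^-1.
  move=> nj; apply: le_trans (h1 j).
  rewrite -(big_mkord xpredT (fun k => q ^+ (j - k))) (@big_cat_nat _ _ _ n _ j)//=.
  apply: ler_wpDr; first by apply: sumr_ge0 => k _; rewrite exprn_ge0// ltW.
  rewrite !big_nat; apply: ler_sum => k /andP[_ kn].
  rewrite /gap (_ : (k - j)%N = 0%N) ?addn0//; apply/eqP.
  by rewrite subn_eq0 ltnW// (leq_trans kn).
rewrite mulr_natl mulr2n; have [Kj|jK] := leqP K j.
  by apply: le_trans (head K Kj) _; rewrite lerDl invr_ge0 ltW.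
rewrite (@big_cat_nat _ _ _ j)//=; last exact: ltnW.
apply: lerD; first exact: head.
by have := tail (K - j)%N; rewrite subnKC// ltnW.
Qed.

End weighted_sums.

Section lipschitz_phase.
Context {R : realType}.

Lemma sin_cos_lip (u v : R) : u <= v ->
  `|sin v - sin u| <= v - u /\ `|cos v - cos u| <= v - u.
Proof.
rewrite le_eqVlt => /predU1P[->|uv]; first by rewrite !subrr normr0.
split.
  rewrite -(@Rint_FTC2 _ sin cos)//; first last.
  - by move=> x _; exact: continuous_cos.
  - by move=> x _; exact: is_derive_sin.
  rewrite -[X in _ <= X]mul1r; apply: Rint_le_bound => //.
    by move=> x _; exact: continuous_cos.
  by move=> x _; exact: cos_max.
rewrite -(@Rint_FTC2 _ cos (fun x => - sin x))//; first last.
- by move=> x _; apply: continuousN; exact: continuous_sin.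
- by move=> x _; exact: is_derive_cos.
rewrite -[X in _ <= X]mul1r; apply: Rint_le_bound => //.
  by move=> x _; apply: continuousN; exact: continuous_sin.
by move=> x _; rewrite normrN; exact: sin_max.
Qed.

Lemma cis_lip (u v : R) : cabs (cis u - cis v) <= 2 * `|u - v|.
Proof.
wlog uv : u v / v <= u.
  move=> h; have [/h//|/ltW/h] := leP v u.
  by rewrite distrC -cabsN opprB.
apply: le_trans (cabs_ReIm _) _; rewrite ReD ImD ReN ImN /=.
have [h1 h2] := sin_cos_lip uv; have uv0 : 0 <= u - v by rewrite subr_ge0.
by rewrite (ger0_norm uv0); lra.
Qed.

End lipschitz_phase.

Section maximal_bands.
Context {R : realType}.

Let sq_int (G H : R -> R[i]) (c : R) : cmeas H -> (forall xi, cabs (H xi) <= c * cabs (G xi)) ->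
  (fun xi => cabs (G xi) ^+ 2) \is_int ->
  (fun xi => cabs (H xi) ^+ 2) \is_int /\
  \int[mu]_xi (cabs (H xi) ^+ 2) <= c ^+ 2 * \int[mu]_xi (cabs (G xi) ^+ 2).
Proof.
move=> mH hH iG; have iG' := intZ (c ^+ 2) iG.
have le xi : cabs (H xi) ^+ 2 <= c ^+ 2 * cabs (G xi) ^+ 2.
  by rewrite -exprMn; apply: lerXn2r; rewrite ?nnegrE ?cabs_ge0// (le_trans _ (hH xi))// cabs_ge0.
have iH : (fun xi => cabs (H xi) ^+ 2) \is_int.
  apply: (int_le _ _ iG') => [|xi]; last by rewrite ger0_norm ?sqr_ge0.
  by apply: measurable_funX; exact: measurable_cabs.
by split => //; rewrite -RintegralZl//; exact: le_Rintegral.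
Qed.

Lemma osc_mass : exists2 C : R, 0 < C & forall (a r t : R) (G : R -> R[i]), 0 < r -> cmeas G ->
  (forall xi, cabs (G xi) != 0 -> `|xi| <= r) ->
  (fun xi => cabs (G xi) ^+ 2) \is_int ->
  mass_le (fun x => cabs (osc a G t x) ^+ 2) (C * \int[mu]_xi (cabs (G xi) ^+ 2)).
Proof.
have [C C0 hC] := @osc_bessel R; exists C => // a r t G r0 mG sG iG.
split; [|by move=> x; exact: sqr_ge0|exact: (hC a r)].
apply: measurable_funX; apply: measurable_cabs.
by apply: (@cmeas_osc_t _ a G (fun=> t)) => //; exact: (@int_supported _ G r).
Qed.

Lemma sum_gaps_le (t : nat -> R) N : (forall n, 0 <= t n) -> \sum_(m < N) (t m - t m.+1) <= t 0%N.
Proof.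
move=> t0; rewrite -(big_mkord xpredT (fun m => t m - t m.+1)).
rewrite (eq_bigr (fun m => - (t m.+1 - t m))); last by move=> m _; rewrite opprB.
by rewrite sumrN telescope_sumr// opprB lerBlDr lerDl.
Qed.

(* The phase is Lipschitz in time on [|xi| <= 1], so the increments telescope. *)
Lemma low_maximal (a : R) : 0 < a -> exists2 C : R, 0 < C &
  forall (G : R -> R[i]) (t : nat -> R) (N : nat), cmeas G ->
  (forall xi, cabs (G xi) != 0 -> `|xi| <= 1) ->
  (fun xi => cabs (G xi) ^+ 2) \is_int ->
  nonincreasing_seq t -> (forall n, 0 <= t n) ->
  mass_le (maxsq N xpredT (fun n => osc a G (t n)))
    (C * (1 + t 0%N) ^+ 2 * \int[mu]_xi (cabs (G xi) ^+ 2)).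
Proof.
move=> a0; have [C C0 hC] := osc_mass; exists (16 * C); first by rewrite mulr_gt0.
move=> G t N mG sG iG tdec t0.
have iG1 : (fun xi => cabs (G xi)) \is_int by exact: (@int_supported _ G 1).
set Q := \int[mu]_xi _; have Q0 : 0 <= Q by apply: Rintegral_ge0 => x _; exact: sqr_ge0.
pose d m := t m - t m.+1; have d0 m : 0 <= d m by rewrite subr_ge0 tdec.
(* Weights for Cauchy-Schwarz on the increments. The gap alone would be the natural choice but may
   vanish; adding [2^-m] keeps it positive and raises the total only by 2. *)
pose w m : R := d m + 2^-1 ^+ m.
have w0 m : 0 < w m by apply: ltr_wpDl => //; apply: exprn_gt0; rewrite invr_gt0.
have sd : \sum_(m < N) d m <= t 0%N by exact: sum_gaps_le.
have sw : \sum_(m < N) ((w m)^-1)^-1 <= t 0%N + 2.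
  under eq_bigr do rewrite invrK; rewrite big_split /=; apply: lerD => //.
  apply: le_trans (geom_sum_le N _ _) _; [by rewrite invr_ge0|by rewrite invf_lt1// ltr1n|].
  by rewrite le_eqVlt; apply/orP; left; apply/eqP; field.
pose H m xi : R[i] := G xi * (cis (t m.+1 * `|xi| `^ a) - cis (t m * `|xi| `^ a)).
have mcis (r : R) : cmeas (fun xi : R => cis (r * `|xi| `^ a)).
  by apply: cmeas_cis; apply: measurable_funM => //; exact: measurable_abspow.
have mH m : cmeas (H m) by apply: cmeasM => //; apply: cmeasD => //; exact: cmeasN.
have HG m xi : cabs (H m xi) <= 2 * d m * cabs (G xi).
  rewrite cabsM mulrC; have [->|/sG x1] := eqVneq (cabs (G xi)) 0; first by rewrite !mulr0.
  apply: ler_wpM2r; first exact: cabs_ge0.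
  apply: le_trans (cis_lip _ _) _; rewrite -mulrBl normrM distrC (ger0_norm (d0 m)).
  rewrite mulrA; apply: ler_piMr; first by rewrite mulr_ge0.
  rewrite ger0_norm ?powR_ge0// (_ : 1 = 1 `^ a); last by rewrite powR1.
  by apply: ler_powRl => //; exact: ltW.
have sH m xi : cabs (H m xi) != 0 -> `|xi| <= 1.
  move=> h; apply: sG; apply: contra_neq h => G0; apply/eqP.
  by rewrite eq_le cabs_ge0 andbT -(mulr0 (2 * d m)) -G0.
(* The increment from time [t m] to [t m.+1], seen as the time-zero integral of [H m], so that the
   fixed-time bound applies with a factor [(2 d m)^2]. *)
pose D m x := osc a (H m) 0 x.
have DE m x : osc a G (t m.+1) x = osc a G (t m) x + D m x.
  rewrite /D /osc -cintegralD.
  - apply: eq_cintegral => xi; rewrite /H mul0r addr0 !cisD; move: (cis _) (cis _) (cis _) => p q r.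
    by ring.
  - apply: cintegrable_osc => //; apply: measurable_funD; first exact: measurable_funM.
    by apply: measurable_funM => //; exact: measurable_abspow.
  - apply: cintegrable_osc => //; first by apply: (@int_supported _ _ 1) => //;
      [exact: sH|exact: (sq_int (mH m) (HG m) iG).1].
    apply: measurable_funD; first exact: measurable_funM.
    by apply: measurable_funM => //; exact: measurable_abspow.
have telesc n x : (n <= N)%N -> cabs (osc a G (t n) x) <= cabs (osc a G (t 0%N) x) + \sum_(m < N) cabs (D m x).
  move=> nN; apply: (@le_trans _ _ (cabs (osc a G (t 0%N) x) + \sum_(m < n) cabs (D m x))).
    elim: n {nN} => [|n ih]; first by rewrite big_ord0 addr0.
    by rewrite DE big_ord_recr /= addrA; apply: le_trans (cabsD _ _) _; exact: lerD.
  rewrite lerD2l -!(big_mkord xpredT (fun m => cabs (D m x))).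
  rewrite (@big_cat_nat _ _ _ n _ N)//= lerDl; apply: sumr_ge0 => m _; exact: cabs_ge0.
have mass0 := hC a 1 (t 0%N) G ltr01 mG sG iG.
have massD m : mass_le (fun x => (w m)^-1 * cabs (D m x) ^+ 2) (4 * C * Q * d m).
  have [iH hH] := sq_int (mH m) (HG m) iG.
  have := mass_leZ (_ : 0 <= (w m)^-1) (hC a 1 0 (H m) ltr01 (mH m) (sH m) iH).
  rewrite invr_ge0 (ltW (w0 m)) => /(_ isT) h; apply: (mass_leW h).
  rewrite ler_pdivrMl//; apply: (@le_trans _ _ (C * ((2 * d m) ^+ 2 * Q))).
    by apply: ler_wpM2l => //; exact: ltW.
  rewrite (_ : C * _ = d m * (4 * C * Q * d m)); last by ring.
  apply: ler_wpM2r; first by rewrite !mulr_ge0// ltW.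
  by rewrite /w lerDl exprn_ge0// invr_ge0.
have massS := mass_leD (mass_leZ (ler0n _ 2) mass0)
  (mass_leZ (_ : 0 <= 2 * (t 0%N + 2)) (mass_le_sum N massD)).
apply: (mass_le_trans _ _ (massS _)).
- by apply: measurable_maxsq => n; apply: (@cmeas_osc_t _ a G (fun=> t n)).
- move=> x; rewrite maxsq_ge0 /=; apply: maxsq_le.
    apply: addr_ge0; first by rewrite mulr_ge0 ?sqr_ge0.
    apply: mulr_ge0; first by rewrite mulr_ge0// addr_ge0.
    by apply: sumr_ge0 => m _; rewrite mulr_ge0 ?sqr_ge0// invr_ge0 ltW.
  move=> n nN _; set S := \sum_(m < N) cabs (D m x).
  apply: (@le_trans _ _ ((cabs (osc a G (t 0%N) x) + S) ^+ 2)).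
    apply: lerXn2r; rewrite ?nnegrE ?cabs_ge0 ?telesc ?(ltnW nN)//.
    by rewrite addr_ge0 ?cabs_ge0//; apply: sumr_ge0 => m _; exact: cabs_ge0.
  have hw' : S ^+ 2 <= (t 0%N + 2) * \sum_(m < N) (w m)^-1 * cabs (D m x) ^+ 2.
    apply: (@weighted_sqr_sum _ (fun m => (w m)^-1) (fun m => cabs (D m x)) _ N _ sw) => m.
    by rewrite invr_gt0.
  by have := sqr_ge0 (cabs (osc a G (t 0%N) x) - S); rewrite sqrrB sqrrD; lra.
- by rewrite mulr_ge0// addr_ge0.
rewrite -mulr_sumr; set T := t 0%N in sd *; have T0 : 0 <= T by exact: t0.
have CQ : 0 <= C * Q by rewrite mulr_ge0// ltW.
apply: (@le_trans _ _ (2 * (C * Q) + 2 * (T + 2) * (4 * C * Q * T))).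
  rewrite lerD2l; apply: ler_wpM2l; first by rewrite mulr_ge0// addr_ge0.
  by apply: ler_wpM2l => //; rewrite -mulrA mulr_ge0.
rewrite (_ : 16 * C * (1 + T) ^+ 2 * Q = (16 + 32 * T + 16 * T ^+ 2) * (C * Q)); last by ring.
rewrite (_ : _ + _ = (2 + 16 * T + 8 * T ^+ 2) * (C * Q)); last by ring.
by apply: ler_wpM2r => //; have := sqr_ge0 T; lra.
Qed.

End maximal_bands.

Section counting_maximal.
Context {R : realType}.

(** The union bound: a maximum of nonnegative functions is at most their sum over the admissible
    indices. *)
Lemma mass_maxsq_count N (P : pred nat) (h : nat -> R -> R[i]) c : (forall n, cmeas (h n)) ->
  (forall n, mass_le (fun x => cabs (h n x) ^+ 2) c) ->
  mass_le (maxsq N P h) ((count P (iota 0 N))%:R * c).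
Proof.
move=> mh hc; elim: N => [|N ih]; first by rewrite mul0r; exact: mass_le0.
have iE : count P (iota 0 N.+1) = (count P (iota 0 N) + P N)%N.
  by rewrite -addn1 iotaD count_cat /= addn0 add0n.
rewrite iE natrD mulrDl.
apply: (mass_le_trans _ _ (mass_leD ih (_ : mass_le (fun x => if P N then cabs (h N x) ^+ 2 else 0) _)) (lexx _)).
- exact: (measurable_maxsq N.+1).
- move=> x; rewrite (maxsq_ge0 N.+1) /= ge_max lerDl lerDr maxsq_ge0.
  by rewrite andbT; case: ifP => // _; rewrite sqr_ge0.
- by case: (P N); rewrite ?mul1r ?mul0r; [exact: hc|exact: mass_le0].
Qed.

Lemma mass_maxsq_empty N (P : pred nat) (h : nat -> R -> R[i]) c : 0 <= c ->
  (forall n, ~~ P n) -> mass_le (maxsq N P h) c.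
Proof.
move=> c0 P0; have -> : maxsq N P h = fun=> 0.
  apply/funext => x; apply/eqP; rewrite eq_le maxsq_ge0 andbT.
  by apply: maxsq_le => // n _; rewrite (negbTE (P0 n)).
exact: mass_leW mass_le0 c0.
Qed.

End counting_maximal.

(** * Interaction of the frequency bands with the blocks of times *)

Section dyadic_times.
Context {R : realType}.
Variables (a Gam B tau A q : R) (t : nat -> R).
Hypotheses (a_gt0 : 0 < a) (a_neq1 : a != 1) (Gam_gt1 : 1 < Gam) (B_gt1 : 1 < B).
Hypotheses (aE : 2 `^ a = Gam * B ^+ 2) (tau_gt0 : 0 < tau) (A_ge0 : 0 <= A).
Hypotheses (t_ge0 : forall n, 0 <= t n) (t_lt : forall n, t n < tau).
Hypothesis cnt : forall j N,
  (count (fun n => tau * Gam^-1 ^+ j.+1 <= t n) (iota 0 N))%:R <= A * B ^+ j.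
Hypotheses (q_gt0 : 0 < q) (q_lt1 : q < 1) (qG : Gam^-1 <= q ^+ 2) (qB : B^-1 <= q).

Let Gam0 : 0 < Gam. Proof. exact: lt_trans ltr01 Gam_gt1. Qed.
Let B0 : 0 < B. Proof. exact: lt_trans ltr01 B_gt1. Qed.

(** Here [(Gam * B^2)^k] is [(2^k)^a], so a slow time moves the phase by a bounded amount at
    frequency [2^k]. The index [k] refers to the annulus [2^k <= |xi| <= 2^(k+1)], that is, to
    [piece g k.+1]. *)
Definition slow_time k : pred nat := fun n => t n * (Gam * B ^+ 2) ^+ k < 1.
Definition fast_time j k : pred nat := fun n =>
  [&& 1 <= t n * (Gam * B ^+ 2) ^+ k, tau * Gam^-1 ^+ j.+1 <= t n & t n < tau * Gam^-1 ^+ j].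

Let L_a k : (2 ^+ k) `^ a = (Gam * B ^+ 2) ^+ k.
Proof.
by rewrite -aE -powR_mulrn// -powRrM mulrC powRrM powR_mulrn// powR_ge0.
Qed.

(** The case [b L^a = 1] of the annulus estimate, so the factor [1 + sqrt (b L^a)] is just 2. *)
Lemma slow_time_mass : exists2 C, 0 < C & forall (G : R -> R[i]) k N, cmeas G ->
  (forall xi, cabs (G xi) != 0 -> 2 ^+ k <= `|xi| <= 2 * 2 ^+ k) ->
  (fun xi => cabs (G xi) ^+ 2) \is_int ->
  mass_le (maxsq N (slow_time k) (fun n => osc a G (t n))) (C * \int[mu]_xi (cabs (G xi) ^+ 2)).
Proof.
have [C C0 hC] := annulus_maximal a_gt0 a_neq1; exists (C * 2); first by rewrite mulr_gt0.
move=> G k N mG sG iG; set X := (Gam * B ^+ 2) ^+ k.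
have X0 : 0 < X by rewrite exprn_gt0// mulr_gt0// exprn_gt0.
split; [|exact: maxsq_ge0|].
  apply: measurable_maxsq => n; apply: (@cmeas_osc_t _ a G (fun=> t n)) => //.
  by apply: (@int_supported _ _ (2 * 2 ^+ k)) => // xi /sG/andP[].
have := hC (2 ^+ k) X^-1 G t N (slow_time k) _ _ _ mG sG iG.
rewrite L_a -/X mulVf ?gt_eqF// sqrtr1; apply; first by rewrite exprn_gt0.
  by rewrite invr_ge0 ltW.
by move=> n /ltW; rewrite t_ge0 -ler_pdivlMr// div1r.
Qed.

(** The factor [B^k] will be paid by the Sobolev weight, and [q] to the power [gap j k] is the decay
    away from the diagonal. It comes from [Gam^-1 <= q^2] in the kernel bound when [k <= j], and
    from [B^-1 <= q] in the counting bound when [j < k]. *)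
Lemma fast_time_mass : exists2 C, 0 < C & forall (G : R -> R[i]) j k N, cmeas G ->
  (forall xi, cabs (G xi) != 0 -> 2 ^+ k <= `|xi| <= 2 * 2 ^+ k) ->
  (fun xi => cabs (G xi) ^+ 2) \is_int ->
  mass_le (maxsq N (fast_time j k) (fun n => osc a G (t n)))
    (C * (B ^+ k * q ^+ gap j k * \int[mu]_xi (cabs (G xi) ^+ 2))).
Proof.
have [C1 C10 hC1] := annulus_maximal a_gt0 a_neq1.
have [C2 C20 hC2] := @osc_mass R.
pose C := C1 * (2 * Num.sqrt tau) + A * C2.
have C1p : 0 < C1 * (2 * Num.sqrt tau) by rewrite !mulr_gt0// sqrtr_gt0.
have C2p : 0 <= A * C2 by rewrite mulr_ge0// ltW.
exists C; first by rewrite ltr_pwDl.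
move=> G j k N mG sG iG; set X := (Gam * B ^+ 2) ^+ k; set Q := \int[mu]_xi _.
have Q0 : 0 <= Q by apply: Rintegral_ge0 => x _; exact: sqr_ge0.
have X0 : 0 < X by rewrite exprn_gt0// mulr_gt0// exprn_gt0.
have G0 n : 0 < Gam^-1 ^+ n by rewrite exprn_gt0// invr_gt0.
have BQ : 0 <= B ^+ k * q ^+ gap j k * Q.
  by apply: mulr_ge0 => //; apply: mulr_ge0; apply: exprn_ge0; exact: ltW.
have iG1 : (fun xi => cabs (G xi)) \is_int.
  by apply: (@int_supported _ _ (2 * 2 ^+ k)) => // xi /sG/andP[].
have mosc n : cmeas (osc a G (t n)) by apply: (@cmeas_osc_t _ a G (fun=> t n)).
have [kj|jk] := leqP k j.
  pose Y := tau * Gam^-1 ^+ j * X.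
  (* If [Y < 1] then every time of block [j] is slow for band [k], and nothing is left to estimate.
     Otherwise [1 <= sqrt Y], so the additive 1 of the annulus estimate is absorbed. *)
  have [Y1|Y1] := ltP Y 1.
    apply: mass_maxsq_empty; first by rewrite mulr_ge0// ltW// ltr_pwDl.
    move=> n; apply/negP => /and3P[h1 _ h2]; move: Y1; apply/negP; rewrite -leNgt.
    by apply: le_trans h1 _; rewrite /Y ler_pM2r// ltW.
  split; [exact: measurable_maxsq|exact: maxsq_ge0|].
  have := hC1 (2 ^+ k) (tau * Gam^-1 ^+ j) G t N (fast_time j k) _ _ _ mG sG iG.
  rewrite L_a -/X -/Y => h; apply: le_trans (h _ _ _) _.
  - by rewrite exprn_gt0.
  - by apply: mulr_ge0; exact: ltW.
  - by move=> n /and3P[_ _ /ltW]; rewrite t_ge0.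
  rewrite lee_fin -/Q.
  have YE : Y = tau * (B ^+ k) ^+ 2 * Gam^-1 ^+ (j - k).
    rewrite /Y /X -{1}(subnK kj) exprD exprMn exprAC.
    have key (p x y z w : R) : p * (x * y) * (z * w) = p * w * x * (y * z) by ring.
    by rewrite key -exprMn mulVf ?gt_eqF// expr1n mulr1.
  have sY : Num.sqrt Y <= Num.sqrt tau * (B ^+ k * q ^+ (j - k)).
    have Z0 : 0 <= B ^+ k * q ^+ (j - k) by apply: mulr_ge0; apply: exprn_ge0; exact: ltW.
    rewrite -[X in _ * X]ger0_norm// -sqrtr_sqr -sqrtrM ?(ltW tau_gt0)//.
    apply: ler_wsqrtr; rewrite YE -mulrA ler_pM2l// exprMn ler_pM2l; last by rewrite !exprn_gt0.
    rewrite exprAC; apply: lerXn2r; rewrite ?nnegrE ?exprn_ge0// ?invr_ge0 ltW//.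
  have s1 : 1 <= Num.sqrt Y by rewrite -sqrtr1; exact: ler_wsqrtr.
  rewrite mulrA; apply: ler_wpM2r => //.
  rewrite /gap (_ : (k - j)%N = 0%N) ?addn0; last by apply/eqP; rewrite subn_eq0.
  apply: (@le_trans _ _ (C1 * (2 * Num.sqrt tau) * (B ^+ k * q ^+ (j - k)))).
    rewrite -mulrA; apply: ler_wpM2l; first exact: ltW.
    by rewrite -mulrA; lra.
  by apply: ler_wpM2r; [apply: mulr_ge0; apply: exprn_ge0; exact: ltW|rewrite lerDl].
(* In the earlier blocks the kernel bound would be too large; the fixed-time bound is multiplied by
   the number of times instead. *)
have h n : mass_le (fun x => cabs (osc a G (t n) x) ^+ 2) (C2 * Q).
  by apply: (hC2 a (2 * 2 ^+ k)) => // xi /sG/andP[].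
apply: mass_leW (mass_maxsq_count N (fast_time j k) mosc h) _.
apply: (@le_trans _ _ (A * B ^+ j * (C2 * Q))).
  apply: ler_wpM2r; first by rewrite mulr_ge0// ltW.
  apply: le_trans (cnt j N); rewrite ler_nat; apply: sub_count => n /and3P[_ h2 _].
  exact: h2.
have gE : gap j k = (k - j)%N.
  by rewrite /gap (_ : (j - k)%N = 0%N)//; apply/eqP; rewrite subn_eq0 ltnW.
have Bj : B ^+ j <= B ^+ k * q ^+ gap j k.
  rewrite gE -{1}(subnKC (ltnW jk)) exprD -mulrA -exprMn ler_peMr ?exprn_ge0 ?(ltW B0)//.
  by apply: exprn_ege1; rewrite -(ler_pdivrMl _ _ B0) mulr1.
apply: (@le_trans _ _ (A * C2 * (B ^+ k * q ^+ gap j k * Q))).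
  rewrite (_ : A * B ^+ j * (C2 * Q) = A * C2 * (B ^+ j * Q)); last by ring.
  by apply: ler_wpM2l => //; apply: ler_wpM2r.
by apply: ler_wpM2r => //; rewrite lerDr ltW.
Qed.

(** The least [j] with [tau Gam^-j <= t n] is not 0 because [t n < tau]; its predecessor is the
    block sought. *)
Lemma fast_time_exists n : 0 < t n -> exists j,
  tau * Gam^-1 ^+ j.+1 <= t n /\ t n < tau * Gam^-1 ^+ j.
Proof.
move=> tn.
have ex : exists j, tau * Gam^-1 ^+ j <= t n.
  have : Gam^-1 ^+ j @[j --> \oo] --> (0 : R).
    by apply: cvg_expr; rewrite ger0_norm ?invr_ge0 ?(ltW Gam0)// invf_lt1.
  move=> /cvgr0_norm_le /(_ (t n / tau)); rewrite divr_gt0// => /(_ isT)[j _ /(_ j (leqnn j))].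
  rewrite ger0_norm ?exprn_ge0 ?invr_ge0 ?(ltW Gam0)// => h; exists j.
  by rewrite mulrC -ler_pdivlMr.
case: (ex_minnP ex) => -[|j] hj hmin.
  by move: hj; rewrite expr0 mulr1 leNgt t_lt.
by exists j; split => //; rewrite ltNge; apply/negP => /hmin; rewrite ltnn.
Qed.

Lemma fast_time_uniform N : exists J, forall n, (n < N)%N -> 0 < t n -> exists2 j, (j < J)%N &
  tau * Gam^-1 ^+ j.+1 <= t n /\ t n < tau * Gam^-1 ^+ j.
Proof.
elim: N => [|N [J hJ]]; first by exists 0%N.
have [/fast_time_exists[j hj]|tN] := ltP 0 (t N).
  exists (maxn J j.+1) => n; rewrite ltnS leq_eqVlt => /predU1P[->|nN] tn.
    by exists j => //; rewrite leq_maxr.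
  by have [j' j'J h] := hJ n nN tn; exists j' => //; rewrite leq_max j'J.
exists J => n; rewrite ltnS leq_eqVlt => /predU1P[->|nN] tn; last exact: hJ.
by move: tn; rewrite ltNge tN.
Qed.

Hypothesis t_decr : nonincreasing_seq t.
Variable s : R.
Hypotheses (s_gt0 : 0 < s) (BE : 4 `^ s = B).

(** At a given [x] and [n] each band is slow or fast. Weighted Cauchy-Schwarz over the bands reduces
    the square of the sum to maxima of single bands; the block of [t n], which varies with [n], is
    then replaced by the sum over all blocks. The constant is uniform in [K] and [N]. *)
Lemma partial_maximal : exists2 C, 0 < C & forall (g : R -> R[i]) K N, cmeas g ->
  (fun xi => bessel_weight s xi * cabs (g xi) ^+ 2) \is_int ->
  mass_le (maxsq N xpredT (fun n => partial g a (t n) K.+1))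
    (C * \int[mu]_xi (bessel_weight s xi * cabs (g xi) ^+ 2)).
Proof.
have [C0 C00 hC0] := low_maximal a_gt0.
have [C1 C10 hC1] := slow_time_mass.
have [C2 C20 hC2] := fast_time_mass.
(* The decay [q = r^2] is spent in two halves: one [r] pays for the Cauchy-Schwarz weights [r^-1] in
   [k], the other for the summation over [j]. *)
pose r := Num.sqrt q; have r0 : 0 < r by rewrite sqrtr_gt0.
have r1 : r < 1 by rewrite -sqrtr1 ltr_sqrt.
have rq : q = r * r by rewrite -expr2 sqr_sqrtr// ltW.
pose cB := (1 - B^-1)^-1; pose cr := 2 / (1 - r).
have cB0 : 0 < cB by rewrite invr_gt0 subr_gt0 invf_lt1.
have cr0 : 0 < cr by rewrite divr_gt0// subr_gt0.
pose T := 3 * (C0 * (1 + t 0%N) ^+ 2).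
have T0 : 0 < T.
  by do 2 apply: mulr_gt0 => //; apply: exprn_gt0; exact: ltr_pwDl.
pose D := T + 3 * cB * C1 + 3 * cr * (C2 * cr).
have cBC : 0 < 3 * cB * C1 by rewrite !mulr_gt0.
have crC : 0 < 3 * cr * (C2 * cr) by apply: mulr_gt0; exact: mulr_gt0.
exists (D * B); first by rewrite mulr_gt0// !addr_gt0.
move=> g K N mg ig; set E := \int[mu]_xi _.
pose Q k := \int[mu]_xi (cabs (piece g k xi) ^+ 2).
have Q0 k : 0 <= Q k by apply: Rintegral_ge0 => x _; exact: sqr_ge0.
have mp k : cmeas (piece g k) by exact: cmeas_piece.
have ip k : (fun xi => cabs (piece g k xi) ^+ 2) \is_int by exact: (piece_int2 mg s_gt0 ig).
(* Only the finitely many blocks meeting the first [N] times occur; the final bound is free of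
   [J]. *)
have [J hJ] := fast_time_uniform N.
pose u0 n x := osc a (piece g 0) (t n) x.
pose v k n x := osc a (piece g k.+1) (t n) x.
have mass0 : mass_le (maxsq N xpredT u0) (C0 * (1 + t 0%N) ^+ 2 * Q 0%N).
  by apply: hC0 => // xi h; have := piece_supp h; rewrite expr0.
have massS k : mass_le (fun x => B ^+ k * maxsq N (slow_time k) (v k) x) (B ^+ k * (C1 * Q k.+1)).
  apply: mass_leZ; first by rewrite exprn_ge0// ltW.
  by apply: hC1 => // xi; exact: piece_annulus.
have massF j k : mass_le (fun x => r^-1 ^+ gap j k * maxsq N (fast_time j k) (v k) x)
    (C2 * (B ^+ k * r ^+ gap j k * Q k.+1)).
  have rg : 0 <= r^-1 ^+ gap j k by rewrite exprn_ge0// invr_ge0 ltW.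
  apply: mass_leW (mass_leZ rg (hC2 _ j k N (mp k.+1) (@piece_annulus _ g k) (ip k.+1))) _.
  rewrite -/(Q k.+1) rq exprMn le_eqVlt; apply/orP; left; apply/eqP.
  have key (p c b x y : R) : p * (c * (b * (x * x) * y)) = (p * x) * (c * (b * x * y)) by ring.
  by rewrite key -exprMn mulVf ?gt_eqF// expr1n mul1r.
have ES : \sum_(k < K) B ^+ k * Q k.+1 <= B * E /\ Q 0%N <= B * E.
  have := band_energy mg s_gt0 ig K.+1; rewrite BE -/E big_ord_recl /= expr0 mul1r -/(Q 0%N) => h.
  have h1 : \sum_(k < K) B ^+ k * Q k.+1 <= \sum_(k < K) B ^+ fintype.bump 0 k * Q (fintype.bump 0 k).
    apply: ler_sum => k _; rewrite /fintype.bump leq0n add1n exprS; apply: ler_wpM2r => //.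
    by rewrite ler_peMl ?exprn_ge0// ltW.
  have h2 : 0 <= \sum_(k < K) B ^+ k * Q k.+1.
    by apply: sumr_ge0 => k _; apply: mulr_ge0 => //; rewrite exprn_ge0// ltW.
  have := Q0 0%N; rewrite /Q in h h1 h2 *; lra.
(* The pointwise majorant; each 3 comes from [(p + y + z)^2 <= 3 p^2 + 3 y^2 + 3 z^2], for the low,
   slow and fast parts. *)
pose F x := 3 * maxsq N xpredT u0 x + 3 * cB * \sum_(k < K) B ^+ k * maxsq N (slow_time k) (v k) x +
   3 * cr * \sum_(j < J) \sum_(k < K) r^-1 ^+ gap j k * maxsq N (fast_time j k) (v k) x.
have massT : mass_le F (3 * (C0 * (1 + t 0%N) ^+ 2 * Q 0%N) +
   3 * cB * \sum_(k < K) B ^+ k * (C1 * Q k.+1) +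
   3 * cr * \sum_(j < J) \sum_(k < K) C2 * (B ^+ k * r ^+ gap j k * Q k.+1)).
  apply: mass_leD; first apply: mass_leD; first exact: mass_leZ.
    by apply: (mass_leZ _ (mass_le_sum K massS)); apply: mulr_ge0 => //; exact: ltW.
  apply: (mass_leZ _ (mass_le_sum J (fun j => mass_le_sum K (massF j)))).
  by apply: mulr_ge0 => //; exact: ltW.
apply: (mass_le_trans _ _ massT).
- by apply: measurable_maxsq => n; exact: (cmeas_partial mg s_gt0 ig).
- move=> x; rewrite maxsq_ge0 /=.
  have sS0 : 0 <= \sum_(k < K) B ^+ k * maxsq N (slow_time k) (v k) x.
    by apply: sumr_ge0 => k _; rewrite mulr_ge0 ?maxsq_ge0// exprn_ge0// ltW.
  have sF0 j : 0 <= \sum_(k < K) r^-1 ^+ gap j k * maxsq N (fast_time j k) (v k) x.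
    by apply: sumr_ge0 => k _; rewrite mulr_ge0 ?maxsq_ge0// exprn_ge0// invr_ge0 ltW.
  have sF00 : 0 <= \sum_(j < J) \sum_(k < K) r^-1 ^+ gap j k * maxsq N (fast_time j k) (v k) x.
    by apply: sumr_ge0.
  apply: maxsq_le.
    rewrite /F; apply: addr_ge0; first apply: addr_ge0; first by rewrite mulr_ge0// maxsq_ge0.
      by apply: mulr_ge0 => //; rewrite mulr_ge0// ltW.
    by apply: mulr_ge0 => //; rewrite mulr_ge0// ltW.
  move=> n nN _.
  pose xs k := if slow_time k n then cabs (v k n x) else 0.
  pose xf k := if slow_time k n then 0 else cabs (v k n x).
  have split_le : cabs (partial g a (t n) K.+1 x) <=
      cabs (u0 n x) + \sum_(k < K) xs k + \sum_(k < K) xf k.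
    apply: le_trans (cabs_sum (fun k => osc a (piece g k) (t n) x) _) _.
    rewrite big_ord_recl -addrA lerD2l -big_split /=; apply: ler_sum => k _.
    by rewrite /xs /xf /fintype.bump leq0n add1n; case: ifP; rewrite ?addr0 ?add0r.
  have xs0 k : 0 <= xs k by rewrite /xs; case: ifP => // _; exact: cabs_ge0.
  have xf0 k : 0 <= xf k by rewrite /xf; case: ifP => // _; exact: cabs_ge0.
  have hs : (\sum_(k < K) xs k) ^+ 2 <= cB * \sum_(k < K) B ^+ k * maxsq N (slow_time k) (v k) x.
    apply: le_trans (@weighted_sqr_sum _ (fun k => B ^+ k) xs cB K _ _) _.
    - by move=> k; exact: exprn_gt0.
    - under eq_bigr do rewrite -exprVn; apply: geom_sum_le; first by rewrite invr_ge0 ltW.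
      by rewrite invf_lt1.
    apply: ler_wpM2l; first exact: ltW.
    apply: ler_sum => k _; apply: ler_wpM2l; first by rewrite exprn_ge0// ltW.
    rewrite /xs; case: ifP => h; last by rewrite expr0n maxsq_ge0.
    exact: (@le_maxsq _ N (slow_time k) (v k)).
  have hf : (\sum_(k < K) xf k) ^+ 2 <=
      cr * \sum_(j < J) \sum_(k < K) r^-1 ^+ gap j k * maxsq N (fast_time j k) (v k) x.
    (* A vanishing time belongs to no block, but it is slow for every band. *)
    have [tn|tn] := ltP 0 (t n); last first.
      have t0 : t n = 0 by apply/eqP; rewrite eq_le tn t_ge0.
      rewrite big1 ?expr0n/=; first by rewrite mulr_ge0// ltW.
      by move=> k _; rewrite /xf /slow_time t0 mul0r ltr01.
    have [j jJ [hj1 hj2]] := hJ n nN tn.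
    apply: le_trans (@weighted_sqr_sum _ (fun k => r^-1 ^+ gap j k) xf cr K _ _) _.
    - by move=> k; rewrite exprn_gt0// invr_gt0.
    - under eq_bigr do rewrite -exprVn invrK; exact: gap_sum_le.
    apply: ler_wpM2l; first exact: ltW.
    rewrite [X in _ <= X](bigD1 (Ordinal jJ))//=.
    apply: ler_wpDr; first by apply: sumr_ge0.
    apply: ler_sum => k _; apply: ler_wpM2l; first by rewrite exprn_ge0// invr_ge0 ltW.
    rewrite /xf; case: ifPn => h; first by rewrite expr0n maxsq_ge0.
    apply: (@le_maxsq _ N (fast_time j k) (v k)) => //.
    by rewrite /fast_time hj1 hj2 !andbT leNgt.
  have h0 : cabs (u0 n x) ^+ 2 <= maxsq N xpredT u0 x by exact: le_maxsq.
  rewrite /F; set p := cabs (u0 n x) in split_le h0; set y := \sum_(k < K) xs k in split_le hs.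
  set z := \sum_(k < K) xf k in split_le hf.
  have y0 : 0 <= y by exact: sumr_ge0.
  have z0 : 0 <= z by exact: sumr_ge0.
  have p0 : 0 <= p by exact: cabs_ge0.
  apply: (@le_trans _ _ ((p + y + z) ^+ 2)).
    by apply: lerXn2r => //; rewrite nnegrE ?cabs_ge0// !addr_ge0.
  apply: (@le_trans _ _ (3 * p ^+ 2 + 3 * y ^+ 2 + 3 * z ^+ 2)).
    have := sqr_ge0 (p - y); have := sqr_ge0 (p - z); have := sqr_ge0 (y - z).
    by rewrite !sqrrB !sqrrD mulrDl; lra.
  by rewrite -!(mulrA 3); apply: lerD; [apply: lerD|]; apply: ler_wpM2l.
have [ES1 ES2] := ES.
have e1 : \sum_(k < K) B ^+ k * (C1 * Q k.+1) <= C1 * (B * E).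
  under eq_bigr do rewrite mulrCA; rewrite -mulr_sumr; apply: ler_wpM2l => //; exact: ltW.
have e2 : \sum_(j < J) \sum_(k < K) C2 * (B ^+ k * r ^+ gap j k * Q k.+1) <= C2 * cr * (B * E).
  rewrite exchange_big /=.
  apply: (@le_trans _ _ (\sum_(k < K) C2 * cr * (B ^+ k * Q k.+1))); last first.
    by rewrite -mulr_sumr; apply: ler_wpM2l => //; rewrite mulr_ge0// ltW.
  apply: ler_sum => k _.
  rewrite (eq_bigr (fun j : 'I_J => C2 * (B ^+ k * Q k.+1) * r ^+ gap k j)); last first.
    by move=> j _; rewrite (gapC k); ring.
  rewrite -mulr_sumr [X in _ <= X]mulrAC; apply: ler_wpM2l; last exact: gap_sum_le.
  apply: mulr_ge0; first exact: ltW.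
  by apply: mulr_ge0 => //; rewrite exprn_ge0// ltW.
have DE : D * B * E = T * (B * E) + 3 * cB * (C1 * (B * E)) + 3 * cr * (C2 * cr * (B * E)).
  by rewrite /D; ring.
rewrite DE; apply: lerD; first apply: lerD.
- rewrite mulrA; apply: ler_wpM2l => //; exact: ltW.
- by apply: ler_wpM2l => //; apply: mulr_ge0 => //; exact: ltW.
- by apply: ler_wpM2l => //; apply: mulr_ge0 => //; exact: ltW.
Qed.

End dyadic_times.

(** * From (a) to (b), and from (b) to (c) *)

Section counting_sets.
Context {R : realType}.

Let count_le (t : nat -> R) b N :
  (((count (fun n => (b < `|t n|)%R) (iota 0 N))%:R : R)%:E <=
    @counting _ R [set n : nat | (b < `|t n|)%R])%E.
Proof.
rewrite /counting; case: asboolP => [fS|_]; last by rewrite leey.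
rewrite lee_fin ler_nat -size_filter; apply: uniq_leq_size.
  by apply: filter_uniq; exact: iota_uniq.
by move=> n; rewrite mem_filter => /andP[h _]; rewrite in_fset_set// inE.
Qed.

Lemma weak_ell_count (r : R) (t : nat -> R) : weak_ell r t ->
  exists A : R, forall b N, 0 < b -> b `^ r * (count (fun n => b < `|t n|) (iota 0 N))%:R <= A.
Proof.
pose E := ereal_sup [set (b `^ r)%:E * @counting _ R [set n : nat | (b < `|t n|)%R]
  | b in [set b : R | (0 < b)%R]]%E.
move=> w; have {}w : (E < +oo)%E by exact: w.
exists (fine E) => b N b0.
have le : ((b `^ r)%:E * @counting _ R [set n : nat | (b < `|t n|)%R] <= E)%E.
  by apply: ereal_sup_ubound; exists b.
have le' : ((b `^ r * (count (fun n => b < `|t n|) (iota 0 N))%:R)%:E <= E)%E.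
  by apply: le_trans le; rewrite EFinM; apply: lee_wpmul2l; rewrite ?lee_fin ?powR_ge0.
rewrite -lee_fin fineK// ge0_fin_numE//; apply: le_trans le'.
by rewrite lee_fin mulr_ge0// powR_ge0.
Qed.

(** The counting measure of an infinite set is infinite, so the bound on initial segments is used
    together with the eventual smallness of the times, which makes each level set finite. *)
Lemma count_weak_ell (r A : R) (t : nat -> R) :
  (forall b, 0 < b -> exists N, forall n, (N <= n)%N -> `|t n| <= b) ->
  (forall b N, 0 < b -> b `^ r * (count (fun n => b < `|t n|) (iota 0 N))%:R <= A) ->
  weak_ell r t.
Proof.
move=> tb hA; apply: (@le_lt_trans _ _ A%:E); last by rewrite ltry.
apply: ge_ereal_sup => _ [b b0 <-]; have [N hN] := tb b b0.
have inN n : b < `|t n| -> (n < N)%N.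
  by move=> h; rewrite ltnNge; apply/negP => /hN; rewrite leNgt h.
have fS : finite_set [set n : nat | b < `|t n|].
  by apply: (sub_finite_set _ (finite_II N)) => n /inN.
rewrite /counting asboolT// -EFinM lee_fin; apply: le_trans (hA b N b0).
apply: ler_wpM2l; first exact: powR_ge0.
rewrite ler_nat -size_filter; apply: uniq_leq_size; first exact: finmap.fset_uniq.
move=> n; rewrite in_fset_set// inE /= => h.
by rewrite mem_filter h mem_iota add0n inN.
Qed.

End counting_sets.

(** * From finite maxima to the maximal function *)

Section maximal_function.
Context {R : realType}.

Lemma cvg_maxsq N (P : pred nat) (h_ : nat -> nat -> R -> R[i]) (h : nat -> R -> R[i]) x :
  (forall n, ccvg (fun K => h_ K n x) (h n x)) ->
  maxsq N P (h_ K) x @[K --> \oo] --> maxsq N P h x.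
Proof.
move=> cv; elim: N => [|N ih] /=; first exact: cvg_cst.
have cN : (if P N then cabs (h_ K N x) ^+ 2 else 0) @[K --> \oo] --> (if P N then cabs (h N x) ^+ 2 else 0).
  by case: (P N); [exact: ccvg_cabs2|exact: cvg_cst].
rewrite maxr_absE; under eq_cvg do rewrite maxr_absE.
apply: cvgM; last exact: cvg_cst.
by apply: cvgD; [exact: cvgD|apply: cvg_norm; exact: cvgB].
Qed.

Definition sup_abs (m : nat -> R -> R[i]) (x : R) : \bar R :=
  ereal_sup (range (fun n => (cabs (m n x))%:E)).

Lemma sup_abs_ge0 m x : (0 <= sup_abs m x)%E.
Proof.
by apply: (@le_trans _ _ (cabs (m 0%N x))%:E); [rewrite lee_fin cabs_ge0|apply: ereal_sup_ubound; exists 0%N].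
Qed.

Lemma measurable_sup_abs m : (forall n, cmeas (m n)) -> measurable_fun setT (sup_abs m).
Proof.
move=> mm; have me n : measurable_fun setT (fun x => (cabs (m n x))%:E).
  by apply/measurable_EFinP; exact: measurable_cabs.
have := measurable_fun_esups me 0%N; congr measurable_fun; apply/funext => x.
rewrite /esups /sup_abs /sdrop /=; congr ereal_sup; apply/seteqP.
by split => y [n _ <-]; exists n.
Qed.

Lemma sup_abs_sq m x c : (forall N, maxsq N xpredT m x <= c) -> (sup_abs m x `^ 2 <= c%:E)%E.
Proof.
move=> h; have c0 : 0 <= c by exact: h 0%N.
have le : (sup_abs m x <= (Num.sqrt c)%:E)%E.
  apply: ge_ereal_sup => _ [n _ <-]; rewrite lee_fin.
  rewrite -[leLHS]ger0_norm ?cabs_ge0// -sqrtr_sqr; apply: ler_wsqrtr.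
  by apply: le_trans (h n.+1); exact: (@le_maxsq _ n.+1 xpredT m x n).
apply: (@le_trans _ _ ((Num.sqrt c)%:E `^ 2)%E).
  by apply: gt0_ler_poweR => //; rewrite in_itv /= leey ?sup_abs_ge0 ?lee_fin ?sqrtr_ge0.
by rewrite poweR_EFin powR_mulrn ?sqrtr_ge0// sqr_sqrtr.
Qed.

(** Monotone convergence in the number of times. The pointwise limit of the finite maxima dominates
    the square of the supremum, also where the latter is infinite. *)
Lemma sup_abs_L2 m (c : R) : (forall n, cmeas (m n)) ->
  (forall N, mass_le (maxsq N xpredT m) c) -> (\int[mu]_x (`|sup_abs m x| `^ 2) <= c%:E)%E.
Proof.
move=> mm hc; pose F N x := (maxsq N xpredT m x)%:E.
have mF N : measurable_fun setT (F N) by have [h _ _] := hc N; exact/measurable_EFinP.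
have F0 N x : (0 <= F N x)%E by rewrite lee_fin maxsq_ge0.
have Fnd x : {homo (fun N => F N x) : n k / (n <= k)%N >-> (n <= k)%E}.
  apply/nondecreasing_seqP => N; by rewrite /F lee_fin /= le_max lexx.
have cF x := ereal_nondecreasing_cvgn (Fnd x).
have le x : (`|sup_abs m x| `^ 2 <= limn (fun N => F N x))%E.
  rewrite gee0_abs ?sup_abs_ge0// (cvg_lim _ (cF x))//.
  set S := ereal_sup _; have FS N : (F N x <= S)%E by apply: ereal_sup_ubound; exists N.
  move: FS; case: S => [S| |] FS; [|by rewrite leey|by have := FS 0%N].
  by apply: sup_abs_sq => N; have := FS N; rewrite lee_fin.
have ml : measurable_fun setT (fun x => limn (fun N => F N x)).
  have := measurable_fun_limn_esup mF; congr measurable_fun; apply/funext => x.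
  by have /cvg_limn_einf_sup[_ ->] := cF x; rewrite (cvg_lim _ (cF x)).
apply: (@le_trans _ _ (\int[mu]_x limn (fun N => F N x))%E).
  apply: ge0_le_int => //.
  - by move=> x; exact: poweR_ge0.
  - have := measurable_sup_abs mm => ms.
    apply: (measurableT_comp (measurable_poweR 2)).
    by apply: measurableT_comp.
have -> : (\int[mu]_x limn (fun N => F N x) = limn (fun N => \int[mu]_x F N x))%E.
  exact: (@monotone_convergence _ _ R (@lebesgue_measure R) setT measurableT F mF
    (fun N x _ => F0 N x) (fun x _ => Fnd x)).
apply: lime_le.
  apply: ereal_nondecreasing_is_cvgn => n k nk.
  by apply: ge0_le_int => // x; exact: Fnd.
by apply: nearW => N; have [_ _] := hc N.
Qed.

End maximal_function.

Section sobolev_functions.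
Context {R : realType}.
Variables (a s : R) (f : functional R).
Hypotheses (s_gt0 : 0 < s) (sf : sobolev s f).

(** The square of the Sobolev norm as a real number, faithful because membership in the space makes
    the integral finite. *)
Definition energy : R := \int[mu]_xi (bessel_weight s xi * cabs (fhat f xi) ^+ 2).

Lemma cmeas_fhat : cmeas (fhat f).
Proof. by have [_ [ex _]] := sf; have [] := xgetPex (fun=> 0) ex. Qed.

Let w0 xi : 0 <= bessel_weight s xi * cabs (fhat f xi) ^+ 2.
Proof. by apply: mulr_ge0; [exact: powR_ge0|exact: sqr_ge0]. Qed.

Let sqrt_sq (I : \bar R) : (0 <= I)%E -> ((I `^ 2^-1) `^ 2 = I)%E.
Proof. by move=> I0; rewrite -poweRrM mulVf ?pnatr_eq0// poweRe1. Qed.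

Let I : \bar R := (\int[mu]_xi (bessel_weight s xi * cabs (fhat f xi) ^+ 2)%:E)%E.

Let I0 : (0 <= I)%E.
Proof. by apply: integral_ge0 => xi _; rewrite lee_fin. Qed.

Lemma fhat_int : (fun xi => bessel_weight s xi * cabs (fhat f xi) ^+ 2) \is_int.
Proof.
apply: intP.
  apply: measurable_funM; last by apply: measurable_funX; apply: measurable_cabs; exact: cmeas_fhat.
  apply: (measurableT_comp (measurable_powR s)); apply: measurable_funD => //.
  by apply: measurable_funX; exact: normr_measurable.
have -> : (\int[mu]_x `|bessel_weight s x * cabs (fhat f x) ^+ 2|%:E = I)%E.
  by apply: eq_integral => x _; rewrite ger0_norm.
rewrite -(sqrt_sq I0); apply: poweR_lty; by have [_ []] := sf.
Qed.

Lemma energy_ge0 : 0 <= energy.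
Proof. by apply: Rintegral_ge0 => x _; exact: w0. Qed.

Lemma sobolev_normE : sobolev_norm s f = (Num.sqrt energy)%:E.
Proof.
rewrite -[LHS]/(I `^ 2^-1)%E /I -Rint_EFin; last exact: fhat_int.
by rewrite poweR_EFin powR12_sqrt// energy_ge0.
Qed.

(** The explicit density built from the bands shows that the chosen one is not the junk value, and
    uniqueness transfers the convergence to it. *)
Lemma mean_limit (t : R) : cmeas (schrodinger_mean a f t) /\
  {ae mu, forall x, ccvg (fun K => ((2 * pi)^-1)%:C%C * partial (fhat f) a t K x)
    (schrodinger_mean a f t x)}.
Proof.
have [h [dh ch]] := band_representation cmeas_fhat s_gt0 fhat_int a t.
have dm := xgetPex (fun=> 0) (ex_intro _ h dh : exists g, [set g | is_density _ g] g).
split; first by have [] := dm.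
by apply: aeS (aeI ch (density_unique dh dm)) => x [cx e]; move: cx; rewrite e.
Qed.

End sobolev_functions.

Section strong_from_partial.
Context {R : realType}.
Variables (a s : R) (t : nat -> R) (C : R).
Hypotheses (s_gt0 : 0 < s).
Hypothesis hC : forall (g : R -> R[i]) K N, cmeas g ->
  (fun xi => bessel_weight s xi * cabs (g xi) ^+ 2) \is_int ->
  mass_le (maxsq N xpredT (fun n => partial g a (t n) K.+1))
    (C * \int[mu]_xi (bessel_weight s xi * cabs (g xi) ^+ 2)).

(** For each [N] the limit in the number of bands is taken first, by Fatou. The countably many
    exceptional null sets, one per time, have a null union. The factor [1 / (2 pi)] is at most 1 and
    is dropped. *)
Lemma maximal_L2 (f : functional R) : sobolev s f ->
  (\int[mu]_x (`|schrodinger_maximal a t f x| `^ 2) <= (C * energy s f)%:E)%E.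
Proof.
move=> sf; have mg := cmeas_fhat sf; have ig := fhat_int sf.
pose m n := schrodinger_mean a f (t n).
have mm n : cmeas (m n) by have [] := mean_limit a s_gt0 sf (t n).
pose c : R[i] := ((2 * pi)^-1)%:C%C.
have c1 : cabs c <= 1.
  rewrite cabsR ger0_norm ?invr_ge0 ?mulr_ge0 ?pi_ge0// invf_le1 ?mulr_gt0 ?pi_gt0//.
  by have := @pi_ge2 R; lra.
pose h K n x := c * partial (fhat f) a (t n) K.+1 x.
apply: (sup_abs_L2 mm) => N.
have mh K n : cmeas (h K n).
  by apply: cmeasM; [exact: cmeas_cst|exact: (cmeas_partial mg s_gt0 ig)].
have massh K : mass_le (maxsq N xpredT (h K)) (C * energy s f).
  apply: (mass_le_trans _ _ (hC K N mg ig) (lexx _)); first exact: measurable_maxsq.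
  move=> x; rewrite maxsq_ge0 /=; apply: maxsq_le; first exact: maxsq_ge0.
  move=> n nN _.
  have := @le_maxsq _ N xpredT (fun n => partial (fhat f) a (t n) K.+1) x n nN isT.
  apply: le_trans; rewrite /h cabsM exprMn; apply: ler_piMl; first exact: sqr_ge0.
  by rewrite exprn_ile1// cabs_ge0.
have cv : {ae mu, forall x, maxsq N xpredT (h K) x @[K --> \oo] --> maxsq N xpredT m x}.
  have al : {ae mu, forall x n, ccvg (fun K => c * partial (fhat f) a (t n) K x) (m n x)}.
    by apply: ae_foralln => n; have [] := mean_limit a s_gt0 sf (t n).
  apply: aeS al => x cx; apply: cvg_maxsq => n; have [cr ci] := cx n.
  split; [rewrite (cvg_shiftS (fun K => complex.Re (c * partial (fhat f) a (t n) K x)))|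
          rewrite (cvg_shiftS (fun K => complex.Im (c * partial (fhat f) a (t n) K x)))].
    exact: cr.
  exact: ci.
split; [exact: measurable_maxsq|exact: maxsq_ge0|].
apply: (Rfatou _ _ _ _ cv) => [K| |K x|x|K].
- exact: measurable_maxsq.
- exact: measurable_maxsq.
- exact: maxsq_ge0.
- exact: maxsq_ge0.
- by have [_ _] := massh K.
Qed.

End strong_from_partial.

Section strong_and_weak.
Context {R : realType}.
Variables (a s : R) (t : nat -> R).
Hypothesis s_gt0 : 0 < s.

Let I (f : functional R) : \bar R := (\int[mu]_x (`|schrodinger_maximal a t f x| `^ 2))%E.

Let I0 f : (0 <= I f)%E.
Proof. by apply: integral_ge0 => x _; exact: poweR_ge0. Qed.

Lemma strong_type (C : R) : 0 <= C ->
  (forall f, sobolev s f -> (I f <= (C * energy s f)%:E)%E) ->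
  forall f : functional R, sobolev s f ->
    (Lnorm (@lebesgue_measure R) 2%:E (schrodinger_maximal a t f)
       <= (Num.sqrt C)%:E * sobolev_norm s f)%E.
Proof.
move=> C0 hC f sf; rewrite (sobolev_normE sf) -EFinM -sqrtrM// unlock -/(I f).
rewrite -powR12_sqrt ?mulr_ge0 ?energy_ge0// -poweR_EFin.
apply: gt0_ler_poweR; rewrite ?invr_ge0// ?in_itv /= ?leey ?I0//; last exact: hC.
by rewrite lee_fin mulr_ge0// energy_ge0.
Qed.

(** Chebyshev's inequality for the square of the maximal function. *)
Lemma weak_type (C1 : R) :
  (forall f : functional R, sobolev s f ->
    (Lnorm (@lebesgue_measure R) 2%:E (schrodinger_maximal a t f)
       <= C1%:E * sobolev_norm s f)%E) ->
  forall f : functional R, sobolev s f -> forall alpha : R, 0 < alpha ->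
    (@lebesgue_measure R
       [set x : R | (alpha%:E < schrodinger_maximal a t f x)%E]
       <= ((C1 ^+ 2) * alpha ^- 2)%:E * sobolev_norm s f `^ 2)%E.
Proof.
move=> hC f sf alpha alpha0; set F := schrodinger_maximal a t f.
have mF : measurable_fun setT F.
  apply: (@measurable_sup_abs _ (fun n => schrodinger_mean a f (t n))) => n.
  by have [] := mean_limit a s_gt0 sf (t n).
have F0 x : (0 <= F x)%E by exact: (sup_abs_ge0 (fun n => schrodinger_mean a f (t n))).
set D := [set x | _].
have mD : measurable D.
  by have := emeasurable_fun_o_infty measurableT mF alpha%:E; rewrite setTI.
have IE : (I f <= (C1 ^+ 2 * energy s f)%:E)%E.
  have := hC f sf; rewrite (sobolev_normE sf) -EFinM => le.
  have -> : (I f = Lnorm (@lebesgue_measure R) 2%:E F `^ 2)%E by rewrite poweR_Lnorm.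
  have L0 : (0 <= Lnorm (@lebesgue_measure R) 2%:E F)%E by exact: Lnorm_ge0.
  have P0 : 0 <= C1 * Num.sqrt (energy s f) by rewrite -lee_fin (le_trans L0).
  apply: (@le_trans _ _ ((C1 * Num.sqrt (energy s f))%:E `^ 2)%E).
    by apply: gt0_ler_poweR => //; rewrite in_itv /= leey ?L0 ?lee_fin ?P0.
  by rewrite poweR_EFin powR_mulrn// exprMn sqr_sqrtr// energy_ge0.
have mark : ((alpha ^+ 2)%:E * mu D <= I f)%E.
  have -> : ((alpha ^+ 2)%:E * mu D = \int[mu]_(x in D) (alpha ^+ 2)%:E)%E.
    by rewrite integral_cst.
  have mp : measurable_fun setT (fun x => `|F x| `^ 2)%E.
    by apply: (measurableT_comp (measurable_poweR 2)); exact: measurableT_comp.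
  apply: (@le_trans _ _ (\int[mu]_(x in D) (`|F x| `^ 2))%E).
    apply: ge0_le_integral => //.
    - by move=> x _; rewrite lee_fin sqr_ge0.
    - exact: measurable_funTS.
    - move=> x Dx; rewrite gee0_abs// -(powR_mulrn _ (ltW alpha0)) -poweR_EFin.
      by apply: gt0_ler_poweR => //; rewrite ?in_itv /= ?leey ?lee_fin ?(ltW alpha0) ?F0// ltW.
  by apply: ge0_subset_integral => // x _; exact: poweR_ge0.
rewrite (sobolev_normE sf) poweR_EFin powR_mulrn ?sqrtr_ge0// sqr_sqrtr ?energy_ge0//.
have a2 : 0 < alpha ^+ 2 by exact: exprn_gt0.
have -> : (mu D = (alpha ^- 2)%:E * ((alpha ^+ 2)%:E * mu D))%E.
  by rewrite muleA -EFinM mulVf ?gt_eqF// mul1e.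
rewrite -EFinM (mulrC _ (alpha ^- 2)) -mulrA EFinM; apply: lee_wpmul2l.
  by rewrite lee_fin invr_ge0 ltW.
exact: le_trans mark IE.
Qed.

End strong_and_weak.

Section sufficiency.
Context {R : realType}.
Variables (a s : R) (t : nat -> R).
Hypotheses (a_gt0 : 0 < a) (a_neq1 : a != 1) (s_gt0 : 0 < s) (s_lt : s < a / 4).
Hypotheses (t_decr : nonincreasing_seq t) (t_lim : t n @[n --> \oo] --> (0 : R)).

Lemma decr_to0_ge0 n : 0 <= t n.
Proof.
have := nonincreasing_cvgn_ge t_decr (cvgP _ t_lim) n.
by rewrite (cvg_lim _ t_lim).
Qed.

Lemma weak_ell_sufficient : weak_ell (2 * s / (a - 4 * s)) t ->
  exists2 C : R, 0 <= C & forall f : functional R, sobolev s f ->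
    (\int[mu]_x (`|schrodinger_maximal a t f x| `^ 2) <= (C * energy s f)%:E)%E.
Proof.
set r := 2 * s / _ => /weak_ell_count[A0 hA0].
pose gam := a - 4 * s; have gam0 : 0 < gam by rewrite /gam subr_gt0 mulrC -ltr_pdivlMr.
have gr : gam * r = 2 * s by rewrite /r -/gam mulrC divfK// gt_eqF.
pose Gam : R := 2 `^ gam; pose B : R := 4 `^ s.
have pow_gt1 (x y : R) : 1 < x -> 0 < y -> 1 < x `^ y.
  move=> x1 y0; rewrite /powR (gt_eqF (lt_trans ltr01 x1)) expR_gt1 mulr_gt0// ln_gt0//.
have G1 : 1 < Gam by apply: pow_gt1 => //; rewrite ltr1n.
have B1 : 1 < B by apply: pow_gt1 => //; rewrite ltr1n.
have G0 : 0 < Gam by exact: lt_trans G1.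
have Gi : Gam^-1 < 1 by rewrite invf_lt1.
have B0 : 0 < B by exact: lt_trans B1.
have Bi : B^-1 < 1 by rewrite invf_lt1.
have p2 : (2 : R) != 0 by [].
have BE : B = 2 `^ (2 * s).
  by rewrite powRrM (_ : 2 `^ 2 = 4)// powR_mulrn//; ring.
have aE : 2 `^ a = Gam * B ^+ 2.
  rewrite BE -powR_mulrn ?powR_ge0// -powRrM /Gam -powRD; last by rewrite p2 implybT.
  by congr (_ `^ _); rewrite /gam; ring.
(* The blocks require all times to be strictly below [tau]. *)
pose tau := t 0%N + 1; have tau0 : 0 < tau by rewrite ltr_wpDl// decr_to0_ge0.
have t_lt n : t n < tau by rewrite (@le_lt_trans _ _ (t 0%N))// ?t_decr// ltrDl.
pose A := Num.max A0 0 / tau `^ r * B ^+ 2.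
have tr0 : 0 < tau `^ r by exact: powR_gt0.
have M0 : 0 <= Num.max A0 0 by rewrite le_max lexx orbT.
have A_ge0 : 0 <= A by rewrite /A mulr_ge0 ?exprn_ge0 ?divr_ge0 ?powR_ge0// ltW.
(* The relation [gam * r = 2 s] turns the weak [l^r] bound at height [Gam^-n] into growth by the
   factor [B] per block. *)
have GB n : (Gam^-1 ^+ n) `^ r = B^-1 ^+ n.
  have powX (x : R) : 0 <= x -> (x ^+ n) `^ r = (x `^ r) ^+ n.
    by move=> x0; rewrite -powR_mulrn// -powRrM mulrC powRrM powR_mulrn// powR_ge0.
  have e1 : Gam^-1 = 2 `^ (- gam) by rewrite powRN.
  have e2 : B^-1 = 2 `^ (- (2 * s)) by rewrite BE powRN.
  rewrite powX; last by rewrite invr_ge0 ltW.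
  by rewrite e1 e2 -powRrM mulNr gr.
have cnt j N : (count (fun n => tau * Gam^-1 ^+ j.+1 <= t n) (iota 0 N))%:R <= A * B ^+ j.
  (* One more power of [Gam^-1] than in the block: the weak [l^r] count has a strict inequality, the
     block count a large one. The total exponent [j + 2] explains the [B^2] in [A]. *)
  pose b := tau * Gam^-1 ^+ j.+2.
  have gi n : 0 < Gam^-1 ^+ n by rewrite exprn_gt0// invr_gt0.
  have b0 : 0 < b by rewrite mulr_gt0.
  have bE : b `^ r = tau `^ r * B^-1 ^+ j.+2 by rewrite /b powRM ?GB// ltW.
  apply: (@le_trans _ _ (count (fun n => b < `|t n|) (iota 0 N))%:R).
    rewrite ler_nat; apply: sub_count => n /=; rewrite ger0_norm ?decr_to0_ge0//.
    apply: lt_le_trans; rewrite /b ltr_pM2l// (exprS _ j.+1) gtr_pMl//.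
  have := hA0 b N b0; rewrite bE => h.
  have h' : tau `^ r * B^-1 ^+ j.+2 * (count (fun n => b < `|t n|) (iota 0 N))%:R <= Num.max A0 0.
    by apply: le_trans h _; rewrite le_max lexx.
  have c0 : 0 < tau `^ r * B^-1 ^+ j.+2 by rewrite mulr_gt0// exprn_gt0// invr_gt0.
  rewrite -(ler_pM2l c0); apply: le_trans h' _.
  rewrite le_eqVlt; apply/orP; left; apply/eqP.
  rewrite /A !exprS exprVn; field; rewrite ?gt_eqF ?exprn_gt0//.
(* The slower of the two decay rates, [Gam^(-1/2)] from the kernel and [B^-1] from the counting. *)
pose q := Num.max (Num.sqrt Gam^-1) B^-1.
have q0 : 0 < q by rewrite lt_max invr_gt0 B0 orbT.
have q1 : q < 1.
  by rewrite gt_max Bi andbT -[X in _ < X]sqrtr1 (ltr_sqrt _ ltr01).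
have qB : B^-1 <= q by rewrite le_max lexx orbT.
have qG : Gam^-1 <= q ^+ 2.
  rewrite -[leLHS]sqr_sqrtr ?invr_ge0 ?(ltW G0)//.
  apply: lerXn2r; rewrite ?nnegrE ?sqrtr_ge0 ?(ltW q0)//.
  by rewrite le_max lexx.
have [C C0 hC] := partial_maximal a_gt0 a_neq1 G1 B1 aE tau0 A_ge0 decr_to0_ge0 t_lt cnt q0 q1 qG qB
  t_decr s_gt0 erefl.
exists C; first exact: ltW.
by move=> f sf; apply: (maximal_L2 s_gt0 _ sf) => g K N; exact: hC.
Qed.

End sufficiency.

(** * Wave packets *)

Section affine_substitution.
Context {R : realType}.

Let ge0_affine (g : R -> R) (L y : R) : 0 < L -> continuous g -> (forall v, 0 <= g v) -> g \is_int ->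
  (fun x => L * g (L * (x - y))) \is_int /\
  \int[mu]_x (L * g (L * (x - y))) = \int[mu]_x g x.
Proof.
move=> L0 cg g0 ig; have E := integral_affine y L0 cg g0.
have i2 : (fun x => L * g (L * (x - y))) \is_int.
  apply: intP.
    apply: measurable_funM => //; apply: (measurableT_comp (continuous_measurable_fun cg)).
    by apply: measurable_funM => //; exact: measurable_funB.
  have -> : (\int[mu]_x `|L * g (L * (x - y))|%:E = \int[mu]_x (g x)%:E)%E.
    by rewrite -E; apply: eq_integral => x _; rewrite ger0_norm// mulr_ge0// ltW.
  by rewrite -Rint_EFin// ltry.
by split => //; apply: EFin_inj; rewrite !Rint_EFin.
Qed.

(** Positive and negative parts inherit continuity and integrability, so the substitution for
    nonnegative functions applies to both. *)
Lemma Rint_affine (f : R -> R) (L y : R) : 0 < L -> continuous f -> f \is_int ->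
  \int[mu]_x (L * f (L * (x - y))) = \int[mu]_x f x.
Proof.
move=> L0 cf iF; pose p x := (`|f x| + f x) / 2; pose m x := (`|f x| - f x) / 2.
have cn : continuous (fun x => `|f x|) by move=> x; apply: cvg_norm; exact: cf.
have cp : continuous p.
  by move=> x; apply: cvgM; [apply: cvgD; [exact: cn|exact: cf]|exact: cvg_cst].
have cm : continuous m.
  by move=> x; apply: cvgM; [apply: cvgB; [exact: cn|exact: cf]|exact: cvg_cst].
have iN : (fun x => `|f x|) \is_int by exact: integrable_norm.
have ip : p \is_int by apply: intZr; exact: intD.
have im : m \is_int by apply: intZr; exact: intB.
have p0 x : 0 <= p x by have := ler_norm (- f x); rewrite normrN /p; lra.
have m0 x : 0 <= m x by have := ler_norm (f x); rewrite /m; lra.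
have fE x : f x = p x - m x by rewrite /p /m; field.
have [i1 e1] := ge0_affine y L0 cp p0 ip; have [i2 e2] := ge0_affine y L0 cm m0 im.
under eq_Rintegral do rewrite fE mulrBr.
under [RHS]eq_Rintegral do rewrite fE.
by rewrite !RintegralB// e1 e2.
Qed.

Definition ccontinuous (f : R -> R[i]) : Prop :=
  continuous (fun x => complex.Re (f x)) /\ continuous (fun x => complex.Im (f x)).

Lemma ccontinuous_cmeas f : ccontinuous f -> cmeas f.
Proof. by move=> [cr ci]; split; exact: continuous_measurable_fun. Qed.

Lemma ccontinuousM f g : ccontinuous f -> ccontinuous g -> ccontinuous (fun x => f x * g x).
Proof.
move=> [fr fi] [gr gi]; split => x.
  under eq_fun do rewrite ReM.
  by apply: cvgB; apply: cvgM; [exact: fr|exact: gr|exact: fi|exact: gi].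
under eq_fun do rewrite ImM.
by apply: cvgD; apply: cvgM; [exact: fr|exact: gi|exact: fi|exact: gr].
Qed.

Lemma ccontinuousR (f : R -> R) : continuous f -> ccontinuous (fun x => (f x)%:C%C).
Proof. by move=> cf; split => // x; exact: cvg_cst. Qed.

Lemma ccontinuous_cis (f : R -> R) : continuous f -> ccontinuous (fun x => cis (f x)).
Proof.
move=> cf; split => x.
  by apply: (@continuous_comp _ _ _ f cos); [exact: cf|exact: continuous_cos].
by apply: (@continuous_comp _ _ _ f sin); [exact: cf|exact: continuous_sin].
Qed.

Lemma ccontinuous_ccvg f (u : nat -> R) l : ccontinuous f -> u m @[m --> \oo] --> l ->
  ccvg (fun m => f (u m)) (f l).
Proof.
move=> [cr ci] ul; split.
  by apply: (@continuous_cvg _ _ _ _ _ _ (fun x => complex.Re (f x))) => //; exact: cr.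
by apply: (@continuous_cvg _ _ _ _ _ _ (fun x => complex.Im (f x))) => //; exact: ci.
Qed.

Lemma cintegral_affine (f : R -> R[i]) (L y : R) : 0 < L -> ccontinuous f -> cintegrable f ->
  cintegral (fun x => L%:C%C * f (L * (x - y))) = cintegral f.
Proof.
move=> L0 [cr ci] [ir ii]; apply: cplx_ext.
  rewrite [RHS](esym (Rint_affine y L0 cr ir)); apply: eq_Rintegral => x _.
  by rewrite /re_part ReM /= mul0r subr0.
rewrite [RHS](esym (Rint_affine y L0 ci ii)); apply: eq_Rintegral => x _.
by rewrite /im_part ImM /= mul0r addr0.
Qed.

End affine_substitution.

(** * The profile of the wave packets and its Fourier transform *)

Section profile.
Context {R : realType}.

(** The squared positive part of [u (1 - u)], with [(p + |p|) / 2] as positive part: it agrees with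
    [bump 0 1] on [[0, 1]] and vanishes elsewhere, in one formula from which continuity on the whole
    line is immediate. *)
Definition chi (u : R) : R := ((u * (1 - u) + `|u * (1 - u)|) / 2) ^+ 2.

Lemma chi_ge0 u : 0 <= chi u. Proof. exact: sqr_ge0. Qed.

Lemma chi_in u : 0 <= u <= 1 -> chi u = bump 0 1 u.
Proof.
move=> /andP[u0 u1]; rewrite /chi /bump ger0_norm; last by rewrite mulr_ge0// subr_ge0.
by rewrite subr0; congr (_ ^+ 2); field.
Qed.

Lemma chi_out u : ~~ (0 <= u <= 1) -> chi u = 0.
Proof.
rewrite negb_and -!ltNge => h; rewrite /chi ler0_norm ?subrr ?mul0r ?expr0n//.
case/orP: h => h.
  by rewrite nmulr_rle0// subr_ge0 (le_trans (ltW h)).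
by rewrite pmulr_rle0 ?subr_le0 ?(ltW h)// (lt_trans ltr01).
Qed.

Lemma chi_le1 u : chi u <= 1.
Proof.
have [h|/chi_out->//] := boolP (0 <= u <= 1); rewrite chi_in//.
case/andP: h => u0 u1; rewrite /bump subr0; apply: exprn_ile1; first by rewrite mulr_ge0// subr_ge0.
by have := sqr_ge0 (u - 2^-1); rewrite sqrrB; lra.
Qed.

Lemma continuous_chi : continuous chi.
Proof.
have cp : continuous (fun u : R => u * (1 - u)).
  by move=> u; apply: cvgM; [exact: cvg_id|apply: cvgB; [exact: cvg_cst|exact: cvg_id]].
have cb : continuous (fun u : R => (u * (1 - u) + `|u * (1 - u)|) / 2).
  move=> u; apply: cvgM; last exact: cvg_cst.
  by apply: cvgD; [exact: cp|apply: cvg_norm; exact: cp].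
by move=> u; rewrite /chi; under eq_fun do rewrite expr2; apply: cvgM; exact: cb.
Qed.

Lemma measurable_chi : measurable_fun setT chi.
Proof. exact: continuous_measurable_fun continuous_chi. Qed.

Lemma chi_patch : chi = bump 0 1 \_ `[0, 1].
Proof.
apply/funext => u; rewrite patchE; case: ifPn => h.
  by apply: chi_in; move: h; rewrite inE /= in_itv.
by apply: chi_out; apply: contra h => h; rewrite inE /= in_itv.
Qed.

Lemma int_chi : chi \is_int.
Proof. by rewrite chi_patch; apply: int_patch => x _; exact: continuous_bump. Qed.

Definition chat (v : R) : R[i] := cintegral (fun u => (chi u)%:C%C * cis (v * u)).

Lemma cabs_chat_le : exists2 C, 0 < C & forall v, cabs (chat v) <= C * (oneDsqr v)^-1.
Proof.
have [C C0 hC] := @linear_kernel R 0 1 ltr01; exists (2 * C); first exact: mulr_gt0.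
move=> v; rewrite -mulrA; apply: cabs_osc_le; [exact: int_chi|exact: measurable_funM|].
move=> th; apply: le_trans (hC v th); rewrite le_eqVlt; apply/orP; left; apply/eqP.
congr (`|_|); rewrite [RHS]Rintegral_mkcond; apply: eq_Rintegral => u _.
by rewrite chi_patch !patchE; case: ifP; rewrite ?mul0r.
Qed.

Lemma cabs_chi u : cabs ((chi u)%:C%C : R[i]) = chi u.
Proof. by rewrite cabsR ger0_norm// chi_ge0. Qed.

Lemma cmeas_chi : cmeas (fun u : R => (chi u)%:C%C).
Proof. exact: cmeasR measurable_chi. Qed.

Let int_cchi : (fun u : R => cabs ((chi u)%:C%C : R[i])) \is_int.
Proof. by under eq_fun do rewrite cabs_chi; exact: int_chi. Qed.

Lemma ccontinuous_chat : ccontinuous chat.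
Proof.
set I0 := \int[mu]_u chi u.
have lip v w : cabs (chat v - chat w) <= 2 * I0 * `|v - w|.
  have ic z : cintegrable (fun u : R => (chi u)%:C%C * cis (z * u)).
    by apply: cintegrable_osc; [exact: cmeas_chi|exact: int_cchi|exact: measurable_funM].
  have E : chat v - chat w = cintegral (fun u => (chi u)%:C%C * (cis (v * u) - cis (w * u))).
    rewrite (_ : - chat w = -1 * chat w); last by rewrite mulN1r.
    rewrite -cintegralZ// -cintegralD//; last first.
      apply: (@cintegrable_le _ _ (fun u => cabs ((chi u)%:C%C : R[i]))); last exact: int_cchi.
        by apply: cmeasM; [exact: cmeas_cst|exact: cintegrable_cmeas].
      by move=> u; rewrite mulN1r cabsN cabsM cis_abs mulr1.
    by apply: eq_cintegral => u; ring.
  have mk : cmeas (fun u : R => (chi u)%:C%C * (cis (v * u) - cis (w * u))).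
    apply: cmeasM; first exact: cmeas_chi.
    by apply: cmeasD; [|apply: cmeasN]; apply: cmeas_cis; exact: measurable_funM.
  have bd u : cabs ((chi u)%:C%C * (cis (v * u) - cis (w * u))) <= 2 * `|v - w| * chi u.
    rewrite cabsM cabs_chi mulrC; have [h|/chi_out->] := boolP (0 <= u <= 1); last by rewrite !mulr0.
    apply: ler_wpM2r; first exact: chi_ge0.
    apply: le_trans (cis_lip _ _) _; rewrite -mulrBl normrM mulrA ler_piMr ?mulr_ge0//.
    by case/andP: h => u0 u1; rewrite ger0_norm.
  have id : (fun u => 2 * `|v - w| * chi u) \is_int by apply: intZ; exact: int_chi.
  rewrite E; apply: le_trans (le_cabs_cintegral (cintegrable_le mk bd id)) _.
  apply: (@le_trans _ _ (\int[mu]_u (2 * `|v - w| * chi u))).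
    apply: le_Rintegral => //; exact: cintegrable_cabs (cintegrable_le mk bd id).
  by rewrite RintegralZl//; [rewrite -/I0 mulrAC|exact: int_chi].
have cont (p : R[i] -> R) : (forall z w : R[i], `|p z - p w| <= cabs (z - w)) -> continuous (p \o chat).
  move=> hp v; apply/cvgrPdist_lt => e e0.
  have I00 : 0 <= I0 by apply: Rintegral_ge0 => u _; exact: chi_ge0.
  have D0 : 0 < 2 * I0 + 1 by rewrite ltr_wpDl// mulr_ge0.
  near=> w; apply: le_lt_trans (hp _ _) _; apply: le_lt_trans (lip _ _) _.
  apply: (@le_lt_trans _ _ ((2 * I0 + 1) * `|v - w|)); first by rewrite ler_wpM2r// lerDl.
  rewrite mulrC -ltr_pdivlMr//; near: w.
  by apply: cvgr_dist_lt; [exact: cvg_id|exact: divr_gt0].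
split.
  by apply: (cont (@complex.Re R)) => z w; have := Re_cabs (z - w); rewrite ReD ReN.
by apply: (cont (@complex.Im R)) => z w; have := Im_cabs (z - w); rewrite ImD ImN.
Unshelve. all: by end_near. Qed.

End profile.

Section lower_bounds.
Context {R : realType}.

Lemma Rint_lower (f : R -> R) (a b c : R) : a < b -> 0 <= c -> f \is_int ->
  (forall x, 0 <= f x) -> (forall x, a <= x <= b -> c <= f x) ->
  c * (b - a) <= \int[mu]_x f x.
Proof.
move=> ab c0 iF f0 fc; rewrite -(Rint_cst c ab) Rintegral_mkcond; apply: le_Rintegral => //.
  by apply: (@int_patch _ (fun=> c)); exact: cont_on_cst.
move=> x _; rewrite patchE; case: ifPn => // h; apply: fc.
by move: h; rewrite inE /= in_itv.
Qed.

(** If the phase stays within 1/2 of a constant on the support there is no cancellation: after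
    removing the constant, [cos d >= 1 - |d| >= 1/2]. *)
Lemma phase_lower (G th : R -> R) (th0 : R) : G \is_int -> (forall u, 0 <= G u) ->
  measurable_fun setT th -> (forall u, G u != 0 -> `|th u - th0| <= 2^-1) ->
  2^-1 * \int[mu]_u G u <= cabs (cintegral (fun u => (G u)%:C%C * cis (th u))).
Proof.
move=> iG G0 mth hth.
have mG : cmeas (fun u => (G u)%:C%C) by apply: cmeasR; exact: int_meas.
have iG' : (fun u => cabs ((G u)%:C%C)) \is_int.
  by under eq_fun do rewrite cabsR ger0_norm//.
have ic : cintegrable (fun u => (G u)%:C%C * cis (th u)) by exact: cintegrable_osc.
have -> : cabs (cintegral (fun u => (G u)%:C%C * cis (th u))) =
    cabs (cintegral (fun u => (G u)%:C%C * cis (th u - th0))).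
  rewrite -[LHS]mul1r -(cis_abs (- th0)) -cabsM -cintegralZ//; congr cabs.
  by apply: eq_cintegral => u; rewrite mulrCA -cisD addrC.
apply: le_trans (le_trans (ler_norm _) (Re_cabs _)).
rewrite -RintegralZl//; apply: le_Rintegral => //; first exact: intZ.
  have [] // : cintegrable (fun u => (G u)%:C%C * cis (th u - th0)).
  by apply: cintegrable_osc => //; exact: measurable_funB.
move=> u _; rewrite /re_part ReM /= mul0r subr0 mulrC.
have [->|Gu] := eqVneq (G u) 0; first by rewrite !mul0r.
apply: ler_wpM2l => //; have h := hth u Gu; set d := th u - th0 in h *.
have : `|cos d - 1| <= `|d|.
  rewrite -cos0; have [d0|d0] := leP 0 d.
    by have [_] := sin_cos_lip d0; rewrite subr0 (ger0_norm d0).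
  by have [_] := sin_cos_lip (ltW d0); rewrite sub0r (ltr0_norm d0) distrC.
by move=> h2; have := ler_norm (1 - cos d); rewrite distrC; lra.
Qed.

End lower_bounds.

Section inversion.
Context {R : realType}.

Lemma ler_sqr_ge0 (p q : R) : 0 <= p -> p <= q -> p ^+ 2 <= q ^+ 2.
Proof. by move=> p0 pq; apply: lerXn2r => //; rewrite nnegrE// (le_trans p0). Qed.

Definition chi_mass : R := \int[mu]_u chi u.

Lemma chi_mass_gt0 : 0 < chi_mass.
Proof.
(* On [[1/4, 3/4]] one has [u (1 - u) >= 3/16 >= 1/10], and [chi] is its square. *)
apply: (@lt_le_trans _ _ (100^-1 * (3/4 - 1/4))); first by lra.
apply: Rint_lower; [lra|by rewrite invr_ge0|exact: int_chi|exact: chi_ge0|].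
move=> u /andP[u1 u2]; rewrite chi_in; last by apply/andP; split; lra.
rewrite /bump subr0; have h : 10^-1 <= u * (1 - u).
  have := mulr_ge0 (_ : 0 <= u - 1/4) (_ : 0 <= 3/4 - u).
  by rewrite !subr_ge0 => /(_ u1 u2); lra.
have := ler_pM _ _ h h; rewrite -expr2 => /(_ _ _) h2.
apply: le_trans (h2 _ _); [by rewrite le_eqVlt; apply/orP; left; apply/eqP; field|lra|lra].
Qed.

Let X : R -> R[i] := chat.
Let cX : ccontinuous X. Proof. exact: ccontinuous_chat. Qed.
Let mX : cmeas X. Proof. exact: ccontinuous_cmeas cX. Qed.

Lemma chat_int : (fun v : R => cabs (chat v)) \is_int /\ (fun v : R => cabs (chat v) ^+ 2) \is_int.
Proof.
by have [C _ hC] := @cabs_chat_le R; have [_ i1 i2] := decay_int mX hC.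
Qed.

Let iX : (fun v => cabs (X v)) \is_int. Proof. by have [] := chat_int. Qed.

Lemma chat_lower v : `|v| <= 2^-1 -> 2^-1 * chi_mass <= cabs (chat v).
Proof.
move=> v2; apply: (@phase_lower _ chi (fun u => v * u) 0).
- exact: int_chi.
- exact: chi_ge0.
- exact: measurable_funM.
move=> u h; have : 0 <= u <= 1 by apply: contraNT h => /chi_out ->.
move=> /andP[u0 u1]; rewrite subr0 normrM (ger0_norm u0).
by apply: le_trans v2; rewrite ler_piMr.
Qed.

Let cont_lin (p q : R) : continuous (fun x : R => p * x + q).
Proof.
move=> x; apply: cvgD; last exact: cvg_cst.
by apply: cvgM; [exact: cvg_cst|exact: cvg_id].
Qed.

(** A compactly supported regularisation that tends to the constant [chi (1/2)] as [N] grows. The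
    shift by 1/2 places the limit inside the support, where [chi] is nonzero. *)
Let weight (N x : R) : R := chi (N^-1 * x + 2^-1).

Let cweight N : continuous (weight N).
Proof.
by move=> x; apply: (@continuous_comp _ _ _ (fun x => N^-1 * x + 2^-1) chi);
  [exact: cont_lin|exact: continuous_chi].
Qed.

Let ic_chi (th : R -> R) : measurable_fun setT th -> cintegrable (fun u => (chi u)%:C%C * cis (th u)).
Proof.
move=> mth; apply: cintegrable_osc => //; first exact: cmeas_chi.
by under eq_fun do rewrite cabs_chi; exact: int_chi.
Qed.

Let weight_kernel (N z : R) : 0 < N ->
  cintegral (fun x => (weight N x)%:C%C * cis (x * z)) =
  N%:C%C * (cis (- (N * z / 2)) * X (N * z)).
Proof.
move=> N0; pose f u := N%:C%C * ((chi u)%:C%C * cis (N * (u - 2^-1) * z)).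
have cf : ccontinuous f.
  apply: ccontinuousM; first by apply: ccontinuousR => x; exact: cvg_cst.
  apply: ccontinuousM; first exact: ccontinuousR continuous_chi.
  apply: ccontinuous_cis => u; apply: cvgM; last exact: cvg_cst.
  by apply: cvgM; [exact: cvg_cst|apply: cvgB; [exact: cvg_id|exact: cvg_cst]].
have mth : measurable_fun setT (fun u : R => N * (u - 2^-1) * z).
  by apply: measurable_funM => //; apply: measurable_funM => //; exact: measurable_funB.
have ifc : cintegrable f.
  apply: (@cintegrable_le _ _ (fun u => N * chi u)).
  - exact: ccontinuous_cmeas.
  - by move=> u; rewrite /f !cabsM cis_abs mulr1 cabs_chi cabsR gtr0_norm.
  - by apply: intZ; exact: int_chi.
transitivity (cintegral (fun x => (N^-1)%:C%C * f (N^-1 * (x - - (N / 2))))).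
  apply: eq_cintegral => x; rewrite /f mulrA -(rmorphM (real_complex R)) mulVf ?gt_eqF// mul1r.
  rewrite /weight; have -> : N^-1 * (x - - (N / 2)) = N^-1 * x + 2^-1 by field; rewrite gt_eqF.
  by congr (_ * cis _); field; rewrite gt_eqF.
rewrite cintegral_affine ?invr_gt0// /f cintegralZ; last exact: ic_chi.
congr (_ * _); rewrite /X /chat -cintegralZ; last by apply: ic_chi; exact: measurable_funM.
by apply: eq_cintegral => u; rewrite mulrCA -cisD; congr (_ * cis _); field.
Qed.

Let int_weight N : 0 < N -> weight N \is_int.
Proof.
move=> N0; have E := @integral_affine _ chi N^-1 (- (N / 2)) _ continuous_chi chi_ge0.
rewrite invr_gt0 N0 in E; have {}E := E isT.
have h : (fun x => N^-1 * weight N x) \is_int.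
  apply: intP; first by apply: measurable_funM => //; exact: continuous_measurable_fun.
  have -> : (\int[mu]_x `|N^-1 * weight N x|%:E = \int[mu]_x (chi x)%:E)%E.
    rewrite -E; apply: eq_integral => x _; rewrite ger0_norm; last first.
      by rewrite mulr_ge0 ?invr_ge0 ?(ltW N0) ?chi_ge0.
    congr ((_ * chi _)%:E); field; rewrite gt_eqF//.
  by rewrite -Rint_EFin ?ltry//; exact: int_chi.
have := intZ N h; under eq_fun do rewrite mulrA divff ?gt_eqF// mul1r.
by [].
Qed.

(** The multiplication formula: Fubini moves the transform from [chi] to the weight, whose transform
    is a concentrated multiple of [chat]; then [xi = v / N + y] is substituted. *)
Let pairing (N y : R) : 0 < N ->
  cintegral (fun x => X x * (weight N x)%:C%C * cis (- (y * x))) =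
  cintegral (fun v => (chi (N^-1 * v + y))%:C%C * (cis (- (v / 2)) * X v)).
Proof.
move=> N0.
have mw : measurable_fun setT (weight N) by exact: continuous_measurable_fun.
pose F (p : R * R) := (weight N p.1)%:C%C * cis (- (y * p.1)) * ((chi p.2)%:C%C * cis (p.1 * p.2)).
have mF : cmeas F.
  apply: cmeasM; apply: cmeasM.
  - by apply: cmeasR; apply: (measurableT_comp mw); exact: measurable_fst.
  - apply: cmeas_cis; apply: measurable_funN; apply: measurable_funM => //; exact: measurable_fst.
  - by apply: cmeasR; apply: (measurableT_comp measurable_chi); exact: measurable_snd.
  - by apply: cmeas_cis; apply: measurable_funM; [exact: measurable_fst|exact: measurable_snd].
have bF x xi : cabs (F (x, xi)) <= weight N x * chi xi.
  rewrite /F !cabsM !cis_abs !mulr1 !cabsR !ger0_norm ?chi_ge0//.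
transitivity (cintegral (fun x => cintegral (fun xi => F (x, xi)))).
  apply: eq_cintegral => x; rewrite /X /chat -mulrA mulrC -cintegralZ//.
  by apply: ic_chi; exact: measurable_funM.
rewrite (cfubini mF (int_weight N0) int_chi bF).
pose f v := (chi (N^-1 * v + y))%:C%C * (cis (- (v / 2)) * X v).
rewrite -/f -(@cintegral_affine _ f N y N0).
- apply: eq_cintegral => xi.
  transitivity ((chi xi)%:C%C * cintegral (fun x => (weight N x)%:C%C * cis (x * (xi - y)))).
    rewrite -cintegralZ; last first.
      apply: cintegrable_osc; last exact: measurable_funM.
        by apply: cmeasR; exact: continuous_measurable_fun.
      by under eq_fun do rewrite cabsR ger0_norm ?chi_ge0//; exact: int_weight.
    apply: eq_cintegral => x; rewrite /F /=.
    rewrite (_ : x * (xi - y) = - (y * x) + x * xi); last by ring.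
    by rewrite cisD; move: (cis _) (cis _) => p q; ring.
  rewrite weight_kernel// /f mulrCA; congr (_ * (_%:C%C * _)).
  by congr chi; field; rewrite gt_eqF.
- apply: ccontinuousM.
    apply: ccontinuousR => v; apply: (@continuous_comp _ _ _ (fun v => N^-1 * v + y) chi);
      [exact: cont_lin|exact: continuous_chi].
  apply: ccontinuousM => //; apply: ccontinuous_cis => v; apply: cvgN.
  by apply: cvgM; [exact: cvg_id|exact: cvg_cst].
- apply: (@cintegrable_le _ _ (fun v => cabs (X v))) => //.
    apply: cmeasM; last first.
      by apply: cmeasM => //; apply: cmeas_cis; apply: measurable_funN; exact: measurable_funM.
    apply: cmeasR; apply: (measurableT_comp measurable_chi).
    by apply: continuous_measurable_fun; exact: cont_lin.
  by move=> v; rewrite !cabsM cis_abs mul1r cabs_chi ler_piMl ?cabs_ge0// chi_le1.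
Qed.

Let k0 : R[i] := cintegral (fun v => cis (- (v / 2)) * X v).

Let mk0 : cmeas (fun v : R => cis (- (v / 2)) * X v).
Proof. by apply: cmeasM => //; apply: cmeas_cis; apply: measurable_funN; exact: measurable_funM. Qed.

Let cvg_dil (l x : R) : (m.+1%:R : R)^-1 * x + l @[m --> \oo] --> l.
Proof.
rewrite -[X in _ --> X]add0r -[X in _ --> X + _](mul0r x).
apply: cvgD; last exact: cvg_cst.
by apply: cvgM; [exact: cvg_harmonic|exact: cvg_cst].
Qed.

(** The limit of [pairing]: on the left the weight tends to [chi (1/2)], on the right
    [chi (v / N + y)] tends to [chi y]. Both sides are dominated by the integrable [|chat|]. *)
Let inversion y : (chi 2^-1)%:C%C * cintegral (fun v => X v * cis (- (y * v))) = (chi y)%:C%C * k0.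
Proof.
have N0 m : 0 < m.+1%:R :> R by [].
have my : cmeas (fun v : R => cis (- (y * v))).
  by apply: cmeas_cis; apply: measurable_funN; exact: measurable_funM.
have l1 : ccvg (fun m => cintegral (fun x => X x * (weight m.+1%:R x)%:C%C * cis (- (y * x))))
    (cintegral (fun x => X x * (chi 2^-1)%:C%C * cis (- (y * x)))).
  apply: (cdominated_convergence _ _ _ iX _).2.
  - move=> m; apply: cmeasM => //; apply: cmeasM => //; apply: cmeasR.
    exact: continuous_measurable_fun.
  - by apply: cmeasM => //; apply: cmeasM => //; exact: cmeas_cst.
  - apply: aeW => x; apply: ccvgM; last exact: ccvg_cst.
    apply: ccvgM; first exact: ccvg_cst.
    apply: (@ccontinuous_ccvg _ (fun u => (chi u)%:C%C) (fun m => m.+1%:R^-1 * x + 2^-1)).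
      exact: ccontinuousR continuous_chi.
    exact: cvg_dil.
  - by apply: aeW => x m; rewrite !cabsM cis_abs mulr1 cabs_chi ler_piMr ?cabs_ge0// chi_le1.
have l2 : ccvg (fun m => cintegral (fun v => (chi ((m.+1%:R)^-1 * v + y))%:C%C * (cis (- (v / 2)) * X v)))
    (cintegral (fun v => (chi y)%:C%C * (cis (- (v / 2)) * X v))).
  apply: (cdominated_convergence _ _ _ iX _).2.
  - move=> m; apply: cmeasM => //; apply: cmeasR; apply: (measurableT_comp measurable_chi).
    by apply: continuous_measurable_fun; exact: cont_lin.
  - by apply: cmeasM => //; exact: cmeas_cst.
  - apply: aeW => x; apply: ccvgM; last exact: ccvg_cst.
    apply: (@ccontinuous_ccvg _ (fun u => (chi u)%:C%C) (fun m => m.+1%:R^-1 * x + y)).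
      exact: ccontinuousR continuous_chi.
    exact: cvg_dil.
  - by apply: aeW => x m; rewrite !cabsM cis_abs mul1r cabs_chi ler_piMl ?cabs_ge0// chi_le1.
have E : (fun m => cintegral (fun x => X x * (weight m.+1%:R x)%:C%C * cis (- (y * x)))) =
    fun m => cintegral (fun v => (chi ((m.+1%:R)^-1 * v + y))%:C%C * (cis (- (v / 2)) * X v)).
  by apply/funext => m; exact: pairing.
rewrite E in l1; rewrite -cintegralZ; last first.
  by apply: cintegrable_osc => //; apply: measurable_funN; exact: measurable_funM.
rewrite /k0 -cintegralZ; last first.
  apply: (cintegrable_le mk0 _ iX) => v.
  by rewrite cabsM cis_abs mul1r.
rewrite -(ccvg_unique l1 l2); apply: eq_cintegral => v.
by rewrite mulrCA mulrA.
Qed.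

(* The inversion formula is needed only up to a nonzero constant.  The constant is the
   integral of an unevaluated kernel; it is nonzero because pairing the formula with
   [chi] gives [kap * int chi^2 = int |chat|^2 > 0]. *)
Lemma chat_inversion : exists2 kap : R[i], kap != 0 & forall y,
  cintegral (fun v => chat v * cis (- (y * v))) = kap * (chi y)%:C%C.
Proof.
have c2 : chi (2^-1 : R) != 0.
  rewrite chi_in; last by apply/andP; split; lra.
  rewrite /bump expf_neq0// gt_eqF// subr0; lra.
have cc2 : ((chi (2^-1 : R))%:C%C : R[i]) != 0 by rewrite fmorph_eq0.
pose kap : R[i] := ((chi 2^-1)%:C%C)^-1 * k0.
have inv y : cintegral (fun v => chat v * cis (- (y * v))) = kap * (chi y)%:C%C.
  by rewrite /kap -mulrA (mulrC k0) -inversion mulKf.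
exists kap => //; apply/eqP => kap0.
pose F (p : R * R) := (chi p.1)%:C%C * cis (- (p.1 * p.2)) * X p.2.
have mF : cmeas F.
  apply: cmeasM; last by apply: cmeas_comp => //; exact: measurable_snd.
  apply: cmeasM; first by apply: cmeasR; apply: (measurableT_comp measurable_chi); exact: measurable_fst.
  by apply: cmeas_cis; apply: measurable_funN; apply: measurable_funM; [exact: measurable_fst|exact: measurable_snd].
have bF y v : cabs (F (y, v)) <= chi y * cabs (X v).
  by rewrite /F !cabsM cis_abs mulr1 cabs_chi.
have fub := cfubini mF int_chi iX bF.
have lhs : cintegral (fun y => cintegral (fun v => F (y, v))) = 0.
  rewrite (@eq_cintegral _ _ (fun=> 0)); last first.
    move=> y; rewrite (@eq_cintegral _ _ (fun v => (chi y)%:C%C * (X v * cis (- (y * v))))).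
      rewrite cintegralZ; first by rewrite /X (inv y) kap0 mul0r mulr0.
      by apply: cintegrable_osc; [exact: mX|exact: iX|apply: measurable_funN; exact: measurable_funM].
    by move=> v; rewrite /F /= -mulrA (mulrC (cis _)).
  by rewrite /cintegral /re_part /im_part /= /Rintegral integral0.
have cj (y w : R) : conjc ((chi y)%:C%C * cis w) = (chi y)%:C%C * cis (- w).
  apply: cplx_ext; first by rewrite ReJ !ReM /= cosN !mul0r.
  by rewrite ImJ !ImM /= sinN; ring.
have rhs : cintegral (fun v => cintegral (fun y => F (y, v))) = cintegral (fun v => ((cabs (X v) ^+ 2)%:C)%C).
  apply: eq_cintegral => v; rewrite -mulJ mulrC {2}/X /chat -cintegralJ; last first.
    by apply: ic_chi; exact: measurable_funM.
  rewrite -cintegralZ; last first.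
    by under eq_fun do rewrite cj; apply: ic_chi; apply: measurable_funN; exact: measurable_funM.
  by apply: eq_cintegral => y; rewrite cj /F /= mulrC (mulrC v).
have zero : \int[mu]_v (cabs (X v) ^+ 2) = 0.
  exact: (congr1 (@complex.Re R) (etrans (esym rhs) (etrans (esym fub) lhs))).
have [_ iX2] := chat_int.
pose c := (2^-1 * chi_mass) ^+ 2.
have c0 : 0 < c by apply: exprn_gt0; rewrite mulr_gt0 ?invr_gt0 ?chi_mass_gt0.
suff : 0 < \int[mu]_v (cabs (X v) ^+ 2) by rewrite zero ltxx.
apply: (@lt_le_trans _ _ (c * (2^-1 - 0))).
  by apply: mulr_gt0 => //; rewrite subr0 invr_gt0.
apply: (Rint_lower _ (ltW c0) iX2); [by rewrite invr_gt0|by move=> x; exact: sqr_ge0|].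
move=> x /andP[x0 x2].
have h : 2^-1 * chi_mass <= cabs (X x) by apply: chat_lower; rewrite ger0_norm.
have m0 : 0 <= 2^-1 * chi_mass by apply: mulr_ge0; [rewrite invr_ge0|exact: ltW chi_mass_gt0].
exact: ler_sqr_ge0 m0 h.
Qed.

End inversion.

Section power_taylor.
Context {R : realType}.

(** By homogeneity it suffices to expand [w^a] at 1 for [w = 1 + d / lam] in [[1, 2]], where [step1]
    and [step2] integrate the second derivative twice. The constant is thus independent of [lam]. *)
Lemma powR_taylor (a : R) : 0 < a -> exists2 K, 0 < K & forall lam d : R, 0 < lam -> 0 <= d <= lam ->
  `|(lam + d) `^ a - lam `^ a - a * lam `^ (a - 1) * d| <= K * lam `^ (a - 2) * d ^+ 2.
Proof.
move=> a0.
have h12 : (1 : R) < 2 by rewrite ltr1n.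
have [m m0 hm] := powR_between ltr01 h12 (a - 2).
have dpow (p u : R) : 1 <= u -> is_derive u 1 (fun v : R => v `^ p) (p * u `^ (p - 1)).
  by move=> u1; apply: is_derive1_powR; exact: lt_le_trans u1.
have cpow (p w : R) : cont_on (fun v : R => v `^ p) 1 w.
  by move=> u /andP[u1 _]; exact: is_derive_cont (dpow p u u1).
pose K := a * (`|a - 1| * m) + 1.
have K1 : 0 <= a * (`|a - 1| * m) by rewrite !mulr_ge0// ltW.
exists K; first by rewrite ltr_wpDl.
have step1 w : 1 <= w <= 2 -> `|w `^ (a - 1) - 1| <= `|a - 1| * m * (w - 1).
  move=> /andP[]; rewrite le_eqVlt => /predU1P[<- _|w1 w2].
    by rewrite powR1 !subrr normr0 mulr0.
  have -> : w `^ (a - 1) - 1 = \int[mu]_(v in `[1, w]) ((a - 1) * v `^ (a - 1 - 1)).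
    rewrite (@Rint_FTC2 _ (fun v : R => v `^ (a - 1))) ?powR1//.
    - by move=> u /andP[u1 _]; exact: dpow.
    - by apply: cont_onM; [exact: cont_on_cst|exact: cpow].
  apply: Rint_le_bound => //.
    by apply: cont_onM; [exact: cont_on_cst|exact: cpow].
  move=> u /andP[u1 uw]; rewrite normrM ler_wpM2l// ger0_norm ?powR_ge0//.
  by rewrite -addrA -opprD; apply: hm; rewrite u1 (le_trans uw).
have step2 w : 1 <= w <= 2 -> `|w `^ a - 1 - a * (w - 1)| <= K * (w - 1) ^+ 2.
  move=> /andP[]; rewrite le_eqVlt => /predU1P[<- _|w1 w2].
    by rewrite powR1 !subrr mulr0 subrr normr0 expr0n mulr0.
  have cf : cont_on (fun v : R => a * v `^ (a - 1) + - a) 1 w.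
    by apply: cont_onD; [apply: cont_onM; [exact: cont_on_cst|exact: cpow]|exact: cont_on_cst].
  have -> : w `^ a - 1 - a * (w - 1) = \int[mu]_(v in `[1, w]) (a * v `^ (a - 1) + - a).
    rewrite (@Rint_FTC2 _ (fun v : R => v `^ a + - a * v))// ?powR1; first by ring.
    move=> u /andP[u1 _]; have d1 := dpow a u u1.
    have d2 : is_derive u 1 (fun v : R => - a * v) (- a).
      by apply: is_derive_eq; rewrite /GRing.scale /=; ring.
    exact: is_deriveD.
  apply: le_trans (_ : a * (`|a - 1| * m * (w - 1)) * (w - 1) <= _).
    apply: Rint_le_bound => // u /andP[u1 uw].
    rewrite (_ : _ - a = a * (u `^ (a - 1) - 1)); last by ring.
    rewrite normrM (gtr0_norm a0); apply: ler_wpM2l; first exact: ltW.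
    apply: le_trans (step1 u _) _; first by rewrite u1 (le_trans uw).
    by apply: ler_wpM2l; [rewrite mulr_ge0// ltW|rewrite lerD2r].
  rewrite (_ : _ * _ = a * (`|a - 1| * m) * (w - 1) ^+ 2); last by ring.
  by apply: ler_wpM2r; [exact: sqr_ge0|rewrite lerDl].
move=> lam d lam0 /andP[d0 dl]; pose w := 1 + d / lam.
have w12 : 1 <= w <= 2.
  rewrite /w lerDl divr_ge0 ?(ltW lam0)//= (_ : 2 = 1 + 1) ?lerD2l ?ler_pdivrMr ?mul1r//; ring.
have w0 : 0 <= w by case/andP: w12 => h _; exact: le_trans h.
have lw : lam + d = lam * w by rewrite /w; field; rewrite gt_eqF.
have wd : w - 1 = d / lam by rewrite /w; ring.
have l1 : lam `^ a = lam `^ (a - 1) * lam.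
  by rewrite -[X in _ * X](powRr1 (ltW lam0)) -powRD ?subrK// (gt_eqF lam0) implybT.
have l2 : lam `^ a = lam `^ (a - 2) * lam ^+ 2.
  by rewrite -(powR_mulrn _ (ltW lam0)) -powRD ?subrK// (gt_eqF lam0) implybT.
rewrite lw powRM ?(ltW lam0)//.
have -> : lam `^ a * w `^ a - lam `^ a - a * lam `^ (a - 1) * d = lam `^ a * (w `^ a - 1 - a * (w - 1)).
  by rewrite wd l1; field; rewrite gt_eqF.
rewrite normrM (ger0_norm (powR_ge0 _ _)).
apply: le_trans (ler_wpM2l (powR_ge0 _ _) (step2 w w12)) _.
rewrite wd l2 le_eqVlt; apply/orP; left; apply/eqP; field; rewrite gt_eqF//.
Qed.

End power_taylor.

Section wave_packet.
Context {R : realType}.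
Variables (lam rho : R).
Hypotheses (rho_gt0 : 0 < rho).

Definition packet (xi : R) : R := chi ((xi - lam) / rho).

Lemma continuous_packet : continuous packet.
Proof.
move=> x; apply: (@continuous_comp _ _ _ (fun xi => (xi - lam) / rho) chi); last exact: continuous_chi.
by apply: cvgM; [apply: cvgB; [exact: cvg_id|exact: cvg_cst]|exact: cvg_cst].
Qed.

Lemma packet_supp xi : packet xi != 0 -> lam <= xi <= lam + rho.
Proof.
move=> h; have : 0 <= (xi - lam) / rho <= 1 by apply: contraNT h => /chi_out e; apply/eqP.
rewrite pmulr_lge0 ?invr_gt0// subr_ge0 ler_pdivrMr// mul1r => /andP[-> h2] /=.
by rewrite -lerBlDl.
Qed.

Lemma packet_ge0 xi : 0 <= packet xi. Proof. exact: chi_ge0. Qed.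

Lemma packet_integral : packet \is_int /\ \int[mu]_xi packet xi = rho * chi_mass.
Proof.
have E := @integral_affine _ chi rho^-1 lam _ continuous_chi chi_ge0.
rewrite invr_gt0 rho_gt0 in E; have {}E := E isT.
have pE xi : rho^-1 * chi (rho^-1 * (xi - lam)) = rho^-1 * packet xi by rewrite /packet (mulrC rho^-1 (xi - lam)).
have h : (fun xi => rho^-1 * packet xi) \is_int.
  apply: intP; first by apply: measurable_funM => //; apply: continuous_measurable_fun; exact: continuous_packet.
  have -> : (\int[mu]_x `|(rho^-1 * packet x)%R|%:E = \int[mu]_x (chi x)%:E)%E.
    rewrite -E; apply: eq_integral => x _; rewrite pE ger0_norm//.
    by rewrite mulr_ge0 ?invr_ge0 ?(ltW rho_gt0) ?packet_ge0.
  by rewrite -Rint_EFin ?ltry//; exact: int_chi.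
have ip : packet \is_int.
  by have := intZ rho h; under eq_fun do rewrite mulrA divff ?gt_eqF// mul1r.
split => //; have F := Rint_affine lam (_ : 0 < rho^-1) continuous_chi int_chi.
rewrite invr_gt0 in F; have {}F := F rho_gt0.
rewrite /chi_mass -F; under [in RHS]eq_Rintegral do rewrite pE.
by rewrite RintegralZl// mulrA divff ?gt_eqF// mul1r.
Qed.

Definition cpacket (xi : R) : R[i] := (packet xi)%:C%C.

Lemma cabs_cpacket xi : cabs (cpacket xi) = packet xi.
Proof. by rewrite cabsR ger0_norm// packet_ge0. Qed.

Lemma cmeas_cpacket : cmeas cpacket.
Proof. by apply: cmeasR; apply: continuous_measurable_fun; exact: continuous_packet. Qed.

Lemma int_cpacket : (fun xi => cabs (cpacket xi)) \is_int.
Proof. by under eq_fun do rewrite cabs_cpacket; have [] := packet_integral. Qed.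

Lemma packet_inversion : exists h : R -> R[i], [/\ cmeas h, 
  (exists M, forall x, cabs (h x) <= M * (oneDsqr x)^-1) &
  forall y, cintegral (fun x => h x * cis (- (y * x))) = cpacket y].
Proof.
have [kap k0 inv] := @chat_inversion R; have [C C0 hC] := @cabs_chat_le R.
(* Modulation by [lam] and dilation by [rho] of [chat], divided by the inversion constant: its
   transform is exactly the packet. *)
pose h x := kap^-1 * (rho%:C%C * (cis (lam * x) * chat (rho * x))).
have clin (p : R) : continuous (fun x : R => p * x).
  by move=> x; apply: cvgM; [exact: cvg_cst|exact: cvg_id].
have cch : ccontinuous (fun x => chat (rho * x)).
  have [cr ci] := @ccontinuous_chat R; split => x.
    by apply: (@continuous_comp _ _ _ (fun x => rho * x) (fun v => complex.Re (chat v))); [exact: clin|exact: cr].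
  by apply: (@continuous_comp _ _ _ (fun x => rho * x) (fun v => complex.Im (chat v))); [exact: clin|exact: ci].
pose M := C * (1 + rho^-1 ^+ 2).
have hM x : cabs (chat (rho * x)) <= M * (oneDsqr x)^-1.
  apply: le_trans (hC _) _; rewrite -mulrA; apply: ler_wpM2l; first exact: ltW.
  rewrite ler_pdivlMr ?oneDsqr_gt0// mulrC ler_pdivrMr ?oneDsqr_gt0// /oneDsqr /=.
  rewrite (_ : _ * (1 + _) = 1 + x ^+ 2 + (rho ^+ 2 * x ^+ 2 + rho^-1 ^+ 2)); last first.
    by rewrite exprMn; field; rewrite gt_eqF.
  rewrite lerDl; apply: addr_ge0; last exact: sqr_ge0.
  by apply: mulr_ge0; exact: sqr_ge0.
exists h; split.
- apply: cmeasM; first exact: cmeas_cst.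
  apply: cmeasM; first exact: cmeas_cst.
  apply: cmeasM; first by apply: cmeas_cis; exact: measurable_funM.
  exact: ccontinuous_cmeas.
- exists (cabs kap^-1 * (rho * M)) => x.
  rewrite !cabsM cis_abs mul1r cabsR (gtr0_norm rho_gt0) -mulrA.
  apply: ler_wpM2l; first exact: cabs_ge0.
  rewrite -mulrA; by apply: ler_wpM2l; [exact: ltW|exact: hM].
move=> y; have [iX _] := @chat_int R; have cX := @ccontinuous_chat R.
pose z := (y - lam) / rho.
have cf : ccontinuous (fun v => chat v * cis (- (z * v))).
  by apply: ccontinuousM => //; apply: ccontinuous_cis => v; apply: cvgN; exact: clin.
have jf : cintegrable (fun v => chat v * cis (- (z * v))).
  apply: cintegrable_osc => //; first exact: ccontinuous_cmeas.
  by apply: measurable_funN; exact: measurable_funM.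
have E := cintegral_affine 0 rho_gt0 cf jf.
have ci : cintegrable (fun x => rho%:C%C * (cis (lam * x) * chat (rho * x) * cis (- (y * x)))).
  apply: (@cintegrable_le _ _ (fun x => rho * (M * (oneDsqr x)^-1))).
  - apply: cmeasM; first exact: cmeas_cst.
    apply: cmeasM; last by apply: cmeas_cis; apply: measurable_funN; exact: measurable_funM.
    apply: cmeasM; first by apply: cmeas_cis; exact: measurable_funM.
    exact: ccontinuous_cmeas.
  - move=> x; rewrite !cabsM !cis_abs mul1r mulr1 cabsR (gtr0_norm rho_gt0).
    by apply: ler_wpM2l; [exact: ltW|exact: hM].
  - by apply: intZ; apply: intZ; exact: int_oneDsqr.
rewrite (@eq_cintegral _ _ (fun x => kap^-1 * (rho%:C%C * (cis (lam * x) * chat (rho * x) * cis (- (y * x)))))); last first.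
  by move=> x; rewrite /h !mulrA.
rewrite cintegralZ// (@eq_cintegral _ _ (fun x => rho%:C%C * (chat (rho * (x - 0)) * cis (- (z * (rho * (x - 0))))))).
  by rewrite E inv mulKf.
move=> x; rewrite subr0 (mulrC (cis (lam * x))) -mulrA -cisD; congr (_ * (_ * cis _)).
by rewrite /z; field; rewrite gt_eqF.
Qed.

End wave_packet.

(** Expanding the phase at [lam], the linear term is at most 1/4 on the support by the first
    smallness condition and the Taylor remainder by the second. Together they stay within the 1/2
    that excludes cancellation. *)
Lemma osc_packet_lower (R : realType) (a : R) : 0 < a -> exists2 K, 0 < K & forall lam rho t x : R,
  0 < rho -> 0 < lam -> rho <= lam -> 0 <= t ->
  `|x + t * (a * lam `^ (a - 1))| * rho <= 4^-1 -> t * (K * lam `^ (a - 2)) * rho ^+ 2 <= 4^-1 ->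
  2^-1 * (rho * chi_mass) <= cabs (osc a (cpacket lam rho) t x).
Proof.
move=> a0; have [K K0 hK] := powR_taylor a0; exists K => // lam rho t x rho_gt0 lam0 rl t0 h1 h2.
have [ip <-] := packet_integral lam rho_gt0.
apply: (phase_lower (th0 := x * lam + t * lam `^ a)) => //.
- exact: packet_ge0.
- exact: measurable_phase.
move=> u /(packet_supp rho_gt0) /andP[u1 u2].
have ul : 0 <= u - lam <= lam by rewrite subr_ge0 u1 lerBlDl (le_trans u2)// lerD2l.
have := hK lam (u - lam) lam0 ul; rewrite (addrC lam) subrK; set D := _ - _ - _ => hD.
have u0 : 0 <= u by apply: le_trans u1; exact: ltW.
rewrite (ger0_norm u0).
have ur : 0 <= u - lam <= rho by rewrite subr_ge0 u1 lerBlDl.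
have -> : x * u + t * u `^ a - (x * lam + t * lam `^ a) =
    (x + t * (a * lam `^ (a - 1))) * (u - lam) + t * D by rewrite /D; ring.
case/andP: ur => d0 dr.
apply: le_trans (ler_normD _ _) _; rewrite !normrM (ger0_norm t0) (ger0_norm d0).
have b1 : `|x + t * (a * lam `^ (a - 1))| * (u - lam) <= 4^-1.
  by apply: le_trans h1; apply: ler_wpM2l.
have b2 : t * `|D| <= 4^-1.
  apply: le_trans h2; rewrite -mulrA; apply: ler_wpM2l => //.
  apply: le_trans hD _; apply: ler_wpM2l; first by rewrite mulr_ge0 ?powR_ge0// ltW.
  exact: ler_sqr_ge0.
lra.
Qed.

(** * Integrable functions as tempered distributions *)

Section decaying_distributions.
Context {R : realType}.

Lemma eq_cintegral_ae (f g : R -> R[i]) : cmeas f -> cmeas g ->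
  {ae mu, forall x, f x = g x} -> cintegral f = cintegral g.
Proof.
move=> [fr fi] [gr gi] fg; apply: cplx_ext.
  rewrite /= /Rintegral; congr fine; apply: ae_eq_integral => //.
  - exact/measurable_EFinP.
  - exact/measurable_EFinP.
  - by apply: aeS fg => x e _; rewrite /re_part /= e.
rewrite /= /Rintegral; congr fine; apply: ae_eq_integral => //.
- exact/measurable_EFinP.
- exact/measurable_EFinP.
- by apply: aeS fg => x e _; rewrite /im_part /= e.
Qed.

Lemma cintegrable_bounded (g phi : R -> R[i]) (M : R) : cmeas g -> (forall x, cabs (g x) <= M) ->
  cmeas phi -> (fun x => cabs (phi x)) \is_int -> cintegrable (fun x => g x * phi x).
Proof.
move=> mg gM mp ip; apply: (@cintegrable_le _ _ (fun x => M * cabs (phi x))).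
- exact: cmeasM.
- by move=> x; rewrite cabsM; apply: ler_wpM2r; [exact: cabs_ge0|exact: gM].
- exact: intZ.
Qed.

Lemma schwartz_int (phi : R -> R[i]) : schwartz phi -> cmeas phi /\ (fun x => cabs (phi x)) \is_int.
Proof.
move=> sp; have mp := schwartz_cmeas sp; have [M _ hM] := schwartz_decay sp.
by have [_ ip _] := decay_int mp hM.
Qed.

Lemma schwartz_seminorm00 (phi : R -> R[i]) : schwartz phi -> exists2 S : R,
  schwartz_seminorm 0 0 phi = S%:E & forall x, cabs (phi x) <= S.
Proof.
move=> [_ sn]; have fin := sn 0%N 0%N; exists (fine (schwartz_seminorm 0 0 phi)).
  rewrite fineK// ge0_fin_numE//; apply: (@le_trans _ _ (`|0:R| ^+ 0 * cabs (cderiven 0 phi 0))%:E).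
    by rewrite lee_fin mulr_ge0 ?exprn_ge0// cabs_ge0.
  by apply: ereal_sup_ubound; exists 0.
move=> x; have le : ((cabs (phi x))%:E <= schwartz_seminorm 0 0 phi)%E.
  apply: ereal_sup_ubound; exists x => //; rewrite expr0 mul1r; congr ((cabs _)%:E).
  exact: cplx_ext.
rewrite -lee_fin fineK// ge0_fin_numE//; apply: le_trans le.
by rewrite lee_fin cabs_ge0.
Qed.

Variables (h : R -> R[i]).
Hypotheses (mh : cmeas h) (ih : (fun x => cabs (h x)) \is_int).

Let ihp (phi : R -> R[i]) : schwartz phi -> cintegrable (fun x => h x * phi x).
Proof.
move=> sp; have [S _ pS] := schwartz_seminorm00 sp; have [mp _] := schwartz_int sp.
have := cintegrable_bounded mp pS mh ih.
by under eq_fun do rewrite mulrC.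
Qed.

Lemma integrable_tempered : tempered_distribution (distr_of_fun h).
Proof.
split.
  move=> c phi psi sp sq; rewrite /distr_of_fun.
  have ic : cintegrable (fun x => c * (h x * phi x)).
    apply: (@cintegrable_le _ _ (fun x => cabs c * cabs (h x * phi x))).
    - apply: cmeasM; first exact: cmeas_cst.
      by apply: cintegrable_cmeas; exact: ihp.
    - by move=> x; rewrite cabsM.
    - by apply: intZ; apply: cintegrable_cabs; exact: ihp.
  rewrite -cintegralZ; last exact: ihp.
  rewrite -cintegralD//; last exact: ihp.
  by apply: eq_cintegral => x; rewrite mulrDr mulrCA.
exists 0%N, (\int[mu]_x cabs (h x)) => phi sp.
have [S SE pS] := schwartz_seminorm00 sp.
rewrite !big_ord1 SE -EFinM lee_fin; apply: le_trans (le_cabs_cintegral (ihp sp)) _.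
rewrite mulrC -RintegralZl//; apply: le_Rintegral => //.
- by apply: cintegrable_cabs; exact: ihp.
- exact: intZ.
- by move=> x _; rewrite cabsM mulrC; apply: ler_wpM2r; [exact: cabs_ge0|exact: pS].
Qed.

Lemma integrable_fourier_density (g : R -> R[i]) : cmeas g ->
  (forall y, cintegral (fun x => h x * cis (- (y * x))) = g y) ->
  is_density (distr_fourier (distr_of_fun h)) g.
Proof.
move=> mg hg; split => // phi sp; have [mp ip] := schwartz_int sp.
have gM y : cabs (g y) <= \int[mu]_x cabs (h x).
  rewrite -hg; apply: le_trans (le_cabs_cintegral _) _.
    by apply: cintegrable_osc => //; apply: measurable_funN; exact: measurable_funM.
  rewrite le_eqVlt; apply/orP; left; apply/eqP; apply: eq_Rintegral => x _.
  by rewrite cabsM cis_abs mulr1.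
split; first exact: cintegrable_bounded mg gM mp ip.
pose F (p : R * R) := h p.1 * (phi p.2 * cis (- (p.2 * p.1))).
have mF : cmeas F.
  apply: cmeasM; first by apply: cmeas_comp => //; exact: measurable_fst.
  apply: cmeasM; first by apply: cmeas_comp => //; exact: measurable_snd.
  by apply: cmeas_cis; apply: measurable_funN; apply: measurable_funM; [exact: measurable_snd|exact: measurable_fst].
have bF x y : cabs (F (x, y)) <= cabs (h x) * cabs (phi y).
  by rewrite /F !cabsM cis_abs mulr1.
rewrite /distr_fourier /distr_of_fun.
transitivity (cintegral (fun x => cintegral (fun y => F (x, y)))).
  apply: eq_cintegral => x; rewrite /fourier -cintegralZ//.
  by apply: cintegrable_osc => //; apply: measurable_funN; exact: measurable_funM.
rewrite (cfubini mF ih ip bF); apply: eq_cintegral => y.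
rewrite -hg mulrC -cintegralZ; last first.
  by apply: cintegrable_osc => //; apply: measurable_funN; exact: measurable_funM.
by apply: eq_cintegral => x; rewrite /F /= mulrCA.
Qed.

End decaying_distributions.

Section packet_function.
Context {R : realType}.
Variables (a s lam rho : R).
Hypotheses (s_gt0 : 0 < s) (rho_gt0 : 0 < rho) (lam_ge1 : 1 <= lam) (rho_le : rho <= lam).

Let mG := @cmeas_cpacket R lam rho.
Let iG := int_cpacket lam rho_gt0.

(** On the support [|xi| <= lam + rho <= 2 lam], and [1 <= lam], so [1 + |xi|^2 <= 5 lam^2]; the
    packet lies between 0 and 1, so its square is at most itself. *)
Let weight_le xi : bessel_weight s xi * packet lam rho xi ^+ 2 <=
  (5 * lam ^+ 2) `^ s * packet lam rho xi.
Proof.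
have [->|p0] := eqVneq (packet lam rho xi) 0; first by rewrite expr0n !mulr0.
have /andP[x1 x2] := packet_supp rho_gt0 p0.
have l0 : 0 <= lam by apply: le_trans lam_ge1.
have x0 : 0 <= xi by exact: le_trans x1.
apply: ler_pM.
- exact: powR_ge0.
- exact: sqr_ge0.
- apply: ler_powRl; [exact: ltW|by rewrite addr_ge0// sqr_ge0|].
  have h1 : 1 <= lam ^+ 2 by exact: exprn_ege1.
  have h2 : `|xi| ^+ 2 <= (2 * lam) ^+ 2.
    apply: ler_sqr_ge0; first exact: normr_ge0.
    by rewrite ger0_norm// (le_trans x2)// mulr_natl mulr2n lerD2l.
  by rewrite exprMn in h2; lra.
- by rewrite expr2; apply: ler_piMl; [exact: packet_ge0|exact: chi_le1].
Qed.

Let weight_int : (fun xi => bessel_weight s xi * cabs (cpacket lam rho xi) ^+ 2) \is_int.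
Proof.
have [ip _] := packet_integral lam rho_gt0.
apply: (int_le _ _ (intZ ((5 * lam ^+ 2) `^ s) ip)) => [|xi].
  apply: measurable_funM; last by apply: measurable_funX; exact: measurable_cabs.
  apply: (measurableT_comp (measurable_powR s)); apply: measurable_funD => //.
  by apply: measurable_funX; exact: normr_measurable.
rewrite ger0_norm; last by apply: mulr_ge0; [exact: powR_ge0|exact: sqr_ge0].
by rewrite cabs_cpacket; exact: weight_le.
Qed.

(** The packet is realised as the transform of the decaying [h], which yields a genuine tempered
    distribution. Both [fhat] and the means are only chosen representatives, so their explicit forms
    hold almost everywhere, by uniqueness of densities. *)
Lemma packet_function : exists f : functional R, [/\ sobolev s f,
  energy s f <= (5 * lam ^+ 2) `^ s * (rho * chi_mass) &
  forall t, {ae mu, forall x, schrodinger_mean a f t x =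
    ((2 * pi)^-1)%:C%C * osc a (cpacket lam rho) t x}].
Proof.
have [h [mh [M hM] inv]] := packet_inversion lam rho_gt0.
have [_ ih _] := decay_int mh hM.
pose f := distr_of_fun h; exists f.
have dG : is_density (distr_fourier f) (cpacket lam rho).
  exact: integrable_fourier_density.
have dF := xgetPex (fun=> 0) (ex_intro _ _ dG : exists g, [set g | is_density (distr_fourier f) g] g).
have aeG : {ae mu, forall xi, fhat f xi = cpacket lam rho xi} by exact: density_unique dF dG.
have mF : cmeas (fhat f) by have [] := dF.
have [ip pE] := packet_integral lam rho_gt0.
have mw : measurable_fun setT (fun xi : R => bessel_weight s xi).
  apply: (measurableT_comp (measurable_powR s)); apply: measurable_funD => //.
  by apply: measurable_funX; exact: normr_measurable.
have IE : (\int[mu]_xi (bessel_weight s xi * cabs (fhat f xi) ^+ 2)%:E =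
    (\int[mu]_xi (bessel_weight s xi * cabs (cpacket lam rho xi) ^+ 2))%:E)%E.
  rewrite Rint_EFin; last exact: weight_int.
  apply: ae_eq_integral => //.
  - apply/measurable_EFinP; apply: measurable_funM => //.
    by apply: measurable_funX; exact: measurable_cabs.
  - apply/measurable_EFinP; apply: measurable_funM => //.
    by apply: measurable_funX; exact: measurable_cabs.
  - by apply: aeS aeG => xi e _; rewrite e.
have sf : sobolev s f.
  split; first exact: integrable_tempered.
  split; first by exists (cpacket lam rho).
  rewrite /sobolev_norm; apply: poweR_lty.
  by rewrite [X in (X < _)%E]IE ltry.
split => //.
  rewrite -pE -RintegralZl// -lee_fin /energy Rint_EFin; last exact: fhat_int.
  rewrite IE lee_fin; apply: le_Rintegral => //; first exact: intZ.
  by move=> xi _; rewrite cabs_cpacket; exact: weight_le.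
move=> t; pose c : R[i] := ((2 * pi)^-1)%:C%C.
have mcis : cmeas (fun xi : R => cis (t * `|xi| `^ a)).
  by apply: cmeas_cis; apply: measurable_funM => //; exact: measurable_abspow.
have mosc : cmeas (osc a (cpacket lam rho) t).
  by apply: (@cmeas_osc_t _ a (cpacket lam rho) (fun=> t)).
have dens : is_density (distr_inv_fourier (distr_of_fun (fun xi => cis (t * `|xi| `^ a) * fhat f xi)))
    (fun x => c * osc a (cpacket lam rho) t x).
  split; first by apply: cmeasM => //; exact: cmeas_cst.
  move=> phi sp; have [mp ipp] := schwartz_int sp; split.
    apply: (@cintegrable_bounded _ _ _ (cabs c * \int[mu]_xi cabs (cpacket lam rho xi))) => //.
      by apply: cmeasM => //; exact: cmeas_cst.
    move=> x; rewrite cabsM; apply: ler_wpM2l; first exact: cabs_ge0.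
    apply: le_trans (le_cabs_cintegral _) _.
      by apply: cintegrable_osc => //; exact: measurable_phase.
    rewrite le_eqVlt; apply/orP; left; apply/eqP; apply: eq_Rintegral => xi _.
    by rewrite cabsM cis_abs mulr1.
  rewrite /distr_inv_fourier [RHS](osc_pairing a t mG iG mp ipp).
  have mi := cmeas_inv_fourier mp ipp.
  apply: eq_cintegral_ae.
  - by apply: cmeasM => //; exact: cmeasM.
  - by apply: cmeasM => //; exact: cmeasM.
  - by apply: aeS aeG => xi ->.
have dm := xgetPex (fun=> 0) (ex_intro _ _ dens : exists g, [set g | is_density _ g] g).
exact: density_unique dm dens.
Qed.

End packet_function.

(** * From (c) to (a) *)

Section necessity.
Context {R : realType}.
Variables (a s : R) (t : nat -> R) (C2 : R).
Hypotheses (a_gt0 : 0 < a) (s_gt0 : 0 < s) (s_lt : s < a / 4).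
Hypotheses (t_decr : nonincreasing_seq t) (t_lim : t n @[n --> \oo] --> (0 : R)).
Hypothesis dt_decr : nonincreasing_seq (fun n : nat => t n - t n.+1).
Hypothesis weak : forall f : functional R, sobolev s f -> forall alpha : R, 0 < alpha ->
  (@lebesgue_measure R [set x : R | (alpha%:E < schrodinger_maximal a t f x)%E]
    <= (C2 * alpha ^- 2)%:E * sobolev_norm s f `^ 2)%E.

Let t_ge0 n : 0 <= t n. Proof. exact: (decr_to0_ge0 t_decr t_lim). Qed.

Let ae_le_measure (A B : set R) : measurable A -> measurable B ->
  {ae mu, forall x, A x -> B x} -> ((@lebesgue_measure R) A <= (@lebesgue_measure R) B)%E.
Proof.
move=> mA mB [N [mN N0 hN]].
have AB : A `<=` B `|` N.
  move=> x Ax; have [Bx|nB] := pselect (B x); first by left.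
  by right; apply: hN => /= /(_ Ax).
apply: (@le_trans _ _ (mu (B `|` N))).
  by apply: le_measure => //; rewrite inE//; exact: measurableU.
apply: (le_trans (@measureU2 _ _ _ (@lebesgue_measure R) B N mB mN)).
by rewrite [X in (_ + X)%E]N0 adde0.
Qed.

(** The weak type inequality for a single packet at half its guaranteed size. The level set contains
    almost all of [[- l, 0[], so [l] is at most a constant times [rho^-2] times the energy
    [lam^(2 s) rho]. *)
Lemma packet_test : exists K D : R, [/\ 0 < K, 0 < D & forall lam rho l : R,
  1 <= lam -> 0 < rho -> rho <= lam -> 0 <= l ->
  (forall x, - l <= x < 0 -> exists n, `|x + t n * (a * lam `^ (a - 1))| * rho <= 4^-1 /\
     t n * (K * lam `^ (a - 2)) * rho ^+ 2 <= 4^-1) ->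
  l * rho <= D * (lam ^+ 2) `^ s].
Proof.
have I0 : 0 < chi_mass :> R by exact: chi_mass_gt0.
have [K K0 hK] := osc_packet_lower a_gt0.
(* Here [64 pi^2] comes from the inverse square of the level, [5^s] from the energy bound, and one
   power of [chi_mass] survives in the denominator. *)
pose D0 : R := 64 * pi ^+ 2 * 5 `^ s / chi_mass.
have D00 : 0 < D0.
  apply: divr_gt0 => //; apply: mulr_gt0; last exact: powR_gt0.
  by apply: mulr_gt0 => //; apply: exprn_gt0; exact: pi_gt0.
exists K, ((`|C2| + 1) * D0); split => //; first by rewrite mulr_gt0// ltr_wpDl.
move=> lam rho l l1 r0 rl l0 cov.
have lam0 : 0 < lam by exact: lt_le_trans l1.
have [f [sf ef mean]] := packet_function a s_gt0 r0 l1 rl.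
(* The mean is at least [rho * chi_mass / (4 pi)] on the covered points; half of this makes the
   inequality strict. *)
pose al := rho * chi_mass / (8 * pi).
have p0 : 0 < (pi : R) by exact: pi_gt0.
have key1 (P : R) : 0 < P -> (2 * P)^-1 * (2^-1 * (rho * chi_mass)) = 2 * (rho * chi_mass / (8 * P)).
  by move=> P0; field; rewrite gt_eqF.
have key2 (P I c u v : R) : 0 < P -> 0 < I ->
    c * (rho * I / (8 * P)) ^- 2 * (u * v * (rho * I)) * rho = c * (64 * P ^+ 2 * u / I) * v.
  by move=> P0 I1; field; rewrite !gt_eqF.
have al0 : 0 < al by apply: divr_gt0; apply: mulr_gt0.
pose F := schrodinger_maximal a t f.
have mF : measurable_fun setT F.
  apply: (@measurable_sup_abs _ (fun n => schrodinger_mean a f (t n))) => n.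
  by have [] := mean_limit a s_gt0 sf (t n).
have mB : measurable [set x : R | (al%:E < F x)%E].
  by have := emeasurable_fun_o_infty measurableT mF al%:E; rewrite setTI.
have aeF : {ae mu, forall x : R, `[- l, 0[%classic x -> (al%:E < F x)%E}.
  have all_n : {ae mu, forall x n, schrodinger_mean a f (t n) x =
      ((2 * pi)^-1)%:C%C * osc a (cpacket lam rho) (t n) x} by exact: ae_foralln.
  apply: aeS all_n => x hx; rewrite /= in_itv /= => xl.
  have [n [h1 h2]] := cov x xl.
  have low := hK lam rho (t n) x r0 lam0 rl (t_ge0 n) h1 h2.
  apply: (@lt_le_trans _ _ (cabs (schrodinger_mean a f (t n) x))%:E); last first.
    by apply: ereal_sup_ubound; exists n.
  rewrite lte_fin hx cabsM cabsR ger0_norm ?invr_ge0 ?mulr_ge0 ?(ltW p0)//.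
  apply: (@lt_le_trans _ _ ((2 * pi)^-1 * (2^-1 * (rho * chi_mass)))); last first.
    by apply: ler_wpM2l => //; rewrite invr_ge0 mulr_ge0// ltW.
  rewrite (_ : (2 * pi)^-1 * (2^-1 * (rho * chi_mass)) = 2 * al); last exact: key1.
  by rewrite mulr_natl mulr2n ltrDl.
have le1 := ae_le_measure (@measurable_itv _ `[- l, 0[) mB aeF.
have le2 : ((l)%:E <= (C2 * al ^- 2)%:E * sobolev_norm s f `^ 2)%E.
  apply: le_trans (weak sf al0); apply: le_trans le1.
  rewrite lebesgue_measure_itv /= lte_fin; case: ltP => [_|h].
    by rewrite -EFinB sub0r opprK.
  by rewrite lee_fin -oppr_ge0.
have e0 := energy_ge0 s f.
move: le2; rewrite (sobolev_normE sf) poweR_EFin powR_mulrn ?sqrtr_ge0// sqr_sqrtr//.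
rewrite -EFinM lee_fin => le2.
have al2 : 0 < al ^+ 2 by exact: exprn_gt0.
have le3 : l <= (`|C2| + 1) * al ^- 2 * ((5 * lam ^+ 2) `^ s * (rho * chi_mass)).
  apply: le_trans le2 _; apply: (@le_trans _ _ ((`|C2| + 1) * al ^- 2 * energy s f)).
    apply: ler_wpM2r => //; apply: ler_wpM2r; first by rewrite invr_ge0 ltW.
    by apply: le_trans (ler_norm _) _; rewrite lerDl.
  by apply: ler_wpM2l => //; apply: mulr_ge0; [rewrite addr_ge0|rewrite invr_ge0 ltW].
have := ler_wpM2r (ltW r0) le3; congr (_ <= _).
by rewrite powRM ?sqr_ge0// /al /D0 key2.
Qed.

(** The gap at [n] is at most each of the [m - p] earlier gaps between [p] and [m], which add up to
    [t p - t m <= 2 b - b]. *)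
Lemma gaps_le b p m n : (p < m)%N -> (m <= n)%N -> t p <= 2 * b -> b < t m ->
  (t n - t n.+1) * (m - p)%:R <= b.
Proof.
move=> pm mn tp tm; pose d n := t n - t n.+1.
have dle i : (i < m)%N -> d n <= d i by move=> im; apply: dt_decr; exact: leq_trans (ltnW im) mn.
have : \sum_(p <= i < m) d n <= \sum_(p <= i < m) d i.
  by rewrite !big_nat; apply: ler_sum => i /andP[_ im]; exact: dle.
rewrite sumr_const_nat => h; rewrite mulr_natr.
apply: (@le_trans _ _ (\sum_(p <= i < m) d i)); first exact: h.
rewrite (eq_bigr (fun i => - (t i.+1 - t i))); last by move=> i _; rewrite opprB.
rewrite sumrN telescope_sumr; last exact: ltnW.
by rewrite opprB; lra.
Qed.

Lemma times_dense b p m tau : (p < m)%N -> t p <= 2 * b -> b < t m -> 0 < tau <= b ->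
  exists n, [/\ tau <= t n, t n <= 2 * b & (t n - tau) * (m - p)%:R <= b].
Proof.
move=> pm tp tm /andP[tau0 taub].
have ex : exists n, t n < tau.
  move/cvgr0_norm_lt : t_lim => /(_ _ tau0)[n _ /(_ n (leqnn n))] h; exists n.
  exact: le_lt_trans (ler_norm _) h.
(* The index before the first time below [tau] is used: its distance to [tau] is at most one gap,
   and that gap comes late enough to be short. *)
case: (ex_minnP ex) => n hn hmin.
have mn : (m < n)%N.
  rewrite ltnNge; apply/negP => nm; have := t_decr nm => h.
  by have := lt_le_trans tm (le_trans h (ltW hn)); rewrite ltNge taub.
case: n hn hmin mn => // n hn hmin mn; exists n.
have tn : tau <= t n by rewrite leNgt; apply/negP => /hmin; rewrite ltnn.
split => //.
  by apply: le_trans tp; apply: t_decr; exact: leq_trans (ltnW pm) mn.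
apply: le_trans (gaps_le pm mn tp tm); apply: ler_wpM2r => //.
by rewrite lerD2l lerN2 ltW.
Qed.

Let r := 2 * s / (a - 4 * s).
Let gam0 : 0 < a - 4 * s. Proof. by rewrite subr_gt0 mulrC -ltr_pdivlMr. Qed.
Let r0 : 0 < r. Proof. by rewrite divr_gt0// mulr_gt0. Qed.

(* The packet has [lam^(a/2) = k / sqrt b] and [rho = kap sqrt b^-1 lam^(1-a/2)]: the
   largest band width for which the phase is linear up to time [2b], and the largest
   frequency for which the gaps [b/k] are not resolved. *)
Lemma block_count : exists2 C, 0 <= C & forall b p m, 0 < b -> (p < m)%N ->
  t p <= 2 * b -> b < t m -> b `^ r * (m - p)%:R <= C.
Proof.
have [K [D [K0 D0 test]]] := packet_test.
(* Small enough for [kap <= 1], [a * kap <= 1/4] and [2 K kap^2 <= 1/4]: the packet narrower than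
   its frequency, and the two smallness conditions of the test. *)
pose kap := (1 + 4 * a + 8 * K)^-1.
have den0 : 0 < 1 + 4 * a + 8 * K by rewrite !addr_gt0// mulr_gt0.
have kap0 : 0 < kap by rewrite invr_gt0.
have k1 : kap <= 1 by rewrite invf_le1// -addrA lerDl addr_ge0// mulr_ge0// ltW.
have ka : a * kap <= 4^-1 by rewrite ler_pdivrMr// ; lra.
have kK : 2 * K * kap ^+ 2 <= 4^-1.
  have h : 2 * K * kap <= 4^-1.
    by rewrite /kap ler_pdivrMr//; move: (a_gt0) (K0); lra.
  apply: le_trans h; rewrite expr2 mulrA ler_piMr// mulr_ge0// ?mulr_ge0// ltW//.
(* The exponent for which [lam^(2 s) = y^e]. The hypothesis [s < a / 4] says [e < 1], so that
   [k <= D1 y^e] can be solved for [k]. *)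
pose e := 4 * s / a; have e0 : 0 < e by rewrite divr_gt0// mulr_gt0.
have e1 : e < 1 by rewrite ltr_pdivrMr// mul1r -subr_gt0.
pose D1 := D / (a * kap); have D10 : 0 < D1 by rewrite divr_gt0// mulr_gt0.
pose C := D1 `^ (1 - e)^-1 + t 0%N `^ r * Num.sqrt (t 0%N).
exists C; first by rewrite addr_ge0 ?powR_ge0// mulr_ge0 ?powR_ge0 ?sqrtr_ge0.
move=> b p m b0 pm tp tm; set k : R := (m - p)%:R.
have k1' : 1 <= k by rewrite ler1n subn_gt0.
have k0 : 0 < k by exact: lt_le_trans k1'.
pose q := Num.sqrt b; have q0 : 0 < q by rewrite sqrtr_gt0.
have qb : q ^+ 2 = b by rewrite sqr_sqrtr// ltW.
have bt : b <= t 0%N by apply: ltW; apply: lt_le_trans tm _; exact: t_decr.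
pose y := k / q; have y0 : 0 < y by rewrite divr_gt0.
(* For [y < 1] the frequency would drop below 1, but then [k < sqrt b] is already bounded through
   [b <= t 0]. *)
have [y1|y1] := ltP y 1.
  rewrite /C; apply: ler_wpDl; first exact: powR_ge0.
  apply: ler_pM; [exact: powR_ge0|exact: ltW| |].
    by apply: ler_powRl => //; exact: ltW.
  apply: (@le_trans _ _ q); last exact: ler_wsqrtr.
  by move: y1; rewrite /y ltr_pdivrMr// mul1r => /ltW.
pose lam := y `^ (2 / a).
have lam1 : 1 <= lam.
  apply: (@le_trans _ _ (1 `^ (2 / a))); first by rewrite powR1.
  by apply: ler_powRl => //; rewrite divr_ge0// ltW.
have lam0 : 0 < lam by exact: lt_le_trans lam1.
have lama : lam `^ a = y ^+ 2 by rewrite /lam -powRrM divfK ?gt_eqF// powR_mulrn// ltW.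
have lama1 : lam `^ (a - 1) = y ^+ 2 / lam.
  by rewrite powRD ?(gt_eqF lam0) ?implybT// lama powRN powRr1// ltW.
have lama2 : lam `^ (a - 2) = y ^+ 2 / lam ^+ 2.
  by rewrite powRD ?(gt_eqF lam0) ?implybT// lama powRN powR_mulrn// ltW.
pose rho := kap * lam / (q * y).
have qy : q * y = k by rewrite /y mulrC divfK// gt_eqF.
have rho0 : 0 < rho by rewrite divr_gt0// mulr_gt0.
have rhol : rho <= lam.
  by rewrite /rho qy ler_pdivrMr// mulrC ler_wpM2l ?(ltW lam0)// (le_trans k1).
have nz : [/\ lam != 0, q != 0, k != 0 & y != 0] by rewrite !gt_eqF.
have [lnz qnz knz ynz] := nz.
pose l := b * (a * lam `^ (a - 1)).
have c0 : 0 < a * lam `^ (a - 1) by rewrite mulr_gt0// powR_gt0.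
have l0 : 0 <= l by rewrite mulr_ge0// ltW.
have cov x : - l <= x < 0 -> exists n, `|x + t n * (a * lam `^ (a - 1))| * rho <= 4^-1 /\
     t n * (K * lam `^ (a - 2)) * rho ^+ 2 <= 4^-1.
  move=> /andP[x1 x2]; pose tau := - x / (a * lam `^ (a - 1)).
  have tau_b : 0 < tau <= b.
    by rewrite /tau divr_gt0 ?oppr_gt0//= ler_pdivrMr// lerNl.
  have [n [h1 h2 h3]] := times_dense pm tp tm tau_b; exists n; split.
    have -> : x + t n * (a * lam `^ (a - 1)) = (t n - tau) * (a * lam `^ (a - 1)).
      by rewrite mulrBl /tau divfK ?gt_eqF// opprK addrC.
    rewrite normrM (gtr0_norm c0) ger0_norm ?subr_ge0//.
    have h4 : t n - tau <= b / k by rewrite ler_pdivlMr.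
    apply: (@le_trans _ _ (b / k * (a * lam `^ (a - 1)) * rho)).
      by apply: ler_wpM2r; [exact: ltW|apply: ler_wpM2r => //; exact: ltW].
    apply: le_trans ka; rewrite lama1 /rho -qb -qy le_eqVlt; apply/orP; left; apply/eqP.
    by field; rewrite lnz qnz ynz.
  apply: (@le_trans _ _ (2 * b * (K * lam `^ (a - 2)) * rho ^+ 2)).
    apply: ler_wpM2r; first exact: sqr_ge0.
    by apply: ler_wpM2r => //; rewrite mulr_ge0 ?powR_ge0// ltW.
  apply: le_trans kK; rewrite lama2 /rho -qb le_eqVlt; apply/orP; left; apply/eqP.
  by field; rewrite lnz qnz ynz.
have main := test lam rho l lam1 rho0 rhol l0 cov.
have lame : (lam ^+ 2) `^ s = y `^ e.
  rewrite -(powR_mulrn _ (ltW lam0)) -powRrM /lam -powRrM; congr (_ `^ _).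
  by rewrite /e; field; rewrite gt_eqF.
(* With these choices [l * rho] is [a * kap * k], so the test inequality bounds [k] directly. *)
have kle : k <= D1 * y `^ e.
  have lr : l * rho = a * kap * k.
    rewrite /l /rho lama1 -qb -qy; field; rewrite ?lnz ?qnz ?ynz//.
  rewrite lr lame in main.
  by rewrite /D1 mulrAC ler_pdivlMr ?mulr_gt0// mulrC.
have ke : k `^ (1 - e) * b `^ (e / 2) <= D1.
  have ye : y `^ e = k `^ e * (b `^ (e / 2))^-1.
    rewrite /y powRM ?invr_ge0 ?(ltW k0) ?(ltW q0)//; congr (_ * _).
    have qE : q = b `^ 2^-1 by rewrite powR12_sqrt// ltW.
    by rewrite qE -[in LHS]powRN -powRrM -[RHS]powRN; congr (_ `^ _); field.
  have ke0 : 0 < k `^ e by exact: powR_gt0.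
  have be0 : 0 < b `^ (e / 2) by exact: powR_gt0.
  have kk : k = k `^ (1 - e) * k `^ e by rewrite -powRD ?subrK ?powRr1 ?(ltW k0)// (gt_eqF k0) implybT.
  rewrite ye {1}kk mulrA ler_pdivlMr// in kle.
  by rewrite -(ler_pM2r ke0) mulrAC.
have ie : 0 < 1 - e by rewrite subr_gt0.
rewrite /C; apply: ler_wpDr; first by rewrite mulr_ge0 ?powR_ge0 ?sqrtr_ge0.
have := ler_powRl (_ : 0 <= (1 - e)^-1) (_ : 0 <= k `^ (1 - e) * b `^ (e / 2)) ke.
rewrite invr_ge0 (ltW ie) mulr_ge0 ?powR_ge0// => /(_ isT isT).
rewrite powRM ?powR_ge0// -!powRrM divff ?gt_eqF// powRr1 ?(ltW k0)// mulrC.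
(* Taking the power [1 / (1 - e)] isolates [k] and puts on [b] the exponent
   [(2 s / a) / ((a - 4 s) / a)], which is [r]. *)
rewrite (_ : e / 2 / (1 - e) = r)//.
rewrite /e /r; field; rewrite ?gt_eqF//=.
Qed.

(** A downward closed set of indices is an initial segment, so its count is the first index outside
    it. This turns counts of times into positions in the sequence. *)
Lemma count_down (P : pred nat) N : (forall i j, (i <= j)%N -> P j -> P i) ->
  forall n, (n < N)%N -> P n = (n < count P (iota 0 N))%N.
Proof.
move=> dP; elim: N => // N ih n.
have -> : count P (iota 0 N.+1) = (count P (iota 0 N) + P N)%N.
  by rewrite -addn1 iotaD count_cat /= addn0 add0n.
have cN : (count P (iota 0 N) <= N)%N by rewrite -{2}(size_iota 0 N) count_size.
case PN: (P N).
  have -> : count P (iota 0 N) = N.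
    apply/eqP; rewrite -{2}(size_iota 0 N) -all_count; apply/allP => i.
    by rewrite mem_iota add0n => /andP[_ /ltnW iN]; exact: dP PN.
  by rewrite addn1 => nN; rewrite nN; exact: dP PN.
rewrite addn0 ltnS leq_eqVlt => /predU1P[->|nN]; last exact: ih.
by rewrite PN ltnNge cN.
Qed.

(** The times in [(b, 2 b]] are those with index from [c2] to [cb - 1]. [block_count] bounds the
    difference of these indices, one less than their number; the extra time costs [b^r <= t 0^r]. *)
Lemma doubling_count : exists2 C, 0 <= C & forall b N, 0 < b ->
  b `^ r * (count (fun n => b < t n) (iota 0 N))%:R <=
  b `^ r * (count (fun n => 2 * b < t n) (iota 0 N))%:R + C.
Proof.
have [C C0 hC] := block_count.
exists (C + t 0%N `^ r); first by rewrite addr_ge0// powR_ge0.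
move=> b N b0; set cb := count _ _; set c2 := count _ _.
have br : 0 <= b `^ r by exact: powR_ge0.
have down c : forall i j, (i <= j)%N -> c < t j -> c < t i.
  by move=> i j ij h; apply: lt_le_trans h _; exact: t_decr.
have cN (P : pred nat) : (count P (iota 0 N) <= N)%N by rewrite -{2}(size_iota 0 N) count_size.
have [cb0|cb0] := posnP cb; first by rewrite cb0 mulr0 !addr_ge0 ?powR_ge0// mulr_ge0.
have bt : b <= t 0%N.
  have N0 : (0 < N)%N by apply: leq_trans cb0 (cN _).
  by apply: ltW; rewrite (count_down (down b) N0).
have b1 : b `^ r <= t 0%N `^ r by apply: ler_powRl => //; exact: ltW.
(* With at most one time in [(b, 2 b]] there is no gap to use, and the extra term alone is
   enough. *)
have [le|lt] := leqP cb c2.+1.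
  apply: (@le_trans _ _ (b `^ r * c2.+1%:R)); first by apply: ler_wpM2l => //; rewrite ler_nat.
  by rewrite -natr1 mulrDr mulr1 lerD2l; apply: ler_wpDl.
have cbE : cb = (c2 + 1 + (cb.-1 - c2))%N.
  by rewrite addn1 addSn subnKC ?prednK// -ltnS prednK// ltnW.
have pm : (c2 < cb.-1)%N by rewrite -ltnS prednK.
have mN : (cb.-1 < N)%N by rewrite prednK// cN.
have tp : t c2 <= 2 * b.
  rewrite leNgt; apply/negP => h.
  by have := count_down (down (2 * b)) (ltn_trans pm mN); rewrite h -/c2 ltnn.
have tm : b < t cb.-1 by rewrite (count_down (down b) mN) -/cb prednK.
have := hC b c2 cb.-1 b0 pm tp tm => h.
rewrite {1}cbE !natrD !mulrDr mulr1 -addrA lerD2l addrC; exact: lerD.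
Qed.

(** Passing from [2 b] to [b] multiplies the weighted count by [2^-r < 1] and adds [C], so a bound
    at the top, where no time exceeds [b], persists down all scales. *)
Lemma weak_type_necessary : weak_ell (2 * s / (a - 4 * s)) t.
Proof.
have [C C0 hC] := doubling_count.
have c1 : 2 `^ (- r) < 1 :> R.
  by rewrite /powR pnatr_eq0 /= expR_lt1 mulNr oppr_lt0 mulr_gt0// ln_gt0// ltr1n.
have d0 : 0 < 1 - 2 `^ (- r) :> R by rewrite subr_gt0.
(* The fixed point of the recursion: [2^-r A + C = A]. *)
pose A := C / (1 - 2 `^ (- r)).
have A0 : 0 <= A by rewrite divr_ge0// ltW.
have bound j N : forall b, 0 < b -> t 0%N <= b * 2 ^+ j ->
    b `^ r * (count (fun n => b < t n) (iota 0 N))%:R <= A.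
  elim: j => [|j ih] b b0 hb.
    rewrite (_ : count _ _ = 0%N) ?mulr0//; apply/eqP; rewrite -leqn0 leqNgt -has_count.
    apply/hasPn => n _; rewrite -leNgt; apply: le_trans (_ : t n <= t 0%N) _; first exact: t_decr.
    by rewrite expr0 mulr1 in hb.
  apply: le_trans (hC b N b0) _.
  have h2 := ih (2 * b) (mulr_gt0 _ b0) _.
  have {}h2 : (2 * b) `^ r * (count (fun n => 2 * b < t n) (iota 0 N))%:R <= A.
    apply: h2 => //; rewrite (_ : 2 * b * 2 ^+ j = b * 2 ^+ j.+1)//.
    by rewrite exprS; ring.
  have E : b `^ r = 2 `^ (- r) * (2 * b) `^ r.
    by rewrite powRM ?(ltW b0)// mulrA -powRD ?addNr ?powRr0 ?mul1r// pnatr_eq0 implybT.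
  rewrite E -mulrA.
  apply: (@le_trans _ _ (2 `^ (- r) * A + C)).
    by rewrite lerD2r; apply: ler_wpM2l => //; exact: powR_ge0.
  by rewrite /A le_eqVlt; apply/orP; left; apply/eqP; field; rewrite gt_eqF.
apply: (@count_weak_ell _ _ A).
  move=> b b0; move/cvgr0_norm_lt : t_lim => /(_ _ b0)[N _ hN]; exists N => n Nn.
  by apply: ltW; exact: hN.
move=> b N b0; have [j hj] : exists j : nat, t 0%N <= b * 2 ^+ j.
  exists (Num.bound (t 0%N / b)); rewrite mulrC -ler_pdivrMr//.
  apply: le_trans (ltW (archi_boundP _)) _; first by rewrite divr_ge0// ltW.
  rewrite -natrX ler_nat ltnW// ltn_expl//.
apply: le_trans (bound j N b b0 hj); rewrite le_eqVlt; apply/orP; left; apply/eqP.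
by congr (_ * _%:R); apply: eq_count => n; rewrite ger0_norm.
Qed.

End necessity.

Theorem theorem1p2 (R : realType) (a s : R) (t : nat -> R)
  (a_gt0 : 0 < a) (a_neq1 : a != 1)
  (s_gt0 : 0 < s) (s_lt : s < a / 4)
  (t_decr : nonincreasing_seq t)
  (t_lim : t n @[n --> \oo] --> (0 : R))
  (dt_decr : nonincreasing_seq (fun n : nat => t n - t n.+1)) :
  let cond_a := weak_ell (2 * s / (a - 4 * s)) t in
  let cond_b := exists C1 : R, forall f : functional R, sobolev s f ->
    (Lnorm (@lebesgue_measure R) 2%:E (schrodinger_maximal a t f)
       <= C1%:E * sobolev_norm s f)%E in
  let cond_c := exists C2 : R, forall f : functional R, sobolev s f ->
    forall alpha : R, 0 < alpha ->
    (@lebesgue_measure R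
       [set x : R | (alpha%:E < schrodinger_maximal a t f x)%E]
       <= (C2 * alpha ^- 2)%:E * sobolev_norm s f `^ 2)%E in
  (cond_a <-> cond_b) /\ (cond_b <-> cond_c).
Proof.
move=> cond_a cond_b cond_c.
have ab : cond_a -> cond_b.
  move=> /(weak_ell_sufficient a_gt0 a_neq1 s_gt0 s_lt t_decr t_lim)[C C0 hC].
  by exists (Num.sqrt C); exact: strong_type.
have bc : cond_b -> cond_c by move=> [C hC]; exists (C ^+ 2); exact: weak_type.
have ca : cond_c -> cond_a.
  by move=> [C hC]; exact: (weak_type_necessary a_gt0 s_gt0 s_lt t_decr t_lim dt_decr hC).
split; split => h; [exact: ab|exact: ca (bc h)|exact: bc|exact: ab (ca h)].
Qed.
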